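(* Fix $\epsilon>0$, $B\in\mathbb{N}$ and $\lambda\geq 0$. Given $\textsc{rand\_neighbor}$ and $\textsc{rand\_vertex}$ probe access to an undirected $d$-regular graph $G$ on $n$ vertices with $\lambda(G)\leq\lambda$, there is a deterministic local access algorithm for random walks on $G$ (with parameters $\epsilon,B$) which uses $O\!\left(\log(nt)\frac{1}{1-\lambda}\log(nB/\epsilon)\right)$ additional (persistent) space and $O\!\left(\sqrt{n}\cdot\log(nt)\frac{1}{1-\lambda}\log^2(nB/\epsilon)\right)$ time and working space per query, where $t$ denotes the queried time.
   Context: For a regular graph $G$ on vertex set $[n]$ with random walk matrix $W$, $\lambda(G)=\max_{x\in\mathbb{R}^n,\,x\perp \mathbf{1}}\|Wx\|_2/\|x\|_2$. Probe access: $\textsc{rand\_neighbor}(v)$ returns a uniformly random neighbor of $v$, and $\textsc{rand\_vertex}$ returns a uniformly random vertex. Let $\mathcal{U}$ denote the distribution of (infinite) random walks on $G$ from a fixed start vertex (vertex $1$), and for a finite set of times $S$, let $P_S(\mathcal{U})$ be the joint distribution of the positions at times in $S$. A local access algorithm for $G$ is given $\epsilon>0$ and $B\in\mathbb{N}$ at initialization, then receives a sequence of time queries $t_1,\dots,t_r$ with $r\leq B$ (each query may depend on previous answers and on the algorithm's internal state), answering each query $t_i$ with a vertex $v_{t_i}$, such that the joint distribution $D$ of the answers $(v_{t_1},\dots,v_{t_r})$ satisfies $\|D-P_{\{t_1,\dots,t_r\}}(\mathcal{U})\|_1\leq\epsilon$ ($\ell_1$ distance $\sum_i|A_i-B_i|$).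 *)

(* Defs.v *)
From HB Require Import structures.
From mathcomp Require Import all_boot all_order all_algebra finmap.
From mathcomp Require Import all_classical all_reals all_analysis.

Set Implicit Arguments.
Unset Strict Implicit.
Unset Printing Implicit Defensive.

Import Order.TTheory GRing.Theory Num.Theory.

Local Open Scope ring_scope.

(** Finitely supported distributions are weighted lists of outcomes; an outcome
    may be listed several times. *)

Definition dist (R : realType) (A : Type) : Type := seq (R * A).

Definition dret (R : realType) (A : Type) (a : A) : dist R A := [:: (1, a)].

Definition dbind (R : realType) (A A' : Type) (D : dist R A)
    (f : A -> dist R A') : dist R A' :=
  flatten [seq [seq (p.1 * q.1, q.2) | q <- f p.2] | p <- D].

Definition dmap (R : realType) (A A' : Type) (f : A -> A') (D : dist R A)
    : dist R A' := [seq (p.1, f p.2) | p <- D].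

Definition uniform (R : realType) (A : Type) (s : seq A) : dist R A :=
  [seq ((size s)%:R^-1, a) | a <- s].

Definition is_dist (R : realType) (A : Type) (D : dist R A) : Prop :=
  all (fun p => 0 <= p.1) D /\ \sum_(p <- D) p.1 = 1.

Definition Pr (R : realType) (A : eqType) (D : dist R A) (a : A) : R :=
  \sum_(p <- D | p.2 == a) p.1.

(** The l1 distance, without the factor 1/2 of total variation. *)
Definition l1dist (R : realType) (A : eqType) (D D' : dist R A) : R :=
  \sum_(a <- undup (map snd D ++ map snd D')) `|Pr D a - Pr D' a|.

(** Every listed outcome satisfies [Q]. The distributions below on which this
    is used only contain outcomes of positive probability. *)
Definition dall (R : realType) (A : Type) (Q : A -> Prop) (D : dist R A)
    : Prop := foldr (fun p acc => Q p.2 /\ acc) True D.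

(** An undirected graph on n vertices is a symmetric [e : rel 'I_n]. Loops are
    allowed (a loop makes a vertex a neighbour of itself); simple graphs are the
    irreflexive ones. *)
Definition regular (n : nat) (e : rel 'I_n) (d : nat) : Prop :=
  forall v : 'I_n, #|[pred u | e v u]| = d.

Definition walk_mx (R : realType) (n : nat) (e : rel 'I_n) (d : nat)
    : 'M[R]_n := \matrix_(i, j) ((e i j)%:R / d%:R).

Definition norm2 (R : realType) (n : nat) (x : 'cV[R]_n) : R :=
  Num.sqrt (\sum_i x i ord0 ^+ 2).

(** The maximum is written as the supremum of a bounded set. For n = 1 the set
    is empty and the value is 0. *)
Definition lambda (R : realType) (n : nat) (e : rel 'I_n) (d : nat) : R :=
  sup [set norm2 (walk_mx R e d *m x) / norm2 x
      | x in [set x : 'cV[R]_n | x != 0 /\ \sum_i x i ord0 = 0]]%classic.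

(** Vertices are handed to the algorithm as numbers 0, ..., n - 1; the start
    vertex, called 1 in the vertex set {1, ..., n}, is the number 0. *)

Record oracle (R : realType) := Oracle {
  rand_vertex : dist R nat;
  rand_neighbor : nat -> dist R nat }.

Definition graph_oracle (R : realType) (n : nat) (e : rel 'I_n) : oracle R :=
  Oracle (uniform R [seq val u | u <- enum 'I_n])
    (fun v => if insub v is Some i
              then uniform R [seq val u | u <- enum [pred u | e i u]]
              else dret R 0%N).

(** The first k steps of the random walk from v: positions at times 0, ..., k.
    The joint law of the positions at a set of times bounded by k only depends
    on this prefix of the infinite walk. *)
Fixpoint walk (R : realType) (O : oracle R) (k v : nat) : dist R (seq nat) :=
  if k is k'.+1
  then dbind (rand_neighbor O v) (fun u => dmap (cons v) (walk O k' u))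
  else dret R [:: v].

(** The algorithms are run on a word RAM with probes. All values and addresses are [w]-bit words. Three memories, initially zero:
    registers and working memory are cleared at the start of each query, the
    persistent memory is kept from one query to the next. The inputs are
    read-only. The only source of randomness is the probes. *)

Definition mem : Type := {fsfun nat -> nat with 0%N}.

Definition upd (m : mem) (a v : nat) : mem := [fsfun m with a |-> v].

Definition mem0 : mem := [fsfun].

Definition bitlen (x : nat) : nat := (trunc_log 2 x).+1.

(** Space of a memory in bits: each non-zero cell is charged for its content and
    for its address, so that no information is stored for free in the choice of
    the cells that are used. *)
Definition space (m : mem) : nat :=
  (\sum_(a <- finsupp m) (bitlen a + bitlen (m a)))%N.

Inductive binop := Add | Sub | Mul | Div | Mod | Leq.

Inductive expr :=
  | Lit of nat
  | Inp of nat
  | Reg of nat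
  | PMem of expr
  | WMem of expr
  | Bin of binop & expr & expr.

Inductive cmd :=
  | Skip
  | SetReg of nat & expr
  | SetPMem of expr & expr
  | SetWMem of expr & expr
  | RandVertex of nat
  | RandNeighbor of nat & expr
  | Seq of cmd & cmd
  | If of expr & cmd & cmd
  | While of expr & cmd.

Record state := State { regs : mem; pmem : mem; wmem : mem }.

Definition set_reg (s : state) (x v : nat) : state :=
  State (upd (regs s) x v) (pmem s) (wmem s).
Definition set_pmem (s : state) (a v : nat) : state :=
  State (regs s) (upd (pmem s) a v) (wmem s).
Definition set_wmem (s : state) (a v : nat) : state :=
  State (regs s) (pmem s) (upd (wmem s) a v).

Definition eval_bin (o : binop) (x y : nat) : nat :=
  match o with
  | Add => (x + y)%N
  | Sub => (x - y)%N
  | Mul => (x * y)%N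
  | Div => (x %/ y)%N
  | Mod => (x %% y)%N
  | Leq => nat_of_bool (x <= y)%N
  end.

Fixpoint eval (w : nat) (inp : seq nat) (s : state) (f : expr) : nat :=
  (match f with
   | Lit x => x
   | Inp k => nth 0 inp k
   | Reg x => regs s x
   | PMem a => pmem s (eval w inp s a)
   | WMem a => wmem s (eval w inp s a)
   | Bin o f1 f2 => eval_bin o (eval w inp s f1) (eval w inp s f2)
   end %% 2 ^ w)%N.

(** A configuration is the stack of commands still to be executed, and a state.
    A machine with an empty stack has halted. *)
Definition config : Type := (seq cmd * state)%type.

Definition halted (c : config) : Prop := c.1 = [::].

(** One time step. An instruction may contain nested expressions; their size is
    bounded by a constant since the program is fixed before all parameters. *)
Definition step (R : realType) (O : oracle R) (w : nat) (inp : seq nat)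
    (c : config) : dist R config :=
  let s := c.2 in
  let ev := eval w inp s in
  match c.1 with
  | [::] => dret R c
  | Skip :: k => dret R (k, s)
  | SetReg x f :: k => dret R (k, set_reg s x (ev f))
  | SetPMem a f :: k => dret R (k, set_pmem s (ev a) (ev f))
  | SetWMem a f :: k => dret R (k, set_wmem s (ev a) (ev f))
  | RandVertex x :: k =>
      dmap (fun v => (k, set_reg s x v)) (rand_vertex O)
  | RandNeighbor x f :: k =>
      dmap (fun v => (k, set_reg s x v)) (rand_neighbor O (ev f))
  | Seq c1 c2 :: k => dret R (c1 :: c2 :: k, s)
  | If f c1 c2 :: k =>
      dret R ((if ev f == 0%N then c2 else c1) :: k, s)
  | While f c1 :: k =>
      dret R (if ev f == 0%N then k else c1 :: While f c1 :: k, s)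
  end.

Fixpoint steps (R : realType) (O : oracle R) (w : nat) (inp : seq nat)
    (k : nat) (c : config) : dist R config :=
  if k is k'.+1
  then dbind (step O w inp c) (steps O w inp k')
  else dret R c.

(** The algorithm: a program, run on a [word]-bit machine with probe access
    [probes] and read-only inputs [params] followed by the queried time; the
    run on query t is given [budget t] time steps. *)
Record algorithm (R : realType) := Algorithm {
  prog : cmd;
  probes : oracle R;
  word : nat;
  params : seq nat;
  budget : nat -> nat }.

Definition run (R : realType) (A : algorithm R) (M : mem) (t k : nat)
    : dist R config :=
  steps (probes A) (word A) (rcons (params A) t) k
    ([:: prog A], State mem0 M mem0).

(** The answer is read in register 0. *)
Definition answer (R : realType) (A : algorithm R) (M : mem) (t : nat)
    : dist R (nat * mem) :=
  dmap (fun c : config => (regs c.2 0%N, pmem c.2)) (run A M t (budget A t)).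

(** One entry per query: the queried time, the answer, and the internal state of
    the algorithm after the answer. *)
Definition history : Type := seq (nat * nat * mem).

Definition last_mem (h : history) : mem := last mem0 [seq z.2 | z <- h].

Definition transcript (h : history) : seq (nat * nat) := [seq z.1 | z <- h].

(** The queries may depend on the previous answers and internal states. *)
Definition adversary : Type := history -> nat.

Fixpoint real_run (R : realType) (A : algorithm R) (adv : adversary) (r : nat)
    : dist R history :=
  if r is r'.+1
  then dbind (real_run A adv r') (fun h =>
         dmap (fun z : nat * mem => rcons h (adv h, z.1, z.2))
              (answer A (last_mem h) (adv h)))
  else dret R [::].

(** The reference experiment: a walk x is drawn, and each query t is answered by
    x_t. Since the adversary also looks at internal states, these have to exist
    in the reference experiment too: they are produced by [sim] from the walk
    and the past. If [adv] ignores the internal states then [sim] plays no role,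
    and for constant queries t_1, ..., t_r the transcript is ((t_i, x_(t_i)))_i,
    with the answers following P_{t_1, ..., t_r}(U). *)
Fixpoint ideal_run (R : realType)
    (sim : seq nat -> history -> nat -> dist R mem)
    (adv : adversary) (x : seq nat) (r : nat) : dist R history :=
  if r is r'.+1
  then dbind (ideal_run sim adv x r') (fun h =>
         dmap (fun M : mem => rcons h (adv h, nth 0%N x (adv h), M))
              (sim x h (adv h)))
  else dret R [::].

(** [T] is any bound on the queried times. The simulator does not depend on the
    adversary. *)
Definition local_access (R : realType) (A : algorithm R) (T : nat)
    (eps : R) (B : nat) : Prop :=
  exists2 sim : seq nat -> history -> nat -> dist R mem,
    forall x h t, is_dist (sim x h t) &
    forall (adv : adversary) (r : nat),
      (forall h, adv h <= T)%N -> (r <= B)%N ->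
      l1dist (dmap transcript (real_run A adv r))
             (dmap transcript
                (dbind (walk (probes A) T 0) (fun x => ideal_run sim adv x r)))
        <= eps.

(** Worst-case resources of a query at time t asked in internal state M: every
    run halts within the time budget, the persistent memory never exceeds its
    size in M by more than [pspace t] bits, and registers and working memory
    never exceed [wspace t] bits. *)
Definition query_within (R : realType) (A : algorithm R) (pspace wspace : nat -> R)
    (M : mem) (t : nat) : Prop :=
  dall halted (run A M t (budget A t)) /\
  forall k : nat, dall (fun c : config =>
      (space (pmem c.2))%:R <= (space M)%:R + pspace t /\
      (space (regs c.2) + space (wmem c.2))%:R <= wspace t)
    (run A M t k).

Definition within_resources (R : realType) (A : algorithm R) (T B : nat)
    (pspace wspace : nat -> R) : Prop :=
  forall (adv : adversary) (r : nat),
    (forall h, adv h <= T)%N -> (r < B)%N ->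
    dall (fun h => query_within A pspace wspace (last_mem h) (adv h))
         (real_run A adv r).

(** Logarithms in O-bounds are read as at least 1. *)
Definition lg (R : realType) (x : R) : R := Num.max 1 (ln x).

(** In log (n t), the time t = 0 is treated as t = 1. *)
Definition pspace_bound (R : realType) (eps : R) (B : nat) (lam : R) (n t : nat)
    : R :=
  lg ((n * maxn t 1)%:R) * (1 - lam)^-1 * lg (n%:R * B%:R / eps).

Definition time_bound (R : realType) (eps : R) (B : nat) (lam : R) (n t : nat)
    : R :=
  Num.sqrt n%:R *
  (lg ((n * maxn t 1)%:R) * (1 - lam)^-1 * lg (n%:R * B%:R / eps) ^+ 2).

Definition nceil (R : realType) (x : R) : nat := `|Num.ceil x|%N.

(** What the algorithm is given: n, B, and the real parameters eps and lam
    rounded to integers. An l1 distance is at most 2, so the requirement is void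
    for eps >= 2, that is, for nceil (2 / eps) = 1. *)
Definition inputs (R : realType) (eps : R) (B : nat) (lam : R) (n : nat)
    : seq nat :=
  [:: n; B; nceil (2 / eps); nceil (1 - lam)^-1].

(** Words of w bits can hold numbers polynomial in the inputs and in the queried
    times: w >= c log (...). *)
Definition word_large (R : realType) (c : nat) (eps : R) (B : nat) (lam : R)
    (n T w : nat) : Prop :=
  ((2 * n * B.+1 * nceil (2 / eps) * nceil (1 - lam)^-1 * T.+1) ^ c
     <= 2 ^ w)%N.

(* Main.v *)
(** The persistent memory holds the positions of the walk at some times. Let L be
    about log (nB/eps) and h about L / (1 - lambda), so that h steps mix up to a
    relative error 2^(-8 L). A query at an unknown time t looks for known times
    within 8h before t and 2h after t. If there are none, the answer is a uniform
    vertex; if there is one on one side only, a walk is run from it (the graph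
    being undirected, a walk run backwards in time has the right law). If there
    are known times on both sides, a bridge between two given vertices has to be
    sampled: about sqrt n walks of half the length are run from the left end, with
    distinct endpoints, and then walks are run from the right end until one of
    them meets such an endpoint (birthday paradox). Everything that was walked is
    stored, so that unknown stretches between known times keep a length of at
    least 2h.

    For two probability distributions, [c * D' a <= D a] for all [a] implies
    [l1dist D D' <= 2 * (1 - c)], so only lower bounds on the probabilities of the
    algorithm are needed. The simulator answers with the ideal walk x, and stores
    x at the times at which the algorithm would store its own walk. Then the ideal
    probability of a history is at most the probability that a random walk agrees
    with its final memory, and a query multiplies the latter, up to a factor close
    to 1, by at most the walk probability of the stored segment times n, 1 or 1/n,
    according to the number of known ends; this is what the algorithm achieves. *)

Require Import Defs.
From HB Require Import structures.
From mathcomp Require Import all_boot all_order all_algebra finmap.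
From mathcomp Require Import all_classical all_reals all_analysis.
From mathcomp Require Import zify ring lra.

Set Implicit Arguments.
Unset Strict Implicit.
Unset Printing Implicit Defensive.

Import Order.TTheory GRing.Theory Num.Theory.

Local Open Scope ring_scope.

(** The adversary sees all answers and memories, so the dependence between queries is controlled by
    a potential: [future M 0 T v0], the probability that a fresh walk agrees with the memory [M]. It
    is 1 for the empty memory, and the inequalities for the single queries telescope without any
    division by conditional probabilities.

    The two search windows differ on purpose. As time 0 is known, a failed search over 8h to the
    left means t > 8h, and a bridge only occurs for t >= 6h. Hence right ends, at most 2h after t,
    stay below 2t, and addresses cost O(log(nt)) bits whatever h is.

    In a bridge, the endpoint of the wanted left walk is among the s endpoints of the table with
    probability about s/n, while conditioning on a collision raises the weight of the wanted right
    walk by about n/s. The two factors cancel.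

    Every table entry loses a factor (1 - delta)^3, the collision (1 - delta)^2 and the conditioning
    on known times (1 - delta)^4. This makes 3s + 6 <= 9n factors per query, and delta = 2^(-8L) is
    small enough for B queries since nBE < 2^L. *)

Local Notation memory := Defs.mem.

(** * Finite distributions *)

Section Distributions.
Variable R : realType.

Definition Ex (A : Type) (D : dist R A) (f : A -> R) : R :=
  \sum_(p <- D) p.1 * f p.2.

Lemma Ex_dret (A : Type) (a : A) f : Ex (dret R a) f = f a.
Proof. by rewrite /Ex big_seq1 mul1r. Qed.

Lemma Ex_dbind (A A' : Type) (D : dist R A) (F : A -> dist R A') f :
  Ex (dbind D F) f = Ex D (fun a => Ex (F a) f).
Proof.
rewrite /Ex /dbind big_flatten big_map; apply: eq_bigr => p _.
by rewrite big_map mulr_sumr; apply: eq_bigr => q _; rewrite mulrA.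
Qed.

Lemma Ex_dmap (A A' : Type) (D : dist R A) (F : A -> A') f :
  Ex (dmap F D) f = Ex D (f \o F).
Proof. by rewrite /Ex /dmap big_map. Qed.

Lemma Ex_uniform (A : Type) (s : seq A) f :
  Ex (uniform R s) f = (size s)%:R^-1 * \sum_(a <- s) f a.
Proof. by rewrite /Ex /uniform big_map mulr_sumr. Qed.

Lemma is_dist_dret (A : Type) (a : A) : is_dist (dret R a).
Proof. by split; rewrite ?big_seq1 //= ler01. Qed.

Lemma is_dist_dbind (A A' : Type) (D : dist R A) (F : A -> dist R A') :
  is_dist D -> (forall a, is_dist (F a)) -> is_dist (dbind D F).
Proof.
move=> [D0 D1] HF; split.
  elim: D D0 {D1} => //= p D IH /andP[p0 D0].
  rewrite /dbind /= all_cat; apply/andP; split; last exact: IH.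
  have [F0 _] := HF p.2.
  by rewrite all_map; apply: sub_all F0 => q /= q0; apply: mulr_ge0.
rewrite /dbind big_flatten big_map -D1; apply: eq_bigr => p _.
by rewrite big_map -mulr_sumr (HF p.2).2 mulr1.
Qed.

Lemma is_dist_dmap (A A' : Type) (D : dist R A) (F : A -> A') :
  is_dist D -> is_dist (dmap F D).
Proof. by move=> [D0 D1]; split; rewrite /dmap ?all_map ?big_map. Qed.

Lemma is_dist_uniform (A : Type) (s : seq A) :
  (0 < size s)%N -> is_dist (uniform R s).
Proof.
move=> s0; split.
  rewrite /uniform all_map (@eq_all _ _ predT) ?all_predT // => a /=.
  by rewrite invr_ge0 ler0n.
rewrite /uniform big_map big_const_seq count_predT iter_addr_0.
rewrite -[LHS]mulr_natl /= mulfV //.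
by rewrite pnatr_eq0 -lt0n.
Qed.

Lemma dall_impl (A : Type) (P Q : A -> Prop) (D : dist R A) :
  (forall a, P a -> Q a) -> dall P D -> dall Q D.
Proof. by move=> PQ; elim: D => //= p D IH [/PQ ? /IH]. Qed.

Lemma dall_dmap (A A' : Type) (P : A' -> Prop) (F : A -> A') (D : dist R A) :
  dall P (dmap F D) <-> dall (P \o F) D.
Proof. by elim: D => //= p D IH; rewrite -IH. Qed.

Lemma dall_cat (A : Type) (P : A -> Prop) (D D' : dist R A) :
  dall P (D ++ D') <-> dall P D /\ dall P D'.
Proof. by elim: D => [|p D IH] /=; [split=> // -[] | rewrite IH; tauto]. Qed.

Lemma dall_dbind (A A' : Type) (P : A' -> Prop) (D : dist R A)
    (F : A -> dist R A') :
  dall P (dbind D F) <-> dall (fun a => dall P (F a)) D.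
Proof.
elim: D => //= p D IH; rewrite /dbind /= dall_cat -IH.
suff -> : dall P [seq (p.1 * q.1, q.2) | q <- F p.2] <-> dall P (F p.2) by [].
by elim: (F p.2) => //= q D' IH'; rewrite IH'.
Qed.

Lemma dall_uniform (A : eqType) (P : A -> Prop) (s : seq A) :
  (forall a, a \in s -> P a) -> dall P (uniform R s).
Proof.
rewrite /uniform; move: (size s)%:R^-1 => c.
elim: s => //= a s IH H; split; first by apply: H; rewrite mem_head.
by apply: IH => b bs; apply: H; rewrite inE bs orbT.
Qed.

Lemma dall_ge (A : Type) (D : dist R A) (f g : A -> R) :
  all (fun p => 0 <= p.1) D -> dall (fun a => f a <= g a) D ->
  Ex D f <= Ex D g.
Proof.
rewrite /Ex; elim: D => [|p D IH] /=; first by rewrite !big_nil.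
move=> /andP[p0 D0] [fg H]; rewrite !big_cons lerD //; last exact: IH.
exact: ler_wpM2l.
Qed.

Lemma Pr_Ex (A : eqType) (D : dist R A) a :
  Pr D a = Ex D (fun b => (b == a)%:R).
Proof.
rewrite /Pr /Ex big_mkcond; apply: eq_bigr => p _.
by case: eqP; rewrite ?mulr1 ?mulr0.
Qed.

(** An outcome may be listed several times, so bounds on [Pr] say nothing about single entries; this
    regrouping carries them over to expectations in [Ex_lower]. *)
Lemma Ex_Pr (A : eqType) (D : dist R A) (s : seq A) f :
  uniq s -> {subset map snd D <= s} -> Ex D f = \sum_(a <- s) Pr D a * f a.
Proof.
move=> us; rewrite /Ex /Pr.
elim: D => [|p D IH] /= Ds.
  by rewrite big_nil big1 // => a _; rewrite big_nil mul0r.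
rewrite big_cons IH => [|a aD]; last by apply: Ds; rewrite inE aD orbT.
have ps : p.2 \in s by apply: Ds; rewrite mem_head.
rewrite [RHS](bigD1_seq p.2) //= [in LHS](bigD1_seq p.2) //=.
rewrite big_cons eqxx mulrDl addrA; congr (_ + _).
apply: eq_bigr => a ap; rewrite big_cons eq_sym (negbTE ap) //.
Qed.

Lemma Pr_ge0 (A : eqType) (D : dist R A) a : is_dist D -> 0 <= Pr D a.
Proof.
move=> [D0 _]; rewrite /Pr big_seq_cond; apply: sumr_ge0 => p /andP[pD _].
exact: (allP D0).
Qed.

Lemma Ex_lower (A : eqType) (D D' : dist R A) (c : R) f :
  (forall a, c * Pr D' a <= Pr D a) -> (forall a, 0 <= f a) ->
  c * Ex D' f <= Ex D f.
Proof.
move=> H f0; pose s := undup (map snd D ++ map snd D').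
rewrite (@Ex_Pr _ D s) ?(@Ex_Pr _ D' s) ?undup_uniq // => [|a aD|a aD].
- by rewrite mulr_sumr ler_sum // => a _; rewrite mulrA ler_wpM2r.
- by rewrite mem_undup mem_cat aD orbT.
- by rewrite mem_undup mem_cat aD.
Qed.

Lemma Pr_dmap (A A' : eqType) (D : dist R A) (F : A -> A') b :
  Pr (dmap F D) b = Ex D (fun a => (F a == b)%:R).
Proof. by rewrite Pr_Ex Ex_dmap. Qed.

Lemma l1dist_lower (A : eqType) (D D' : dist R A) (c : R) :
  is_dist D -> is_dist D' -> c <= 1 ->
  (forall a, c * Pr D' a <= Pr D a) -> l1dist D D' <= 2 * (1 - c).
Proof.
move=> HD HD' c1 H; rewrite /l1dist.
set s := undup _.
have tot (D0 : dist R A) : is_dist D0 -> {subset map snd D0 <= s} ->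
    \sum_(a <- s) Pr D0 a = 1.
  move=> [_ D1] Ds; have := @Ex_Pr _ D0 s (fun=> 1) (undup_uniq _) Ds.
  rewrite /Ex; under eq_bigr do rewrite mulr1.
  by rewrite D1 => ->; apply: eq_bigr => a _; rewrite mulr1.
have e1 : \sum_(a <- s) Pr D a = 1.
  by apply: tot => // a aD; rewrite mem_undup mem_cat aD.
have e2 : \sum_(a <- s) Pr D' a = 1.
  by apply: tot => // a aD; rewrite mem_undup mem_cat aD orbT.
(* The excess of [D] over [c * D'] and the rest [(1 - c) * D'] are nonnegative of mass [1 - c] each,
   and their difference is [D - D']. *)
have -> : 2 * (1 - c) =
    \sum_(a <- s) ((Pr D a - c * Pr D' a) + (1 - c) * Pr D' a).
  by rewrite big_split sumrB /= -!mulr_sumr e1 e2; ring.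
apply: ler_sum => a _.
have -> : Pr D a - Pr D' a = (Pr D a - c * Pr D' a) - (1 - c) * Pr D' a by ring.
apply: le_trans (ler_normB _ _) _; rewrite !ger0_norm //.
  by rewrite mulr_ge0 ?subr_ge0 // Pr_ge0.
by rewrite subr_ge0.
Qed.

End Distributions.

(** * Random walks on a regular graph *)

Section Walks.
Variables (R : realType) (n d : nat) (e : rel 'I_n).
Hypotheses (d_gt0 : (0 < d)%N) (e_sym : symmetric e) (e_reg : regular e d).

Let W := walk_mx R e d.

Lemma walk_mx_ge0 u v : 0 <= W u v.
Proof. by rewrite mxE divr_ge0. Qed.

Lemma walk_mx_sym u v : W u v = W v u.
Proof. by rewrite !mxE e_sym. Qed.

Lemma walk_mx_row u : \sum_v W u v = 1.
Proof.
under eq_bigr do rewrite mxE.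
rewrite -mulr_suml -natr_sum -big_mkcond sum1_card.
by have := e_reg u; rewrite /= => ->; rewrite divff // pnatr_eq0 -lt0n.
Qed.

Definition walk_pow k : 'M[R]_n := iter k (mulmx W) 1%:M.

Lemma walk_powS k u v : walk_pow k.+1 u v = \sum_z W u z * walk_pow k z v.
Proof. by rewrite /walk_pow /= mxE. Qed.

Lemma walk_pow_ge0 k u v : 0 <= walk_pow k u v.
Proof.
elim: k u v => [|k IH] u v; first by rewrite mxE ler0n.
by rewrite walk_powS sumr_ge0 // => z _; rewrite mulr_ge0 ?walk_mx_ge0.
Qed.

Lemma walk_pow_row k u : \sum_v walk_pow k u v = 1.
Proof.
elim: k u => [|k IH] u.
  rewrite (bigD1 u) //= mxE eqxx big1 ?addr0 // => v uv.
  by rewrite mxE eq_sym (negbTE uv).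
under eq_bigr do rewrite walk_powS.
rewrite exchange_big /= -[RHS](walk_mx_row u); apply: eq_bigr => z _.
by rewrite -mulr_sumr IH mulr1.
Qed.

Lemma walk_pow_add k l : walk_pow (k + l) = walk_pow k *m walk_pow l.
Proof.
elim: k => [|k IH]; first by rewrite mul1mx.
by rewrite addSn /walk_pow /= -!/(walk_pow _) IH mulmxA.
Qed.

Lemma walk_mx_tr : W^T = W.
Proof. by apply/matrixP => u v; rewrite mxE walk_mx_sym. Qed.

Lemma walk_pow_sym k u v : walk_pow k u v = walk_pow k v u.
Proof.
suff H : (walk_pow k)^T = walk_pow k by rewrite -[in LHS]H mxE.
elim: k => [|k IH]; first by rewrite trmx1.
rewrite -[in RHS]addn1 walk_pow_add {2}/walk_pow /= mulmx1.
by rewrite /walk_pow /= -/(walk_pow k) trmx_mul IH walk_mx_tr.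
Qed.

Lemma sqr_le_norm2 (x : 'cV[R]_n) u : `|x u ord0| <= norm2 x.
Proof.
rewrite /norm2 -sqrtr_sqr ler_wsqrtr // (bigD1 u) //= lerDl.
by rewrite sumr_ge0 // => i _; rewrite sqr_ge0.
Qed.

(** The supremum in [lambda] can only be used once its set is known to be bounded. A crude factor is
    enough: the rows of [W] are probability vectors, so each entry of [W x] is at most [norm2 x]. *)
Lemma norm2_walk_mx_le (x : 'cV[R]_n) :
  norm2 (W *m x) <= Num.sqrt n%:R * norm2 x.
Proof.
have norm_ge0 : 0 <= norm2 x by exact: sqrtr_ge0.
rewrite -(ger0_norm norm_ge0) -sqrtr_sqr -sqrtrM // [leLHS]/norm2 ler_wsqrtr //.
have -> : n%:R * norm2 x ^+ 2 = \sum_(i < n) norm2 x ^+ 2.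
  by rewrite sumr_const card_ord mulr_natl.
apply: ler_sum => u _.
rewrite -real_normK ?num_real // lerXn2r ?nnegrE ?normr_ge0 // mxE.
apply: le_trans (ler_norm_sum _ _ _) _.
rewrite -[leRHS]mul1r -(walk_mx_row u) mulr_suml ler_sum // => v _.
by rewrite normrM ger0_norm ?walk_mx_ge0 // ler_wpM2l ?walk_mx_ge0 ?sqr_le_norm2.
Qed.

Variable lam : R.
Hypotheses (lam_ge0 : 0 <= lam) (lam_spec : lambda R e d <= lam).

Lemma norm2_walk_mx (x : 'cV[R]_n) :
  \sum_i x i ord0 = 0 -> norm2 (W *m x) <= lam * norm2 x.
Proof.
move=> x0; have [->|xn0] := eqVneq x 0.
  by rewrite mulmx0 /norm2 big1 ?sqrtr0 ?mulr0 // => i _; rewrite mxE expr0n.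
have norm_gt0 : 0 < norm2 x.
  have [u xu] : exists u, x u ord0 != 0.
    apply/existsP; apply: contra_neqT xn0 => /existsPn H.
    by apply/matrixP => u j; rewrite ord1 mxE; apply/eqP/negPn.
  by apply: lt_le_trans (sqr_le_norm2 x u); rewrite normr_gt0.
rewrite -ler_pdivrMr //; apply: le_trans lam_spec; apply: ub_le_sup; last first.
  by exists x.
exists (Num.sqrt n%:R) => _ [y [yn0 _] <-].
(* Division by zero gives 0, which satisfies the bound as well. *)
have [/eqP y0|y0] := eqVneq (norm2 y) 0.
  by rewrite (eqP y0) invr0 mulr0 sqrtr_ge0.
by rewrite ler_pdivrMr ?norm2_walk_mx_le // lt_def y0 sqrtr_ge0.
Qed.

Lemma walk_pow_mixing k u v : `|walk_pow k u v - n%:R^-1| <= lam ^+ k.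
Proof.
have n_gt0 : (0 < n)%N by case: (n) u => [[]|].
have nR : n%:R != 0 :> R by rewrite pnatr_eq0 -lt0n.
(* The point mass at [v] minus the uniform distribution: entry [u] of [walk_pow k *m y] is
   [walk_pow k u v - 1/n], because rows sum to 1. *)
pose y : 'cV[R]_n := \col_z ((z == v)%:R - n%:R^-1).
have y_col : \sum_z y z ord0 = 0.
  under eq_bigr do rewrite mxE.
  rewrite sumrB sumr_const card_ord -[X in _ - X]mulr_natl mulfV //.
  rewrite (bigD1 v) //= eqxx big1 ?addr0 ?subrr // => z zv.
  by rewrite (negbTE zv).
have y_norm : norm2 y <= 1.
  rewrite /norm2 -sqrtr1 ler_wsqrtr //.
  have -> : \sum_i y i ord0 ^+ 2 = \sum_z ((z == v)%:R * (1 - 2 * n%:R^-1) + n%:R^-1 ^+ 2).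
    apply: eq_bigr => z _; rewrite mxE; case: (z == v) => /=; last by ring.
    by ring.
  rewrite big_split /= -mulr_suml sumr_const card_ord (bigD1 v) //= eqxx.
  rewrite big1 => [|z zv]; last by rewrite (negbTE zv).
  rewrite addr0 mul1r -[X in _ + X]mulr_natl expr2 mulrA mulfV // mul1r.
  have : 0 <= n%:R^-1 :> R by rewrite invr_ge0.
  lra.
(* The columns of the symmetric [W] sum to 1 too, so the vectors stay orthogonal to the constants
   and every step contracts by [lam]. *)
have pow_y : forall j, \sum_z (walk_pow j *m y) z ord0 = 0 /\
    norm2 (walk_pow j *m y) <= lam ^+ j.
  elim=> [|j [IH1 IH2]]; first by rewrite mul1mx expr0.
  rewrite /walk_pow /= -/(walk_pow j) -mulmxA; split.
    under eq_bigr do rewrite mxE.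
    rewrite exchange_big /= -[RHS]IH1; apply: eq_bigr => z _.
    rewrite -mulr_suml; under eq_bigr do rewrite walk_mx_sym.
    by rewrite walk_mx_row mul1r.
  rewrite exprS; apply: le_trans (norm2_walk_mx IH1) _.
  exact: ler_wpM2l.
apply: le_trans (pow_y k).2; apply: le_trans (sqr_le_norm2 _ u).
rewrite mxE; under [X in _ <= `|X|]eq_bigr do rewrite mxE mulrBr.
rewrite sumrB -mulr_suml walk_pow_row mul1r (bigD1 v) //= eqxx mulr1.
by rewrite big1 ?addr0 // => z zv; rewrite (negbTE zv) mulr0.
Qed.

(** The argument of [g] is the path without its starting vertex [u]. *)
Fixpoint Ew (m : nat) (u : 'I_n) (g : seq 'I_n -> R) : R :=
  if m is m'.+1 then \sum_v W u v * Ew m' v (fun p => g (v :: p)) else g [::].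

Fixpoint pathw (u : 'I_n) (p : seq 'I_n) : R :=
  if p is v :: p' then W u v * pathw v p' else 1.

Lemma pathw_ge0 u p : 0 <= pathw u p.
Proof.
by elim: p u => //= v p IH u; rewrite mulr_ge0 ?walk_mx_ge0.
Qed.

Lemma pathw_cat u p q : pathw u (p ++ q) = pathw u p * pathw (last u p) q.
Proof. by elim: p u => [|v p IH] u /=; rewrite ?mul1r // IH mulrA. Qed.

Lemma Ew_le m u (f g : seq 'I_n -> R) :
  (forall p, size p = m -> f p <= g p) -> Ew m u f <= Ew m u g.
Proof.
elim: m u f g => [|m IH] u f g fg /=; first exact: fg.
apply: ler_sum => v _; apply: ler_wpM2l; first exact: walk_mx_ge0.
by apply: IH => p pm; apply: fg; rewrite /= pm.
Qed.

Lemma eq_Ew m u (f g : seq 'I_n -> R) :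
  (forall p, size p = m -> f p = g p) -> Ew m u f = Ew m u g.
Proof. by move=> fg; apply/eqP; rewrite eq_le !Ew_le // => p /fg ->. Qed.

Lemma Ew_add m u (f g : seq 'I_n -> R) :
  Ew m u (fun p => f p + g p) = Ew m u f + Ew m u g.
Proof.
elim: m u f g => //= m IH u f g; rewrite -big_split /=.
by apply: eq_bigr => v _; rewrite IH mulrDr.
Qed.

Lemma Ew_scale m u c (f : seq 'I_n -> R) :
  Ew m u (fun p => f p * c) = Ew m u f * c.
Proof.
elim: m u f => //= m IH u f; rewrite mulr_suml.
by apply: eq_bigr => v _; rewrite IH mulrA.
Qed.

Lemma Ew_ge0 m u (f : seq 'I_n -> R) :
  (forall p, size p = m -> 0 <= f p) -> 0 <= Ew m u f.
Proof.
move=> f0; have /Ew_le : forall p, size p = m -> f p * 0 <= f p.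
  by move=> p pm; rewrite mulr0 f0.
by move=> /(_ u); rewrite Ew_scale mulr0.
Qed.

Lemma Ew_last m u (G : 'I_n -> R) :
  Ew m u (fun p => G (last u p)) = \sum_z walk_pow m u z * G z.
Proof.
elim: m u => [|m IH] u /=.
  rewrite (bigD1 u) //= mxE eqxx mul1r big1 ?addr0 // => v uv.
  by rewrite mxE eq_sym (negbTE uv) mul0r.
under eq_bigr do rewrite IH mulr_sumr.
rewrite exchange_big; apply: eq_bigr => z _; rewrite walk_powS mulr_suml.
by apply: eq_bigr => v _; rewrite mulrA.
Qed.

Lemma Ew_path m u q c : size q = m ->
  Ew m u (fun p => if p == q then c else 0) = pathw u q * c.
Proof.
elim: m u q => [|m IH] u q; first by case: q => //= _; rewrite mul1r.
case: q => //= v q [qm]; rewrite (bigD1 v) //= big1 ?addr0 => [|z zv].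
  rewrite -mulrA -IH //; congr (_ * _); apply: eq_Ew => p _.
  by rewrite eqseq_cons eqxx.
rewrite (@eq_Ew _ _ _ (fun=> 0 * 0)) ?Ew_scale ?mulr0 // => p _.
by rewrite eqseq_cons (negbTE zv).
Qed.

Lemma Ew_cst m u c : Ew m u (fun=> c) = c.
Proof.
by rewrite (Ew_last m u (fun=> c)) -mulr_suml walk_pow_row mul1r.
Qed.

End Walks.

(** * A program logic for the word RAM *)

Section Memories.
Local Open Scope nat_scope.

Lemma updE (m : memory) a v b : upd m a v b = if b == a then v else m b.
Proof. by rewrite /upd fsfun_withE. Qed.

Lemma mem0E a : mem0 a = 0.
Proof. by rewrite /mem0 fsfunE. Qed.

Lemma memP (m m' : memory) : (forall a, m a = m' a) -> m = m'.
Proof. by move=> H; apply/fsfunP. Qed.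

Definition mem_of_seq (l : seq nat) : memory :=
  foldr (fun i m => upd m i (nth 0 l i)) mem0 (iota 0 (size l)).

Lemma mem_of_seqE l i : mem_of_seq l i = nth 0 l i.
Proof.
rewrite /mem_of_seq.
have H (s : seq nat) : foldr (fun i m => upd m i (nth 0 l i)) mem0 s i =
    if i \in s then nth 0 l i else 0.
  elim: s => [|a s IH] /=; first by rewrite mem0E.
  by rewrite updE IH inE; case: eqP => [->|].
rewrite H mem_iota add0n leq0n /=; case: ltnP => // lt_l.
by rewrite nth_default.
Qed.

Lemma upd_mem_of_seq l i v :
  upd (mem_of_seq l) i v = mem_of_seq (set_nth 0 l i v).
Proof.
by apply: memP => a; rewrite updE !mem_of_seqE nth_set_nth.
Qed.

Lemma bitlen_le x y : x <= y -> bitlen x <= bitlen y.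
Proof. by move=> xy; rewrite ltnS leq_trunc_log. Qed.

(** All space bounds rest on this: the charge of a cell depends on its address and its content, so
    both are bounded along with the set of cells that may differ from [M]. *)
Definition confined (M : memory) (A V : nat) (F : seq nat) (m : memory) : Prop :=
  (forall a, a \notin F -> m a = M a) /\
  (forall a, a \in F -> a <= A /\ m a <= V).

Lemma space_confined M A V F m :
  confined M A V F m -> Defs.space m <= Defs.space M + size F * (bitlen A + bitlen V).
Proof.
move=> [Fout Fin]; rewrite /Defs.space (bigID (mem F)) /= addnC leq_add //.
- rewrite -big_filter.
  have -> : \sum_(a <- [seq a <- finsupp m | a \notin F]) (bitlen a + bitlen (m a))
    = \sum_(a <- [seq a <- finsupp m | a \notin F]) (bitlen a + bitlen (M a)).
    rewrite !big_filter; apply: eq_bigr => a aF.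
    by rewrite Fout.
  apply: (@uniq_sub_le_big nat addn leq leqnn (fun x y => leq_addr y x)).
  + by rewrite filter_uniq // fset_uniq.
  + exact: fset_uniq.
  + by move=> a; rewrite mem_filter !mem_finsupp => /andP[aF]; rewrite Fout.
- rewrite -big_filter.
  apply: (@leq_trans (\sum_(a <- [seq a <- finsupp m | a \in F])
                        (bitlen A + bitlen V))).
    rewrite !big_filter; apply: leq_sum => a aF.
    by have [? ?] := Fin _ aF; rewrite leq_add // bitlen_le.
  rewrite big_const_seq count_predT iter_addn_0 mulnC leq_mul2r.
  apply/orP; right; apply: uniq_leq_size.
    by rewrite filter_uniq // fset_uniq.
  by move=> a; rewrite mem_filter => /andP[].
Qed.

Lemma confined_upd M A V F m a v :
  confined M A V F m -> a \in F -> v <= V -> confined M A V F (upd m a v).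
Proof.
move=> [H1 H2] aF vV; split=> b bF; rewrite updE.
  by case: eqP => [ba|_]; [rewrite ba aF in bF | apply: H1].
by case: eqP => [_|_]; have [? ?] := H2 _ bF; split.
Qed.

(** The effect of [walk_cmd] and [copy_cmd] on a memory: [Add] writes upwards, [Sub] downwards.
    Values are incremented because 0 marks a free cell. *)
Fixpoint fill (o : binop) (m : memory) (a : nat) (q : seq nat) : memory :=
  if q is v :: q' then fill o (upd m a v.+1) (eval_bin o a 1) q' else m.

Lemma fill_addE m a q b :
  fill Add m a q b = if a <= b < a + size q then (nth 0 q (b - a)).+1 else m b.
Proof.
elim: q m a => [|v q IH] m a /=; first by case: ifP => //; lia.
rewrite IH updE addn1; have [->|/eqP ba] := eqVneq b a.
  by rewrite ltnn leqnn subnn /= ifT //; lia.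
have [ab|ab] := ltnP a b; last by rewrite ifF //; lia.
rewrite (_ : b - a = (b - a.+1).+1) /=; last by lia.
by congr (if _ then _ else _); lia.
Qed.

Lemma fill_subE m a q b : size q <= a.+1 ->
  fill Defs.Sub m a q b = if b <= a < b + size q then (nth 0 q (a - b)).+1 else m b.
Proof.
elim: q m a => [|v q IH] m a /=; first by case: ifP => //; lia.
rewrite ltnS => qa; have [q0|q0] := posnP (size q).
  rewrite (size0nil q0) /= updE.
  have [->|/eqP ba] := eqVneq b a; first by rewrite subnn leqnn ifT //; lia.
  by rewrite ifF //; lia.
rewrite IH ?updE; last by lia.
have [->|/eqP ba] := eqVneq b a.
  by rewrite leqnn subnn /= ifF; [rewrite ifT //; lia | lia].
have [ab|ab] := ltnP b a; last by rewrite !ifF //; lia.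
rewrite (_ : a - b = (a - 1 - b).+1) /=; last by lia.
by congr (if _ then _ else _); lia.
Qed.

End Memories.

(** * Total correctness with lower bounds on expectations *)

Section Logic.
Variables (R : realType) (n d : nat) (e : rel 'I_n).
Hypotheses (n_gt0 : (0 < n)%N) (d_gt0 : (0 < d)%N) (e_reg : regular e d).
Variables (w : nat) (inp : seq nat).
Variables (Inv Post : state -> Prop) (f : state -> R).

Let O := graph_oracle R e.

(** A total-correctness logic in continuation-passing style: [Inv] holds all along,
    [Post] at the end, and the final expectation of [f] is at least [r]. No upper
    bounds on probabilities are needed. *)
Fixpoint ok (N : nat) (c : config) (r : R) : Prop :=
  match N with
  | 0 => [/\ c.1 = [::], Inv c.2, Post c.2 & r <= f c.2]
  | N'.+1 => Inv c.2 /\ exists g : config -> R,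
      dall (fun c' => ok N' c' (g c')) (step O w inp c) /\
      r <= Ex (step O w inp c) g
  end.

Lemma ok_inv0 N c r : ok N c r -> Inv c.2.
Proof. by case: N => [[]|N []]. Qed.

Lemma step_weight c : all (fun p => 0 <= p.1) (step O w inp c).
Proof.
have uni (A : Type) (s : seq A) : all (fun p => 0 <= p.1) (uniform R s).
  rewrite /uniform all_map (@eq_all _ _ predT) ?all_predT // => a /=.
  by rewrite invr_ge0 ler0n.
case: c => -[|[|x g|x g|x g|x|x g|c1 c2|g c1 c2|g c1] k] s //=;
  rewrite ?ler01 //; rewrite /dmap all_map; first exact: uni.
rewrite /=; set o : option 'I_n := insub _.
by case: o => [i|]; [exact: uni | rewrite /= ler01].
Qed.

Lemma ok_steps N c r : ok N c r ->
  dall (fun c' : config => halted c' /\ Post c'.2) (steps O w inp N c) /\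
  r <= Ex (steps O w inp N c) (fun c' => f c'.2).
Proof.
elim: N c r => [|N IH] c r /=.
  by move=> [c1 ? ? rf]; rewrite Ex_dret.
move=> [_ [g [Hg rg]]]; rewrite Ex_dbind dall_dbind; split.
  by apply: dall_impl Hg => c' /IH[].
apply: le_trans rg _; apply: dall_ge; first exact: step_weight.
by apply: dall_impl Hg => c' /IH[].
Qed.

(** [k] is unrelated to [N]: shorter runs are prefixes and a halted machine stays where it is. Space
    bounds need [Inv] at every time. *)
Lemma ok_inv N c r : ok N c r ->
  forall k, dall (fun c' : config => Inv c'.2) (steps O w inp k c).
Proof.
move=> H k; elim: k N c r H => [|k IH] N c r H /=.
  by split=> //; apply: ok_inv0 H.
rewrite dall_dbind; case: N H => [|N] /=.
  move=> H; have [c1 _ _ _] := H; rewrite /step c1 /=.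
  by split=> //; apply: (IH 0%N c r).
by move=> [_ [g [Hg _]]]; apply: dall_impl Hg => c' /IH.
Qed.

Lemma ok_weak N c r r' : ok N c r -> r' <= r -> ok N c r'.
Proof.
case: N => [[? ? ? rf] r'r|N [? [g [? rg]]] r'r] /=.
  by split=> //; apply: le_trans rf.
by split=> //; exists g; split=> //; apply: le_trans rg.
Qed.

Lemma ok_det N c c' r : step O w inp c = dret R c' -> Inv c.2 ->
  ok N c' r -> ok N.+1 c r.
Proof.
move=> stepE Hc H; split=> //; exists (fun=> r).
by rewrite stepE Ex_dret.
Qed.

Lemma ok_add N M c r : ok N c r -> ok (N + M) c r.
Proof.
elim: N c r => [|N IH] c r.
  move=> H; have [c10 Hc _ _] := H; rewrite add0n.
  elim: M => // M IH; apply: ok_det IH => //.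
  by rewrite /step c10.
move=> [Hc [g [Hg rg]]]; split=> //; exists g; split=> //.
by apply: dall_impl Hg => c' /IH.
Qed.

(** Joins branches of different running times: each is padded to a common number of steps. *)
Lemma ok_le N M c r : ok N c r -> (N <= M)%N -> ok M c r.
Proof. by move=> H NM; rewrite -(subnKC NM); apply: ok_add. Qed.

(** Machine states are written with their registers in a list; [evn] evaluates
    expressions without reduction modulo the word size, which is sound when
    [fits] holds. *)
Definition St (l : seq nat) (p m : memory) : state :=
  State (mem_of_seq l) p m.

Fixpoint evn (l : seq nat) (p m : memory) (g : expr) : nat :=
  match g with
  | Lit x => x
  | Inp k => nth 0%N inp k
  | Reg x => nth 0%N l x
  | PMem a => p (evn l p m a)
  | WMem a => m (evn l p m a)
  | Bin o g1 g2 => eval_bin o (evn l p m g1) (evn l p m g2)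
  end.

Variable X : nat.
Hypothesis X_word : (X < 2 ^ w)%N.

Fixpoint fits (l : seq nat) (p m : memory) (g : expr) : Prop :=
  match g with
  | Lit x => (x <= X)%N
  | Inp k => (nth 0 inp k <= X)%N
  | Reg x => (nth 0 l x <= X)%N
  | PMem a => fits l p m a /\ (p (evn l p m a) <= X)%N
  | WMem a => fits l p m a /\ (m (evn l p m a) <= X)%N
  | Bin o g1 g2 => [/\ fits l p m g1, fits l p m g2
                    & (eval_bin o (evn l p m g1) (evn l p m g2) <= X)%N]
  end.

Lemma fits_evn l p m g : fits l p m g -> (evn l p m g <= X)%N.
Proof. by case: g => //= [a []|a []|o g1 g2 []]. Qed.

Lemma eval_evn l p m g : fits l p m g ->
  Defs.eval w inp (St l p m) g = evn l p m g.
Proof.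
move=> fg; have := leq_ltn_trans (fits_evn fg) X_word.
elim: g fg => [x|k|x|a IH|a IH|o g1 IH1 g2 IH2] /=.
- by move=> _ /modn_small.
- by move=> _ /modn_small.
- by move=> _; rewrite mem_of_seqE => /modn_small.
- move=> [fa _] ?; rewrite IH ?modn_small //.
  exact: leq_ltn_trans (fits_evn fa) X_word.
- move=> [fa _] ?; rewrite IH ?modn_small //.
  exact: leq_ltn_trans (fits_evn fa) X_word.
- move=> [f1 f2 _] ?; rewrite IH1 ?IH2 ?modn_small //.
    exact: leq_ltn_trans (fits_evn f2) X_word.
  exact: leq_ltn_trans (fits_evn f1) X_word.
Qed.

Variables (nreg : nat) (PG WG : memory -> Prop).

Definition good (l : seq nat) (p m : memory) : Prop :=
  [/\ size l = nreg, all (fun v => v <= X)%N l, PG p & WG m].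

Hypothesis good_Inv : forall l p m, good l p m -> Inv (St l p m).

Lemma good_reg l p m x v : good l p m -> (x < nreg)%N -> (v <= X)%N ->
  good (set_nth 0%N l x v) p m.
Proof.
move=> [sl al PGp WGm] xn vX; split=> //.
  by rewrite size_set_nth sl; apply/maxn_idPr.
apply/(all_nthP 0%N) => i; rewrite size_set_nth sl (maxn_idPr xn) => il.
rewrite nth_set_nth /=; case: eqP => // _.
by move/(all_nthP 0%N): al; apply; rewrite sl.
Qed.

Lemma ok_end l p m r : good l p m -> Post (St l p m) -> r <= f (St l p m) ->
  ok 0 ([::], St l p m) r.
Proof. by move=> Gl; split=> //; apply: good_Inv. Qed.

Lemma ok_skip N k l p m r : good l p m ->
  ok N (k, St l p m) r -> ok N.+1 (Skip :: k, St l p m) r.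
Proof. by move=> Gl; apply: ok_det => //; apply: good_Inv. Qed.

Lemma ok_seq N k c1 c2 l p m r : good l p m ->
  ok N (c1 :: c2 :: k, St l p m) r -> ok N.+1 (Seq c1 c2 :: k, St l p m) r.
Proof. by move=> Gl; apply: ok_det => //; apply: good_Inv. Qed.

Lemma ok_set N k l p m r x g : good l p m -> (x < nreg)%N -> fits l p m g ->
  (good (set_nth 0%N l x (evn l p m g)) p m ->
   ok N (k, St (set_nth 0%N l x (evn l p m g)) p m) r) ->
  ok N.+1 (SetReg x g :: k, St l p m) r.
Proof.
move=> Gl xn fg H; apply: ok_det (H _); last 1 first.
- exact: good_reg (fits_evn fg).
- by rewrite /step /= eval_evn // /set_reg /= upd_mem_of_seq.
- exact: good_Inv.
Qed.

Lemma ok_setp N k l p m r a g : good l p m -> fits l p m a -> fits l p m g ->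
  PG (upd p (evn l p m a) (evn l p m g)) ->
  (good l (upd p (evn l p m a) (evn l p m g)) m ->
   ok N (k, St l (upd p (evn l p m a) (evn l p m g)) m) r) ->
  ok N.+1 (SetPMem a g :: k, St l p m) r.
Proof.
move=> Gl fa fg PGp H; apply: ok_det (H _); last 1 first.
- by case: Gl; split.
- by rewrite /step /= !eval_evn.
- exact: good_Inv.
Qed.

Lemma ok_setw N k l p m r a g : good l p m -> fits l p m a -> fits l p m g ->
  WG (upd m (evn l p m a) (evn l p m g)) ->
  (good l p (upd m (evn l p m a) (evn l p m g)) ->
   ok N (k, St l p (upd m (evn l p m a) (evn l p m g))) r) ->
  ok N.+1 (SetWMem a g :: k, St l p m) r.
Proof.
move=> Gl fa fg WGm H; apply: ok_det (H _); last 1 first.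
- by case: Gl; split.
- by rewrite /step /= !eval_evn.
- exact: good_Inv.
Qed.

Lemma ok_if N k l p m r g c1 c2 : good l p m -> fits l p m g ->
  ok N ((if evn l p m g == 0%N then c2 else c1) :: k, St l p m) r ->
  ok N.+1 (If g c1 c2 :: k, St l p m) r.
Proof.
move=> Gl fg; apply: ok_det; last exact: good_Inv.
by rewrite /step /= eval_evn.
Qed.

Lemma ok_while N k l p m r g c : good l p m -> fits l p m g ->
  ok N (if evn l p m g == 0%N then k else c :: While g c :: k, St l p m) r ->
  ok N.+1 (While g c :: k, St l p m) r.
Proof.
move=> Gl fg; apply: ok_det; last exact: good_Inv.
by rewrite /step /= eval_evn.
Qed.

(** The intermediate value in [ok] is a function of configurations; this recovers the vertex just
    drawn from the register that received it. *)
Let vertex (x : nat) (c : config) : option 'I_n := insub (regs c.2 x).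

Lemma vertex_set k l p m x v :
  vertex x (k, set_reg (St l p m) x (nat_of_ord v)) = Some v.
Proof. by rewrite /vertex /= updE eqxx valK. Qed.

Lemma ok_rand_vertex N k l p m x (g : 'I_n -> R) : good l p m ->
  (x < nreg)%N -> (n <= X)%N ->
  (forall v : 'I_n, good (set_nth 0%N l x v) p m ->
     ok N (k, St (set_nth 0%N l x v) p m) (g v)) ->
  ok N.+1 (RandVertex x :: k, St l p m) (n%:R^-1 * \sum_v g v).
Proof.
move=> Gl xn nX H; split; first exact: good_Inv.
exists (fun c => if vertex x c is Some v then g v else 0).
rewrite /step /= dall_dmap; split.
  apply: dall_uniform => _ /mapP[v _ ->] /=.
  rewrite vertex_set {1}/set_reg /= upd_mem_of_seq; apply: H.
  by apply: good_reg => //; apply: leq_trans nX; apply: ltnW.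
rewrite Ex_dmap Ex_uniform size_map size_enum_ord big_map big_enum /=.
rewrite ler_wpM2l ?invr_ge0 // ler_sum // => v _.
by rewrite vertex_set.
Qed.

Lemma ok_rand_neighbor N k l p m x a (u : 'I_n) (g : 'I_n -> R) :
  good l p m -> (x < nreg)%N -> (n <= X)%N -> fits l p m a ->
  evn l p m a = u ->
  (forall v : 'I_n, good (set_nth 0%N l x v) p m ->
     ok N (k, St (set_nth 0%N l x v) p m) (g v)) ->
  ok N.+1 (RandNeighbor x a :: k, St l p m) (\sum_v walk_mx R e d u v * g v).
Proof.
move=> Gl xn nX fa aE H; split; first exact: good_Inv.
exists (fun c => if vertex x c is Some v then g v else 0).
rewrite /step /= eval_evn // aE dall_dmap /= valK; split.
  apply: dall_uniform => _ /mapP[v _ ->] /=.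
  rewrite vertex_set {1}/set_reg /= upd_mem_of_seq; apply: H.
  by apply: good_reg => //; apply: leq_trans nX; apply: ltnW.
rewrite Ex_dmap Ex_uniform size_map -cardE e_reg big_map big_enum /=.
rewrite mulr_sumr [leRHS]big_mkcond /= ler_sum // => v _.
rewrite mxE vertex_set -topredE /= mulrAC.
by case: (e u v); rewrite ?mul1r ?mul0r // mulrC.
Qed.

End Logic.
Arguments ok : simpl never.

(** * Subroutines *)

(** Registers: 0 answer, 2 [bitlen (n B E)], 3 mixing time, 4 square root of [n],
    5 and 6 distances to the known times on the left and on the right, 7 current
    vertex, 8 remaining steps, 9 and 10 addresses read and written, 11 number of
    left walks stored, 12 left walks still to be drawn, 13 remaining tries.
    Vertices are stored incremented, 0 marking a free cell. *)
Definition walk_cmd : cmd :=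
  Seq (SetWMem (Reg 9) (Bin Add (Reg 7) (Lit 1)))
      (While (Reg 8)
        (Seq (RandNeighbor 7 (Reg 7))
        (Seq (SetReg 9 (Bin Add (Reg 9) (Lit 1)))
        (Seq (SetWMem (Reg 9) (Bin Add (Reg 7) (Lit 1)))
             (SetReg 8 (Bin Defs.Sub (Reg 8) (Lit 1))))))).

Definition copy_cmd (o : binop) : cmd :=
  While (Reg 8)
    (Seq (SetPMem (Reg 10) (WMem (Reg 9)))
    (Seq (SetReg 10 (Bin o (Reg 10) (Lit 1)))
    (Seq (SetReg 9 (Bin Add (Reg 9) (Lit 1)))
         (SetReg 8 (Bin Defs.Sub (Reg 8) (Lit 1)))))).

(** Acceptance and exhaustion both end with register 13 at 0; the callers tell them apart by testing
    [acc] once more on the last vertex. *)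
Definition try_cmd (start len base acc : expr) : cmd :=
  While (Reg 13)
    (Seq (SetReg 7 start)
    (Seq (SetReg 8 len)
    (Seq (SetReg 9 base)
    (Seq walk_cmd
         (If acc (SetReg 13 (Lit 0))
                 (SetReg 13 (Bin Defs.Sub (Reg 13) (Lit 1)))))))).

(** The product of the two comparisons is a conjunction. The loop stops at distance [c] times
    register 3 in any case, so the caller has to look at the cell reached. To the left it cannot
    pass time 0, whose cell is filled beforehand. *)
Definition search_cmd (x : nat) (o : binop) (c : nat) : cmd :=
  While (Bin Mul (Bin Leq (PMem (Bin o (Inp 4) (Reg x))) (Lit 0))
                 (Bin Leq (Bin Add (Reg x) (Lit 1)) (Bin Mul (Lit c) (Reg 3))))
        (SetReg x (Bin Add (Reg x) (Lit 1))).

Definition bitlen_cmd : cmd :=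
  While (Reg 1) (Seq (SetReg 1 (Bin Div (Reg 1) (Lit 2)))
                     (SetReg 2 (Bin Add (Reg 2) (Lit 1)))).

(** A linear search is affordable: it takes about sqrt n steps. *)
Definition sqrt_cmd : cmd :=
  While (Bin Leq (Bin Add (Bin Mul (Reg 4) (Reg 4)) (Lit 1)) (Inp 0))
        (SetReg 4 (Bin Add (Reg 4) (Lit 1))).

(** * Rules for the loops *)

Section Blocks.
Local Open Scope nat_scope.
Variables (R : realType) (n d : nat) (e : rel 'I_n).
Hypotheses (n_gt0 : (0 < n)%N) (d_gt0 : (0 < d)%N) (e_reg : regular e d).
Variables (w : nat) (inp : seq nat).
Variables (Inv Post : state -> Prop) (f : state -> R).
Variable X : nat.
Hypotheses (X_word : (X < 2 ^ w)%N) (n_X : (n <= X)%N).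
Variables (PG WG : memory -> Prop).

Let good := good X 14 PG WG.
Hypothesis good_Inv : forall l p m, good l p m -> Inv (St l p m).

Let ok := ok e w inp Inv Post f.
Let Ew := @Ew R n d e.

Lemma X_gt0 : (0 < X)%N.
Proof. exact: leq_trans n_X. Qed.

Lemma good_le l p m x : good l p m -> (nth 0 l x <= X)%N.
Proof.
move=> [sl al _ _]; case: (ltnP x (size l)) => xl; last by rewrite nth_default.
by move/(all_nthP 0%N): al => /(_ _ xl).
Qed.

(** [J] stands for what the caller knows about the working memory; it only has to survive writes
    into the range of the walk. *)
Lemma ok_walk_loop len (u : 'I_n) N k r0 r1 r2 r3 r4 r5 r6 ptr r10 r11 r12 r13
    p m (J : memory -> Prop) g :
  good [:: r0; r1; r2; r3; r4; r5; r6; val u; len; ptr; r10; r11; r12; r13] p m ->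
  (ptr + len <= X)%N -> (forall m', J m' -> WG m') -> J m ->
  (forall m' a v, J m' -> (ptr < a <= ptr + len)%N -> (v <= n)%N ->
     J (upd m' a v)) ->
  (forall q : seq 'I_n, size q = len ->
     let l := [:: r0; r1; r2; r3; r4; r5; r6; val (last u q); 0; (ptr + len)%N;
                  r10; r11; r12; r13] in
     let m' := fill Add m ptr.+1 (map val q) in
     J m' -> good l p m' -> ok N (k, St l p m') (g q)) ->
  ok (N + (8 * len).+1) (While (Reg 8)
        (Seq (RandNeighbor 7 (Reg 7))
        (Seq (SetReg 9 (Bin Add (Reg 9) (Lit 1)))
        (Seq (SetWMem (Reg 9) (Bin Add (Reg 7) (Lit 1)))
             (SetReg 8 (Bin Defs.Sub (Reg 8) (Lit 1)))))) :: k,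
    St [:: r0; r1; r2; r3; r4; r5; r6; val u; len; ptr; r10; r11; r12; r13] p m)
    (Ew len u g).
Proof.
elim: len u N ptr m g => [|len IH] u N ptr m g Gl ptrX JW Jm Jupd H.
  rewrite muln0 addn1; apply: (ok_while X_word good_Inv) => //=.
  by have := H [::] erefl; rewrite /= addn0; apply.
have lenX := good_le 8 Gl; have uX := good_le 7 Gl; simpl in lenX, uX.
rewrite (_ : N + (8 * len.+1).+1 = (N + (8 * len).+1).+4.+4)%N; last by lia.
apply: (ok_while X_word good_Inv) => //=; apply: (ok_seq good_Inv) => //.
apply: (ok_rand_neighbor e_reg X_word good_Inv) => // v Gv; simpl in Gv; rewrite /=.
apply: (ok_seq good_Inv) => //; apply: (ok_set X_word good_Inv) => //=.
  by split=> //; have := X_gt0; lia.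
rewrite addn1 => G1; apply: (ok_seq good_Inv) => //; have vX : (v.+1 <= X)%N.
  exact: leq_trans n_X.
have Jm1 : J (upd m ptr.+1 v.+1) by apply: Jupd => //; lia.
apply: (ok_setw X_word good_Inv) => //=; rewrite ?addn1 //.
- by lia.
- by split=> //; have := X_gt0; lia.
- exact: JW.
move=> G2; apply: (ok_set X_word good_Inv) => //=.
  by split=> //; have := X_gt0; lia.
rewrite subn1 /= => G3; apply: IH => //; first by lia.
  by move=> m' a x Jm' aP xn; apply: Jupd => //; lia.
move=> q qlen; rewrite addSn -addnS => l m' Jm' Gm'.
by have := H (v :: q); rewrite /= addn1 qlen; apply.
Qed.

Lemma ok_walk len (u : 'I_n) N k r0 r1 r2 r3 r4 r5 r6 ptr r10 r11 r12 r13
    p m (J : memory -> Prop) g :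
  good [:: r0; r1; r2; r3; r4; r5; r6; val u; len; ptr; r10; r11; r12; r13] p m ->
  (ptr + len <= X)%N -> (forall m', J m' -> WG m') -> J m ->
  (forall m' a v, J m' -> (ptr <= a <= ptr + len)%N -> (v <= n)%N ->
     J (upd m' a v)) ->
  (forall q : seq 'I_n, size q = len ->
     let l := [:: r0; r1; r2; r3; r4; r5; r6; val (last u q); 0; (ptr + len)%N;
                  r10; r11; r12; r13] in
     let m' := fill Add m ptr (map val (u :: q)) in
     J m' -> good l p m' -> ok N (k, St l p m') (g q)) ->
  ok (N + (8 * len + 3)) (walk_cmd :: k,
    St [:: r0; r1; r2; r3; r4; r5; r6; val u; len; ptr; r10; r11; r12; r13] p m)
    (Ew len u g).
Proof.
move=> Gl ptrX JW Jm Jupd H.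
have uX := good_le 7 Gl; have ptX := good_le 9 Gl; simpl in uX, ptX.
rewrite (_ : N + _ = (N + (8 * len).+1).+2)%N; last by lia.
have u1X : (u.+1 <= X)%N by exact: leq_trans n_X.
have Jm1 : J (upd m ptr u.+1) by apply: Jupd => //; lia.
apply: (ok_seq good_Inv) => //.
apply: (ok_setw X_word good_Inv) => //=; rewrite ?addn1 //.
- by split=> //; have := X_gt0; lia.
- exact: JW.
move=> G2; apply: (@ok_walk_loop _ _ _ _ _ _ _ _ _ _ _ _ _ _ _ _ _ _ J) => //.
  by move=> m' a x Jm' aP xn; apply: Jupd => //; lia.
move=> q qlen l m' Jm' Gm'; have := H q qlen; rewrite /= addn1.
exact.
Qed.

Lemma ok_copy o (q : seq nat) N k r0 r1 r2 r3 r4 r5 r6 r7 ptr dst r11 r12 r13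
    p m lo hi (K : memory -> Prop) r :
  good [:: r0; r1; r2; r3; r4; r5; r6; r7; size q; ptr; dst; r11; r12; r13] p m ->
  (ptr + size q <= X)%N -> (hi.+1 <= X)%N ->
  (if o is Defs.Sub then lo + size q <= dst.+1 /\ dst <= hi
   else o = Add /\ lo <= dst /\ dst + size q <= hi.+1)%N ->
  all (fun v => v < n)%N q ->
  (forall i, i < size q -> m (ptr + i) = (nth 0 q i).+1)%N ->
  (forall p', K p' -> PG p') -> K p ->
  (forall p' a v, K p' -> (lo <= a <= hi)%N -> (v < n)%N -> K (upd p' a v.+1)) ->
  (forall ptr' dst',
     let l := [:: r0; r1; r2; r3; r4; r5; r6; r7; 0; ptr'; dst'; r11; r12; r13] in
     let p' := fill o p dst q in
     K p' -> good l p' m -> ok N (k, St l p' m) r) ->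
  ok (N + (8 * size q).+1) (copy_cmd o :: k,
    St [:: r0; r1; r2; r3; r4; r5; r6; r7; size q; ptr; dst; r11; r12; r13] p m) r.
Proof.
move=> + + hiX.
elim: q N p ptr dst => [|v q IH] N p ptr dst Gl ptrX oP qn qm KP Kp Kupd H.
  by rewrite muln0 addn1; apply: (ok_while X_word good_Inv) => //=; apply: H.
have iX := good_le 8 Gl; have dX := good_le 10 Gl; have pX := good_le 9 Gl.
simpl in iX, dX, pX, ptrX, oP; have X0 := X_gt0.
have /= /andP[vn qn'] := qn.
have mv : m ptr = v.+1 by have := qm 0%N isT; rewrite addn0.
rewrite (_ : N + (8 * (size q).+1).+1 = (N + (8 * size q).+1).+4.+4)%N; last by lia.
have dlh : (lo <= dst <= hi)%N by case: (o) oP; lia.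
have d1X : (eval_bin o dst 1 <= X)%N by case: (o) oP => //=; lia.
have Kp1 : K (upd p dst v.+1) by apply: Kupd.
apply: (ok_while X_word good_Inv) => //=; apply: (ok_seq good_Inv) => //;
  apply: (ok_setp X_word good_Inv) => //=; rewrite ?mv //.
- by split=> //; lia.
- exact: KP.
move=> G1; apply: (ok_seq good_Inv) => //; apply: (ok_set X_word good_Inv) => //= G2.
apply: (ok_seq good_Inv) => //; apply: (ok_set X_word good_Inv) => //=.
  by split=> //; lia.
rewrite addn1 => G3; apply: (ok_set X_word good_Inv) => //=.
  by split=> //; lia.
rewrite subn1 /= => G4; apply: IH => //.
- by lia.
- by case: (o) oP => //= -[] // *; [split=> //|]; lia.
- by move=> i iq; rewrite addSn -addnS (qm i.+1).
Qed.

(** The term for [j] is the event that [j] attempts are rejected and the next one is accepted. Runs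
    in which all attempts fail are credited with 0. *)
Lemma ok_try start len base acc (u : 'I_n) (ln bs : nat) (A : pred 'I_n)
    tries N k r0 r1 r2 r3 r4 r5 r6 r10 r11 r12 p (J : memory -> Prop)
    (g : seq 'I_n -> R) c0 i0 ptr0 m :
  let l cur i ptr tr :=
    [:: r0; r1; r2; r3; r4; r5; r6; cur; i; ptr; r10; r11; r12; tr] in
  (bs + ln <= X) -> (0 < tries) ->
  (forall m', J m' -> WG m') ->
  (forall m' a v, J m' -> bs <= a <= bs + ln -> v <= n -> J (upd m' a v)) ->
  (forall cur i ptr tr m', J m' -> let l' := l cur i ptr tr in
    [/\ fits inp X l' p m' start, evn inp l' p m' start = val u,
        fits inp X l' p m' len, evn inp l' p m' len = ln &
        fits inp X l' p m' base /\ evn inp l' p m' base = bs]) ->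
  (forall (cur : 'I_n) ptr tr m', J m' -> let l' := l (val cur) 0 ptr tr in
    fits inp X l' p m' acc /\ (evn inp l' p m' acc != 0) = A cur) ->
  (forall (q : seq 'I_n) ptr m', size q = ln -> J m' ->
     (forall i, i <= ln -> m' (bs + i) = (nth 0 (map val (u :: q)) i).+1) ->
     good (l (val (last u q)) 0 ptr 0) p m' ->
     ok N (k, St (l (val (last u q)) 0 ptr 0) p m')
        (if A (last u q) then g q else 0%R)) ->
  J m -> good (l c0 i0 ptr0 tries) p m ->
  ok (N + (tries * (8 * ln + 15)).+1)
     (try_cmd start len base acc :: k, St (l c0 i0 ptr0 tries) p m)
     ((\sum_(j < tries) Ew ln u (fun q => if A (last u q) then 0 else 1) ^+ j)
        * Ew ln u (fun q => if A (last u q) then g q else 0))%R.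
Proof.
move=> l bX tr0 JW Jupd Hstart Hacc Hend.
set q := Ew _ _ _; set G0 := Ew _ _ _.
(* The case [t = 0] is only reached after a rejection; the induction has to remember that walk,
   which is still in memory when the loop ends. *)
have main t c i ptr m1 : J m1 -> good (l c i ptr t) p m1 ->
    (t = 0 -> exists q : seq 'I_n, [/\ size q = ln, c = val (last u q), i = 0,
       A (last u q) = false &
       forall i, i <= ln -> m1 (bs + i) = (nth 0 (map val (u :: q)) i).+1]) ->
    ok (N + (t * (8 * ln + 15)).+1)
     (try_cmd start len base acc :: k, St (l c i ptr t) p m1)
     ((\sum_(j < t) q ^+ j) * G0)%R.
  elim: t c i ptr m1 => [|t IH] c i ptr m1 Jm1 G1 H0.
    have [z [zln cz i0' Az mz]] := H0 erefl.
    rewrite big_ord0 mul0r addn1; apply: (ok_while X_word good_Inv) => //=.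
    move: G1; rewrite cz i0' => G1.
    by have := Hend z ptr m1 zln Jm1 mz G1; rewrite Az.
  have tX := good_le 13 G1; simpl in tX; have X0 := X_gt0.
  rewrite (_ : N + _ =
    ((N + (t * (8 * ln + 15)).+1).+4 + (8 * ln + 3)).+4.+4); last by lia.
  set N1 := (N + (t * (8 * ln + 15)).+1).+4.
  apply: (ok_while X_word good_Inv) => //=; apply: (ok_seq good_Inv) => //.
  have [s1 s2 _ _ _] := Hstart c i ptr t.+1 m1 Jm1.
  apply: (ok_set X_word good_Inv) => //; rewrite s2 => G2.
  apply: (ok_seq good_Inv) => //.
  have [_ _ s1' s2' _] := Hstart (val u) i ptr t.+1 m1 Jm1.
  apply: (ok_set X_word good_Inv) => //; rewrite s2' => G3.
  apply: (ok_seq good_Inv) => //.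
  have [_ _ _ _ [s1'' s2'']] := Hstart (val u) ln ptr t.+1 m1 Jm1.
  apply: (ok_set X_word good_Inv) => //; rewrite s2'' => G4.
  apply: (ok_seq good_Inv) => //=.
  have -> : ((\sum_(j < t.+1) q ^+ j) * G0 =
    Ew ln u (fun z => if A (last u z) then g z
                      else (\sum_(j < t) q ^+ j) * G0))%R.
    rewrite big_ord_recl expr0 mulrDl mul1r.
    under eq_bigr => j _ do rewrite exprS.
    rewrite -mulr_sumr -mulrA.
    rewrite {1}/G0 {1}/q -Ew_scale -Ew_add; apply: eq_Ew => z _.
    by case: (A _); rewrite ?mul0r ?mul1r ?addr0 ?add0r.
  refine (ok_walk (N := N1) G4 bX JW Jm1 Jupd _) => z zln /= Jm' G5.
  have mz j : j <= ln -> fill Add (upd m1 bs u.+1) (bs + 1) (map val z) (bs + j)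
      = (nth 0 (map val (u :: z)) j).+1.
    move=> jln; rewrite (fill_addE m1 bs (map val (u :: z))) /= size_map zln.
    by rewrite ifT ?addKn //; lia.
  have [s3 s4] := Hacc (last u z) (bs + ln) t.+1 _ Jm'.
  rewrite /N1; apply: (ok_if X_word good_Inv) => //.
  move: s4; rewrite /l; case: eqP => //= _ As; last first.
    apply: (ok_set X_word good_Inv) => //= G6.
    (* Acceptance leaves the loop early, and the remaining steps are padding. *)
    apply: (@ok_le _ _ _ _ _ _ _ _ N.+1); last by lia.
    apply: (ok_while X_word good_Inv) => //=.
    by have := Hend z (bs + ln) _ zln Jm' mz G6; rewrite -As.
  apply: (ok_set X_word good_Inv) => //=; first by split=> //; lia.
  rewrite subn1 /= -As => G6.
  apply: (@ok_le _ _ _ _ _ _ _ _ (N + (t * (8 * ln + 15)).+1)); last by lia.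
  apply: IH => // t0; exists z; split=> //.
move=> Jm G1; apply: main => // t0; by rewrite t0 in tr0.
Qed.

Lemma ok_search l p m x o c N k r fd :
  good l p m -> (x < 14)%N -> nth 0%N l x = 0%N ->
  (forall i, i <= fd -> eval_bin o (nth 0 inp 4) i <= X)%N ->
  (forall a, p a <= X)%N -> (c <= X)%N -> (nth 0 inp 4 <= X)%N -> x != 3 ->
  (c * nth 0 l 3 < X)%N -> (fd <= c * nth 0 l 3)%N ->
  (forall i, i < fd -> p (eval_bin o (nth 0 inp 4) i) = 0)%N ->
  (fd < c * nth 0 l 3 -> p (eval_bin o (nth 0 inp 4) fd) <> 0)%N ->
  (good (set_nth 0%N l x fd) p m -> ok N (k, St (set_nth 0%N l x fd) p m) r) ->
  ok (N + (2 * fd).+1) (search_cmd x o c :: k, St l p m) r.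
Proof.
move=> Gl x14 lx eX pX cX tX x3 chX fdc fd0 fd1 H.
have hX := good_le 3 Gl; have x3' : (3 == x) = false by rewrite eq_sym (negbTE x3).
pose P (j : nat) := forall N, ok N (k, St (set_nth 0%N l x fd) p m) r ->
  good (set_nth 0%N l x (fd - j)) p m ->
  ok (N + (2 * j).+1)
     (search_cmd x o c :: k, St (set_nth 0%N l x (fd - j)) p m) r.
have main : forall j, (j <= fd)%N -> P j.
  elim=> [|j IH] jfd N' HN G1.
    rewrite subn0 muln0 addn1 in G1 *.
    apply: (ok_while X_word good_Inv) => //=.
      rewrite !nth_set_nth /= eqxx x3'; have X0 := X_gt0.
      by do ![split=> //]; rewrite ?eX //; try lia; case: leqP => //; case: leqP.
    rewrite !nth_set_nth /= eqxx x3' leqn0.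
    rewrite addn1; case: ltnP => [/fd1 pfd|]; last by rewrite muln0.
    by move/eqP/negbTE: pfd => ->.
  have X0 := X_gt0.
  rewrite (_ : N' + _ = (N' + (2 * j).+1).+2)%N; last by lia.
  apply: (ok_while X_word good_Inv) => //=.
    rewrite !nth_set_nth /= eqxx x3'.
    do ![split=> //]; rewrite ?eX //; try lia; case: leqP => //; case: leqP => //.
  rewrite !nth_set_nth /= eqxx x3' fd0 ?leqnn; last by lia.
  have -> : (fd - j.+1 + 1 <= c * nth 0 l 3) = true by apply/idP; lia.
  apply: (ok_set X_word good_Inv) => //=; rewrite nth_set_nth /= eqxx.
    by split=> //; lia.
  rewrite set_set_nth eqxx (_ : fd - j.+1 + 1 = fd - j)%N; last by lia.
  by apply: IH => //; lia.
have lE : set_nth 0%N l x 0 = l.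
  apply: (@eq_from_nth _ 0%N).
    by rewrite size_set_nth; case: Gl => -> *; apply/maxn_idPr.
  by move=> i _; rewrite nth_set_nth /=; case: eqP => // ->.
have := main fd (leqnn fd) N; rewrite subnn lE; apply=> //.
by apply: H; apply: good_reg => //; lia.
Qed.

Lemma ok_bitlen y N k r0 r2 l p m r :
  good [:: r0, y, r2 & l] p m -> (0 < y)%N -> (r2 + bitlen y <= X)%N -> (2 <= X)%N ->
  (good [:: r0, 0, (r2 + bitlen y)%N & l] p m ->
   ok N (k, St [:: r0, 0, (r2 + bitlen y)%N & l] p m) r) ->
  ok (N + (4 * bitlen y).+1)
     (bitlen_cmd :: k, St [:: r0, y, r2 & l] p m) r.
Proof.
have [b yb] : exists b, (bitlen y <= b)%N by exists (bitlen y).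
elim: b y r2 N yb => // b IH y r2 N yb Gl y0 yX X2 H.
have yX' := good_le 1 Gl; simpl in yX'.
(* [bitlen 0] is 1, so halving does not lower the bit length at [y = 1]. *)
have bE : bitlen y = (if y == 1 then 1 else (bitlen (y %/ 2)).+1)%N.
  case: eqP => [->|/eqP y1]; first by rewrite /bitlen trunc_log1.
  by rewrite /bitlen trunc_log2S ?divn2 //; lia.
rewrite (_ : N + _ = (N + (4 * if y == 1 then 0 else bitlen (y %/ 2)).+1).+4);
  last by rewrite bE; case: eqP; lia.
apply: (ok_while X_word good_Inv) => //=; rewrite eqn0Ngt y0 /=.
apply: (ok_seq good_Inv) => //; apply: (ok_set X_word good_Inv) => //=.
  by split=> //; lia.
move=> G1; apply: (ok_set X_word good_Inv) => //=.
  by split=> //; rewrite /bitlen in yX; lia.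
move=> G2; rewrite /= in G2; have [y1|y1] := eqVneq y 1%N.
  move: H G2; rewrite bE y1 /= addn1 => H G2.
  by rewrite muln0 addn1; apply: (ok_while X_word good_Inv) => //=; apply: H.
move: H yX yb; rewrite bE (negbTE y1) => H yX yb.
apply: IH => //; first by lia.
- by lia.
by move: H; rewrite -addnA add1n.
Qed.

Lemma ok_sqrt s N k r0 r1 r2 r3 l p m r :
  good [:: r0, r1, r2, r3, 0 & l] p m -> nth 0 inp 0 = n ->
  (n <= s * s)%N -> (forall i, i < s -> i * i < n)%N -> (s * s < X)%N -> (s < X)%N ->
  (good [:: r0, r1, r2, r3, s & l] p m ->
   ok N (k, St [:: r0, r1, r2, r3, s & l] p m) r) ->
  ok (N + (2 * s).+1) (sqrt_cmd :: k, St [:: r0, r1, r2, r3, 0 & l] p m) r.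
Proof.
move=> Gl inp0 ns ltn_s ssX sX H.
have main : forall j : nat, (j <= s)%N ->
    good [:: r0, r1, r2, r3, (s - j) & l] p m ->
    ok (N + (2 * j).+1)
       (sqrt_cmd :: k, St [:: r0, r1, r2, r3, (s - j) & l] p m)%N r.
  elim=> [|j IH] js G1.
    rewrite subn0 muln0 addn1 in G1 *; rewrite /sqrt_cmd.
    apply: (ok_while X_word good_Inv) => //=.
      by rewrite inp0; have X0 := X_gt0; do ![split=> //]; try nia; case: leqP.
    by rewrite inp0 addn1 ltnNge ns /=; apply: H.
  rewrite (_ : N + _ = (N + (2 * j).+1).+2)%N; last by lia.
  have X0 := X_gt0.
  have sj : ((s - j.+1) * (s - j.+1) < s * s)%N by nia.
  apply: (ok_while X_word good_Inv) => //=.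
    by rewrite inp0; do ![split=> //]; try lia; case: leqP.
  rewrite inp0 addn1 ltn_s /=; last by lia.
  apply: (ok_set X_word good_Inv) => //=; first by split=> //; lia.
  rewrite (_ : s - j.+1 + 1 = s - j)%N; last by lia.
  by apply: IH; lia.
by have := main s (leqnn s); rewrite subnn; apply.
Qed.

End Blocks.

(** * Collisions between two families of walks *)

Section TailBounds.
Variable R : realType.

(** [1 - q] times the geometric sum is [1 - q ^+ m]: giving up after [m] tries only loses
    [delta]. *)
Lemma geo_sum_lower (q a delta : R) m :
  0 <= q -> 1 - q <= a -> q ^+ m <= delta ->
  1 - delta <= a * \sum_(j < m) q ^+ j.
Proof.
move=> q0 qa qm.
have G0 : 0 <= \sum_(j < m) q ^+ j by apply: sumr_ge0 => j _; apply: exprn_ge0.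
apply: le_trans (ler_wpM2r G0 qa).
have := subrX1 q m; lra.
Qed.

Lemma bernoulli (x : R) m : 0 <= x -> 1 + m%:R * x <= (1 + x) ^+ m.
Proof.
move=> x0; elim: m => [|m IH]; first by rewrite expr0 mul0r addr0.
rewrite exprS; apply: le_trans (ler_wpM2l _ IH); last by rewrite addr_ge0.
rewrite -natr1; have : 0 <= m%:R * (x * x) by rewrite mulr_ge0 // mulr_ge0.
lra.
Qed.

Lemma bernoulli_sub (x : R) m : 0 <= x <= 1 -> 1 - m%:R * x <= (1 - x) ^+ m.
Proof.
move=> /andP[x0 x1]; elim: m => [|m IH]; first by rewrite expr0 mul0r subr0.
rewrite exprS; apply: le_trans (ler_wpM2l _ IH); last by rewrite subr_ge0.
rewrite -natr1; have : 0 <= m%:R * (x * x) by rewrite mulr_ge0 // mulr_ge0.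
lra.
Qed.

(** [1 - x <= 1 / (1 + x)] and [(1 + x)^m >= 1 + m x]. *)
Lemma pow_sub_le (x : R) m : 0 <= x <= 1 -> (1 - x) ^+ m <= (1 + m%:R * x)^-1.
Proof.
move=> /andP[x0 x1].
have B := bernoulli m x0.
have p0 : 0 < 1 + m%:R * x by rewrite ltr_pwDl // mulr_ge0.
rewrite -[leRHS]mul1r ler_pdivlMr // mulrC.
apply: le_trans (ler_wpM2r (exprn_ge0 _ _) B) _; first by rewrite subr_ge0.
rewrite -exprMn exprn_ile1 //; nra.
Qed.

(** [(1 - x)^2 <= (1 - x) / (1 + x)]. *)
Lemma step_algebra (x nn ni G K o1 : R) : 0 <= x <= 1 ->
  0 < ni -> 0 <= nn -> 0 <= K -> 0 <= o1 ->
  (1 - x) * nn <= ni * (1 + x) * G ->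
  (1 - x) ^+ 3 * (o1 / ni * nn * K) <= G * (K * ((1 - x) * o1)).
Proof.
move=> /andP[x0 x1] ni0 nn0 K0 o0 H.
have H2 : (1 - x) ^+ 2 * nn <= ni * G.
  have xp : 0 < 1 + x by rewrite ltr_wpDr.
  rewrite -(ler_pM2l xp); apply: (@le_trans _ _ ((1 - x) * nn)); last lra.
  rewrite mulrA ler_wpM2r //; nra.
have -> : (1 - x) ^+ 3 * (o1 / ni * nn * K) =
    (K * ((1 - x) * o1)) * ((1 - x) ^+ 2 * nn / ni) by ring.
rewrite [leRHS]mulrC ler_wpM2l //; last by rewrite ler_pdivrMr // [G * _]mulrC.
by rewrite !mulr_ge0 // subr_ge0.
Qed.

(** Here [ni] of the [nn] vertices are fresh and [mu] is their mass. At least half of the vertices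
    are fresh and near uniformity costs at most another factor 2, so a try succeeds with probability
    at least 1/4. *)
Lemma tail_algebra (x mu nn ni : R) : 0 <= x <= 2^-1 -> 0 < nn ->
  nn <= 2 * ni -> ni * (1 - x) <= nn * mu -> 0 <= mu /\ 1 - mu <= 3 / 4.
Proof.
move=> /andP[x0 x1] nn0 nni H.
suff : 4^-1 <= mu by lra.
rewrite -(ler_pM2l nn0).
apply: le_trans H; apply: (@le_trans _ _ (ni * 2^-1)); first by lra.
by rewrite ler_wpM2l //; lra.
Qed.

Lemma square_algebra (x : R) : 0 <= x -> x <= 1 ->
  (1 + x) * (1 - x) ^+ 2 <= 1 - x.
Proof. by move=> x0 x1; nra. Qed.

(** [(1 - 1/(2s))^s <= 2/3]. *)
Lemma collision_algebra (x mu nn : R) (s tries : nat) : 0 <= x <= 2^-1 ->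
  (3 / 4) ^+ tries <= x -> (0 < s)%N -> 0 < nn -> nn <= s%:R * s%:R ->
  0 <= 1 - mu -> s%:R * (1 - x) <= nn * mu -> (1 - mu) ^+ (s * tries) <= x.
Proof.
move=> /andP[x0 x1] tail s_gt0 nn0 nns q0 H.
have s0 : 0 < s%:R :> R by rewrite ltr0n.
have s1 : 1 <= s%:R :> R by rewrite ler1n.
have mu_ge : (2 * s%:R)^-1 <= mu.
  rewrite -[leLHS]mul1r ler_pdivrMr ?mulr_gt0 //.
  rewrite -(ler_pM2l s0).
  have : nn * mu <= s%:R * s%:R * mu.
    by rewrite ler_wpM2r // -(pmulr_rge0 _ nn0); apply: le_trans H;
       rewrite mulr_ge0 ?ltW //; lra.
  nra.
apply: le_trans tail; rewrite exprM; apply: lerXn2r; rewrite ?nnegrE ?exprn_ge0 //.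
apply: (@le_trans _ _ ((1 - (2 * s%:R)^-1) ^+ s)).
  have : 1 - mu <= 1 - (2 * s%:R)^-1 by lra.
  by move=> Hq; apply: lerXn2r; rewrite ?nnegrE //; apply: le_trans Hq.
apply: le_trans (pow_sub_le _ _) _.
  apply/andP; split; first by rewrite invr_ge0 mulr_ge0 // ltW.
  by rewrite invf_le1 ?mulr_gt0 //; lra.
have -> : 1 + s%:R * (2 * s%:R)^-1 = 3 / 2 :> R by field; rewrite gt_eqF.
by rewrite invf_div; lra.
Qed.

End TailBounds.

Section Collision.
Variables (R : realType) (n d : nat) (e : rel 'I_n).
Hypotheses (d_gt0 : (0 < d)%N) (e_sym : symmetric e) (e_reg : regular e d).

Let Ew := @Ew R n d e.

Variables (delta : R) (tries s : nat).
Hypotheses (delta_ge0 : 0 <= delta) (delta_le : delta <= 2^-1).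
Hypothesis tries_tail : (3 / 4) ^+ tries <= delta.
Hypotheses (s_gt0 : (0 < s)%N) (s_half : (2 * s.-1 <= n)%N) (s_le : (s <= n)%N)
  (n_le_sqr : (n <= s * s)%N).

Definition nearly_uniform (l : nat) (u : 'I_n) : Prop :=
  forall z, 1 - delta <= n%:R * walk_pow R d e l u z <= 1 + delta.

Lemma n_gt0R : 0 < n%:R :> R.
Proof. by rewrite ltr0n; apply: leq_trans s_le. Qed.

Lemma mass_bounds l u (A : pred 'I_n) : nearly_uniform l u ->
  #|A|%:R * (1 - delta) <= n%:R * \sum_(z | A z) walk_pow R d e l u z
    <= #|A|%:R * (1 + delta).
Proof.
move=> Hu; rewrite mulr_sumr !mulr_natl -!sumr_const.
by apply/andP; split; apply: ler_sum => z _; have /andP[] := Hu z.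
Qed.

Lemma Ew_reject l u (A : pred 'I_n) :
  Ew l u (fun q => if A (last u q) then 0 else 1)
    = 1 - \sum_(z | A z) walk_pow R d e l u z.
Proof.
transitivity (\sum_z walk_pow R d e l u z * (if A z then 0 else 1)).
  exact: Ew_last.
rewrite -[X in X - _](walk_pow_row R d_gt0 e_reg l u).
rewrite [X in X - _](bigID A) /= addrAC addrN add0r [RHS]big_mkcond /=.
by apply: eq_bigr => z _; case: (A z); rewrite ?mulr0 ?mulr1.
Qed.

Lemma Ew_accept l u (A : pred 'I_n) c :
  Ew l u (fun q => if A (last u q) then c else 0)
    = (\sum_(z | A z) walk_pow R d e l u z) * c.
Proof.
transitivity (\sum_z walk_pow R d e l u z * (if A z then c else 0)).
  exact: Ew_last.
rewrite mulr_suml.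
rewrite [RHS]big_mkcond /=.
by apply: eq_bigr => z _; case: (A z); rewrite ?mulr0.
Qed.

Lemma reject_ge0 l u (A : pred 'I_n) :
  0 <= Ew l u (fun q => if A (last u q) then 0 else 1).
Proof. by apply: Ew_ge0 => q _; case: ifP. Qed.

Variables (l1 : nat) (u : 'I_n).
Hypothesis mix1 : nearly_uniform l1 u.

(** One factor comes from near uniformity on the other fresh endpoints. Two come from comparing the
    truncated geometric sum with the fresh mass, as [(1 - delta) / (1 + delta)] is at least
    [(1 - delta) ^+ 2]. *)
Let theta : R := (1 - delta) ^+ 3.

Variables (lp : seq 'I_n) (beta : R).
Hypotheses (lp_size : size lp = l1) (beta_ge0 : 0 <= beta).

Definition ends (ps : seq (seq 'I_n)) : seq 'I_n := map (last u) ps.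

(** A lower bound for the value of a table [ps] of left walks, with [o] further
    walks to be added: [beta] is the value of a complete table containing [lp],
    and when the table is complete the endpoint of [lp] is one of its [s]
    endpoints. *)
Definition table_value (o : nat) (ps : seq (seq 'I_n)) : R :=
  if (size ps + o != s)%N then 0
  else if last u lp \notin ends ps then
    theta ^+ o * (o%:R / (n - size ps)%:R * n%:R * pathw R d e u lp * beta)
  else if lp \in ps then theta ^+ o * beta else 0.

Lemma delta_bounds : 0 <= 1 - delta <= 1.
Proof. by move: delta_ge0 delta_le; lra. Qed.

Lemma theta_bounds : 0 <= theta <= 1.
Proof. by rewrite exprn_ge0 ?exprn_ile1 //=; move: delta_ge0 delta_le; lra. Qed.

Lemma table_value_ge0 o ps : 0 <= table_value o ps.
Proof.
have /andP[t0 _] := theta_bounds.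
rewrite /table_value; case: ifP => // _; case: ifP => _; last first.
  by case: ifP => // _; rewrite mulr_ge0 // exprn_ge0.
apply: mulr_ge0; first exact: exprn_ge0.
by rewrite !mulr_ge0 ?pathw_ge0 ?divr_ge0.
Qed.

Lemma card_fresh ps : uniq (ends ps) ->
  #|[pred z | z \notin ends ps]| = (n - size ps)%N.
Proof.
move=> /card_uniqP; rewrite size_map => cE.
have := cardC (mem (ends ps)); rewrite card_ord cE.
rewrite (_ : #|[predC mem (ends ps)]| = #|[pred z | z \notin ends ps]|).
  by move=> cn; have := congr1 (subn^~ (size ps)) cn; rewrite /= addKn.
by apply: eq_card => z; rewrite !inE.
Qed.

(** Draws without replacement from [k = n - size ps] fresh endpoints: the endpoint of [lp] comes now
    with probability [1 / k], or else among the next [o] draws with probability [o / (k - 1)],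
    together [(o + 1) / k]. Given the endpoint, the walk is [lp] with probability about [n] times
    its path weight. *)
Lemma table_value_step o ps :
  uniq (ends ps) -> (size ps + o.+1 = s)%N ->
  table_value o.+1 ps <=
    (\sum_(j < tries)
       Ew l1 u (fun q => if last u q \notin ends ps then 0 else 1) ^+ j)
    * Ew l1 u (fun q => if last u q \notin ends ps
                        then table_value o (rcons ps q) else 0).
Proof.
move=> uends sz; have n0 := n_gt0R.
have in_n : (size ps < n)%N by lia.
have half : n%:R <= 2 * (n - size ps)%:R :> R by rewrite -natrM ler_nat; lia.
have szr w : (size (rcons ps w) + o != s)%N = false.
  by rewrite size_rcons; apply/negbTE; rewrite negbK; apply/eqP; lia.
have card_pred k : (k.+1 = n - size ps -> k = n - (size ps).+1)%N by lia.
have mi_gt0 : (0 < o)%N -> (0 < n - (size ps).+1)%N by lia.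
have /andP[t0 t1] := theta_bounds; have /andP[d0 d1] := delta_bounds.
set A : pred 'I_n := fun z => z \notin ends ps.
set q := Ew l1 u _; set E := Ew l1 u _.
set mu := \sum_(z | A z) walk_pow R d e l1 u z.
have qE : q = 1 - mu by exact: Ew_reject.
have q0 : 0 <= q by exact: (reject_ge0 l1 u A).
have cardA : #|A| = (n - size ps)%N by exact: card_fresh.
have ni0 : 0 < (n - size ps)%:R :> R by rewrite ltr0n subn_gt0.
have /andP[muL muU] := mass_bounds A mix1; rewrite cardA -/mu in muL muU.
have [mu0 mu4] : 0 <= mu /\ 1 - mu <= 3 / 4.
  by apply: tail_algebra n0 half muL; rewrite delta_ge0.
have qm : q ^+ tries <= delta.
  apply: le_trans tries_tail; apply: lerXn2r; rewrite ?nnegrE ?divr_ge0 //.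
  by rewrite qE.
have G1 : 1 - delta <= mu * \sum_(j < tries) q ^+ j.
  by apply: geo_sum_lower => //; rewrite qE subKr.
set G := \sum_(j < tries) q ^+ j in G1 *.
have G0 : 0 <= G by apply: sumr_ge0 => j _; apply: exprn_ge0.
have to0 : 0 <= theta ^+ o by exact: exprn_ge0.
rewrite [X in X <= _]/table_value sz eqxx /=; case: ifP => [zA|/negbFE zin].
  set pw := pathw R d e u lp.
  have pw0 : 0 <= pw by exact: pathw_ge0.
  set c : R := theta ^+ o * (o%:R / (n - (size ps).+1)%:R * n%:R * pw * beta).
  set A' : pred 'I_n := fun z => (z \notin ends ps) && (z != last u lp).
  (* Accepted walks are [lp] itself, walks to another fresh vertex, and other walks to the endpoint
     of [lp]; the last kind is estimated by 0. *)
  have E1 : pw * (theta ^+ o * beta)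
      + (\sum_(z | A' z) walk_pow R d e l1 u z) * c <= E.
    rewrite -(Ew_path _ _ u _ lp_size) -(Ew_accept l1 u A') -Ew_add.
    apply: Ew_le => w _; rewrite /A'; case: eqP => [->|wlp].
      rewrite eqxx andbF addr0 zA /table_value szr /ends map_rcons mem_rcons.
      by rewrite in_cons eqxx /= mem_rcons in_cons eqxx.
    rewrite add0r; have [_|_] /= := boolP (last u w \notin ends ps); last by [].
    case: eqP => [_|wz] /=; first exact: table_value_ge0.
    rewrite /table_value szr /ends map_rcons mem_rcons in_cons negb_or zA andbT.
    by rewrite eq_sym; case: eqP => // _; rewrite size_rcons.
  have cardA' : #|A'| = (n - (size ps).+1)%N.
    have := cardD1 (last u lp) [pred z | z \notin ends ps].
    rewrite card_fresh // inE zA /= => cE.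
    move: cE; rewrite add1n => /esym/card_pred <-.
    by apply: eq_card => z; rewrite !inE andbC.
  have /andP[muL' _] := mass_bounds A' mix1; rewrite cardA' in muL'.
  set mu' := \sum_(z | A' z) _ in E1 muL'.
  have E2 : theta ^+ o * (pw * beta) * ((1 - delta) * o.+1%:R) <= E.
    (* For [o = 0] the endpoint of [lp] may be the only fresh vertex, so the division by the number
       of the others is avoided. *)
    apply: le_trans E1; case: (posnP o) => [eq_o0|o_gt0].
      have -> : c = 0 by rewrite /c eq_o0 !mul0r mulr0.
      rewrite eq_o0 mulr0 addr0 expr0 !mul1r mulr1.
      by rewrite ler_piMr ?mulr_ge0.
    have mi0 : 0 < (n - (size ps).+1)%:R :> R by rewrite ltr0n mi_gt0.
    have -> : mu' * c = theta ^+ o * (pw * beta) *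
        (o%:R * (n%:R * mu' / (n - (size ps).+1)%:R)) by rewrite /c; ring.
    rewrite [pw * (theta ^+ o * beta)](_ : _ = theta ^+ o * (pw * beta) * 1);
      last by ring.
    rewrite -mulrDr.
    rewrite ler_wpM2l ?mulr_ge0 // -natr1 mulrDr mulr1 addrC lerD //.
    by rewrite mulrC ler_wpM2l // ler_pdivlMr // mulrC.
  apply: le_trans (ler_wpM2l G0 E2).
  have G2 : (1 - delta) * n%:R <= (n - size ps)%:R * (1 + delta) * G.
    apply: le_trans (ler_wpM2r G0 muU); rewrite mulrC -mulrA.
    by rewrite ler_wpM2l // ltW.
  have -> : G * (theta ^+ o * (pw * beta) * ((1 - delta) * o.+1%:R)) =
    G * ((theta ^+ o * (pw * beta)) * ((1 - delta) * o.+1%:R)) by [].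
  have -> : theta ^+ o.+1 * (o.+1%:R / (n - size ps)%:R * n%:R * pw * beta) =
    (1 - delta) ^+ 3 * (o.+1%:R / (n - size ps)%:R * n%:R *
      (theta ^+ o * (pw * beta))) by rewrite exprS /theta; ring.
  apply: step_algebra => //; first by rewrite delta_ge0 -subr_ge0.
  by rewrite !mulr_ge0.
case: ifP => [lp_in|_]; last first.
  by rewrite mulr_ge0 //; apply: Ew_ge0 => w _; case: ifP => // _;
     apply: table_value_ge0.
have -> : E = mu * (theta ^+ o * beta).
  rewrite /mu -(Ew_accept l1 u A); apply: eq_Ew => w _; rewrite /A.
  case: ifP => // _; rewrite /table_value szr /ends map_rcons mem_rcons.
  by rewrite in_cons zin orbT /= mem_rcons in_cons lp_in orbT.
rewrite exprS -mulrA [leRHS]mulrA [G * mu]mulrC ler_wpM2r ?mulr_ge0 //.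
by apply: le_trans G1; rewrite /theta exprS ler_piMr // exprn_ile1.
Qed.

Variables (l2 : nat) (v : 'I_n).
Hypothesis mix2 : nearly_uniform l2 v.

(** Acceptance has probability at most [(1 + delta) * s / n], so conditioning on it raises the
    weight of [rp] by nearly [n / s]. That probability is also at least about [s / n >= 1 / s],
    whence [s * tries] attempts. *)
Lemma collision_step ps rp :
  uniq (ends ps) -> size ps = s -> size rp = l2 -> last v rp \in ends ps ->
  (1 - delta) ^+ 2 * (n%:R / s%:R * pathw R d e v rp) <=
    (\sum_(j < s * tries)
       Ew l2 v (fun q => if last v q \in ends ps then 0 else 1) ^+ j)
    * Ew l2 v (fun q => if last v q \in ends ps then (q == rp)%:R else 0).
Proof.
move=> uends sz rp_size rp_in; have n0 := n_gt0R.
have s0 : 0 < s%:R :> R by rewrite ltr0n.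
have nss : n%:R <= s%:R * s%:R :> R by rewrite -natrM ler_nat.
have /andP[d0 d1] := delta_bounds.
set A : pred 'I_n := fun z => z \in ends ps.
set q := Ew l2 v _; set E := Ew l2 v _.
set mu := \sum_(z | A z) walk_pow R d e l2 v z.
have qE : q = 1 - mu by exact: Ew_reject.
have q0 : 0 <= q by exact: (reject_ge0 l2 v A).
have cardA : #|A| = s.
  by rewrite -sz -(size_map (last u)); apply/card_uniqP.
have /andP[muL muU] := mass_bounds A mix2; rewrite cardA -/mu in muL muU.
have qm : q ^+ (s * tries) <= delta.
  by rewrite qE; apply: (collision_algebra _ tries_tail s_gt0 n0 nss _ muL);
    rewrite -?qE ?delta_ge0.
have G1 : 1 - delta <= mu * \sum_(j < s * tries) q ^+ j.
  by apply: geo_sum_lower => //; rewrite qE subKr.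
set G := \sum_(j < s * tries) q ^+ j in G1 *.
have G0 : 0 <= G by apply: sumr_ge0 => j _; apply: exprn_ge0.
have -> : E = pathw R d e v rp * 1.
  rewrite -(Ew_path _ _ v _ rp_size); apply: eq_Ew => w _.
  by case: eqP => [->|_]; rewrite ?rp_in //; case: ifP.
rewrite mulr1 mulrA ler_wpM2r ?pathw_ge0 //.
rewrite mulrA ler_pdivrMr // mulrC -(ler_pM2l (_ : 0 < 1 + delta)); last first.
  by rewrite ltr_wpDr.
apply: (@le_trans _ _ (n%:R * (mu * G))).
  rewrite (_ : (1 + delta) * _ = n%:R * ((1 + delta) * (1 - delta) ^+ 2));
    last by ring.
  rewrite ler_wpM2l // ?(ltW n0) //.
  by apply: le_trans G1; apply: (square_algebra delta_ge0); rewrite -subr_ge0.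
rewrite mulrA (_ : _ * (G * _) = s%:R * (1 + delta) * G); last by ring.
by rewrite ler_wpM2r.
Qed.

(** The chance [s / n] that the endpoint of [lp] enters the table cancels against the gain [n / s]
    of the collision. *)
Lemma table_value0 rp :
  beta = (1 - delta) ^+ 2 * (n%:R / s%:R * pathw R d e v rp) ->
  table_value s [::] = (1 - delta) ^+ (3 * s + 2) * n%:R *
    (pathw R d e u lp * pathw R d e v rp).
Proof.
move=> betaE; rewrite /table_value add0n eqxx /= subn0 betaE exprD exprM.
have n0 := n_gt0R; have s0 : 0 < s%:R :> R by rewrite ltr0n.
by rewrite /theta; field; rewrite !gt_eqF.
Qed.

End Collision.

(** * Bridges *)

Definition len_expr : expr := Bin Add (Reg 5) (Reg 6).
Definition left_len_expr : expr := Bin Div len_expr (Lit 2).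
Definition right_len_expr : expr := Bin Defs.Sub len_expr left_len_expr.
Definition slot_expr (j : expr) : expr :=
  Bin Add (Inp 0) (Bin Mul j (Bin Add len_expr (Lit 1))).
Definition left_addr : expr := Bin Defs.Sub (Inp 4) (Reg 5).
Definition right_addr : expr := Bin Add (Inp 4) (Reg 6).
Definition left_vertex : expr := Bin Defs.Sub (PMem left_addr) (Lit 1).
Definition right_vertex : expr := Bin Defs.Sub (PMem right_addr) (Lit 1).
Definition tries_expr : expr := Bin Mul (Lit 24) (Reg 2).
Definition unmarked : expr := Bin Leq (WMem (Reg 7)) (Lit 0).
Definition marked : expr := WMem (Reg 7).

(** Collects [Reg 12] left walks with distinct endpoints; an endpoint [z] of the
    walk in slot [j] is marked by [j + 1] at the address [z < n]. *)
Definition table_cmd : cmd :=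
  While (Reg 12)
    (Seq (SetReg 13 tries_expr)
    (Seq (try_cmd left_vertex left_len_expr (slot_expr (Reg 11)) unmarked)
    (Seq (If unmarked
            (Seq (SetWMem (Reg 7) (Bin Add (Reg 11) (Lit 1)))
                 (SetReg 11 (Bin Add (Reg 11) (Lit 1))))
            Skip)
         (SetReg 12 (Bin Defs.Sub (Reg 12) (Lit 1)))))).

(** The right walk runs backwards in time, so it is copied downwards from the right end. Both copies
    write the meeting vertex. *)
Definition splice_cmd : cmd :=
  Seq (SetReg 8 (Bin Add left_len_expr (Lit 1)))
  (Seq (SetReg 9 (slot_expr (Bin Defs.Sub marked (Lit 1))))
  (Seq (SetReg 10 left_addr)
  (Seq (copy_cmd Add)
  (Seq (SetReg 8 (Bin Add right_len_expr (Lit 1)))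
  (Seq (SetReg 9 (slot_expr (Reg 4)))
  (Seq (SetReg 10 right_addr)
       (copy_cmd Defs.Sub))))))).

Definition bridge_cmd : cmd :=
  Seq (SetReg 11 (Lit 0))
  (Seq (SetReg 12 (Reg 4))
  (Seq table_cmd
  (Seq (SetReg 13 (Bin Mul (Reg 4) tries_expr))
  (Seq (try_cmd right_vertex right_len_expr (slot_expr (Reg 4)) marked)
       (If marked splice_cmd Skip))))).

(** * Correctness of the bridge sampler *)

Section Bridge.
Local Open Scope nat_scope.
Variables (R : realType) (n d : nat) (e : rel 'I_n).
Hypotheses (n_gt0 : 0 < n) (d_gt0 : 0 < d) (e_sym : symmetric e)
  (e_reg : regular e d).
Variables (w : nat) (inp : seq nat).
Variables (Inv Post : state -> Prop) (f : state -> R).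
Variable X : nat.
Hypotheses (X_word : X < 2 ^ w) (n_X : n <= X).
Variables (PG WG : memory -> Prop).

Let good := good X 14 PG WG.
Hypothesis good_Inv : forall l p m, good l p m -> Inv (St l p m).

Let ok := ok e w inp Inv Post f.

Variables (t L h s da db : nat) (u v : 'I_n) (p : memory).
Hypotheses (inp0 : nth 0 inp 0 = n) (inp4 : nth 0 inp 4 = t).
Hypotheses (da_t : da <= t) (p_left : p (t - da) = u.+1)
  (p_right : p (t + db) = v.+1).
Hypotheses (s_gt0 : 0 < s) (s_half : 2 * s.-1 <= n) (s_le : s <= n)
  (n_le_sqr : n <= s * s).

Let len := da + db.
Let l1 := len %/ 2.
Let l2 := len - l1.
Let W0 := n + s.+1 * len.+1.
Let slot i := n + i * len.+1.

Hypotheses (W0_X : W0 <= X) (tdb_X : t + db < X) (tries_X : s * (24 * L) <= X)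
  (X_ge : 24 <= X) (L_gt0 : 0 < L).

Hypothesis confined_WG : forall F m, size F <= s + s.+1 * len.+1 ->
  confined mem0 W0 n F m -> WG m.

Variable K : memory -> Prop.
Hypotheses (K_PG : forall p', K p' -> PG p') (Kp : K p)
  (K_upd : forall p' a x, K p' -> t - da <= a <= t + db -> x < n ->
     K (upd p' a x.+1)).

Lemma l1_len : l1 <= len. Proof. exact: leq_div. Qed.

(** A mark may lie anywhere below [n], but only endpoints are marked. Listing these, at most [s] of
    them, and not all addresses below [n] keeps the working space of order sqrt n. *)
Definition cells (ps : seq (seq 'I_n)) : seq nat :=
  [seq val z | z <- ends u ps] ++ iota n (s.+1 * len.+1).

Definition table (ps : seq (seq 'I_n)) (m : memory) : Prop :=
  [/\ confined mem0 W0 n (cells ps) m, uniq (ends u ps) /\ size ps <= s,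
      (forall q, q \in ps -> size q = l1),
      (forall z : 'I_n, m z = if z \in ends u ps
                              then (index z (ends u ps)).+1 else 0) &
      (forall i k, i < size ps -> k <= l1 ->
         m (slot i + k) = (nth 0 (map val (u :: nth [::] ps i)) k).+1)].

Lemma table_WG ps m : table ps m -> WG m.
Proof.
move=> [nm [_ szs] _ _ _]; apply: (confined_WG _ nm).
by rewrite size_cat !size_map size_iota leq_add2r.
Qed.

(** The slots from number [size ps] on are scratch space, which rejected walks may overwrite. *)
Lemma table_upd ps m a x : table ps m -> slot (size ps) <= a < W0 -> x <= n ->
  table ps (upd m a x).
Proof.
move=> [nm us sz mz ms] /andP[sa aW] xn; have n_a : n <= a.
  by apply: leq_trans sa; apply: leq_addr.
split=> //.
- apply: confined_upd => //; rewrite mem_cat mem_iota n_a aW orbT //.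
- move=> z; rewrite updE mz; case: eqP => // za.
  by have := ltn_ord z; rewrite za ltnNge n_a.
move=> i k ips kl; rewrite updE ms //; case: eqP => // ika.
have : i.+1 * len.+1 <= size ps * len.+1 by rewrite leq_mul2r ips.
have := l1_len; move: sa ika; rewrite /slot; lia.
Qed.

Lemma table_rcons ps m q : table ps m -> size q = l1 -> size ps < s ->
  last u q \notin ends u ps ->
  (forall k, k <= l1 ->
     m (slot (size ps) + k) = (nth 0 (map val (u :: q)) k).+1) ->
  table (rcons ps q) (upd m (last u q) (size ps).+1).
Proof.
move=> [[nm1 nm2] [us szs] sz mz ms] qs pss zE mq.
have cE a : (a \in cells (rcons ps q)) = (a == val (last u q)) || (a \in cells ps).
  rewrite /cells /ends map_rcons map_rcons !mem_cat mem_rcons in_cons.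
  by rewrite orbA.
split.
- split=> a; rewrite cE updE; case: eqP => [->|_] //=; first exact: nm1.
    move=> _; split; last exact: leq_trans s_le.
    by rewrite /W0; have := ltn_ord (last u q); lia.
  exact: nm2.
- by rewrite size_rcons; split=> //; rewrite /ends map_rcons rcons_uniq zE.
- by move=> r; rewrite mem_rcons in_cons => /predU1P[->|/sz].
- move=> z; rewrite updE /ends map_rcons mem_rcons in_cons -val_eqE /=.
  rewrite -cats1 index_cat; case: eqP => [zq|_] /=.
    have -> : z = last u q by apply: val_inj.
    by rewrite (negbTE zE) /= eqxx addn0 size_map.
  by rewrite mz; case: (z \in _).
move=> i k; rewrite size_rcons ltnS leq_eqVlt nth_rcons updE => ips kl.
rewrite ifF; last first.
  by apply/negbTE/eqP; have := ltn_ord (last u q); rewrite /slot; lia.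
case/predU1P: ips => [->|ips]; first by rewrite ltnn eqxx mq.
by rewrite ips ms.
Qed.

Lemma table_mark_le ps m (z : 'I_n) : table ps m -> m z <= X.
Proof.
move=> [_ [_ szs] _ -> _]; case: ifP => // zin.
apply: leq_trans n_X; apply: leq_trans s_le; apply: leq_trans szs.
by rewrite -(size_map (last u)) index_mem.
Qed.

Let regs r0 r1 cur i ptr r10 j o tr :=
  [:: r0; r1; L; h; s; da; db; cur; i; ptr; r10; j; o; tr].

Lemma fits_slot r0 r1 cur i ptr r10 j o tr m g :
  let l := regs r0 r1 cur i ptr r10 j o tr in
  fits inp X l p m g -> evn inp l p m g <= s ->
  fits inp X l p m (slot_expr g) /\
  evn inp l p m (slot_expr g) = slot (evn inp l p m g).
Proof.
move=> l fg gs; rewrite /= inp0 /slot -/len addn1; split=> //.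
have h1 : evn inp l p m g * len.+1 <= s * len.+1 by rewrite leq_mul2r gs orbT.
have h2 : s.+1 * len.+1 = s * len.+1 + len.+1 by rewrite mulSn addnC.
by move: W0_X; rewrite /W0; rewrite /len in h1 h2 *; do ![split=> //]; lia.
Qed.

Lemma fits_left r0 r1 cur i ptr r10 j o tr m :
  let l := regs r0 r1 cur i ptr r10 j o tr in
  [/\ fits inp X l p m left_vertex, evn inp l p m left_vertex = val u,
      fits inp X l p m left_len_expr & evn inp l p m left_len_expr = l1].
Proof.
move=> l; rewrite /= inp4 p_left subn1 /=; have := ltn_ord u.
move: W0_X tdb_X; rewrite /W0 mulSn => hW ht hu; have := l1_len.
rewrite /l1 /len in hW * => hl.
by do ![split=> //]; lia.
Qed.

Lemma fits_right r0 r1 cur i ptr r10 j o tr m :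
  let l := regs r0 r1 cur i ptr r10 j o tr in
  [/\ fits inp X l p m right_vertex, evn inp l p m right_vertex = val v,
      fits inp X l p m right_len_expr & evn inp l p m right_len_expr = l2].
Proof.
move=> l; rewrite /= inp4 p_right subn1 /=; have := ltn_ord v.
move: W0_X tdb_X; rewrite /W0 mulSn => hW ht hu; have := l1_len.
rewrite /l2 /l1 /len in hW * => hl.
by do ![split=> //]; lia.
Qed.

Variables (delta : R) (lp rp : seq 'I_n).
Hypotheses (delta_ge0 : (0 <= delta)%R) (delta_le : (delta <= 2^-1)%R).
Hypothesis tries_tail : ((3 / 4) ^+ (24 * L) <= delta)%R.
Hypotheses (mix1 : nearly_uniform d e delta l1 u)
  (mix2 : nearly_uniform d e delta l2 v).
Hypotheses (lp_size : size lp = l1) (rp_size : size rp = l2)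
  (lp_rp : last u lp = last v rp).

Let beta : R :=
  ((1 - delta) ^+ 2 * (n%:R / s%:R * pathw R d e v rp))%R.

Let tv := table_value d e delta s u lp beta.

Lemma beta_ge0 : (0 <= beta)%R.
Proof. by rewrite !mulr_ge0 ?exprn_ge0 ?pathw_ge0 ?(andP (delta_bounds _ _)).1. Qed.

Lemma ok_table o ps m N k r0 r1 r10 cur i ptr tr :
  (forall ps m cur i ptr tr, table ps m ->
     good (regs r0 r1 cur i ptr r10 (size ps) 0 tr) p m ->
     ok N (k, St (regs r0 r1 cur i ptr r10 (size ps) 0 tr) p m) (tv 0 ps)) ->
  table ps m -> size ps + o <= s ->
  good (regs r0 r1 cur i ptr r10 (size ps) o tr) p m ->
  ok (N + (o * (24 * L * (8 * l1 + 15) + 12)).+1)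
    (table_cmd :: k, St (regs r0 r1 cur i ptr r10 (size ps) o tr) p m)
    (tv o ps).
Proof.
move=> Hend; elim: o ps m cur i ptr tr => [|o IH] ps m cur i ptr tr Tm os Gm.
  rewrite mul0n addn1; apply: (ok_while X_word good_Inv) => //=.
  exact: Hend.
have oX := good_le 12 Gm; have jX := good_le 11 Gm; simpl in oX, jX.
eapply (@ok_le _ _ _ _ _ _ _ _ _ (N + _)).
  apply: (ok_while X_word good_Inv) => //=.
  apply: (ok_seq good_Inv) => //; apply: (ok_set X_word good_Inv) => //=.
    have hL : 24 * L <= s * (24 * L) by rewrite leq_pmull.
    by do ![split=> //]; lia.
  move=> G1; apply: (ok_seq good_Inv) => //=.
  have psn : size ps < s by lia.
  have slot_le : slot (size ps) + l1 < W0.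
    have : (size ps).+1 * len.+1 <= s * len.+1 by rewrite leq_mul2r psn orbT.
    by have := l1_len; rewrite /slot /W0 !mulSn; lia.
  pose N1 := (N + (o * (24 * L * (8 * l1 + 15) + 12)).+1).+4.+3.
  apply: (@ok_weak _ _ _ _ _ _ _ _ (N1 + (24 * L * (8 * l1 + 15)).+1) _
    ((\sum_(j < 24 * L)
       Ew d e l1 u (fun q => if last u q \notin ends u ps then 0 else 1) ^+ j)
    * Ew d e l1 u (fun q => if last u q \notin ends u ps
                        then tv o (rcons ps q) else 0))%R).
    apply: (ok_try n_gt0 d_gt0 e_reg X_word n_X good_Inv (u := u) (ln := l1)
      (bs := slot (size ps)) (A := fun z => z \notin ends u ps) (N := N1)
      (J := table ps) (g := fun q => tv o (rcons ps q))) => //.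
    - by apply: leq_trans W0_X; apply: ltnW.
    - by lia.
    - exact: table_WG.
    - move=> m' a x Tm' /andP[sa al] xn; apply: table_upd => //.
      by rewrite sa; apply: leq_ltn_trans slot_le.
    - move=> cur' i' ptr' tr' m' _ l'.
      have [? ? ? ?] := fits_left r0 r1 cur' i' ptr' r10 (size ps) o.+1 tr' m'.
      split=> //; apply: (@fits_slot _ _ _ _ _ _ _ _ _ _ (Reg 11)) => //=.
      exact: ltnW.
    - move=> z ptr' tr' m' Tm' l' /=; have [_ _ _ mz _] := Tm'.
      have zX := table_mark_le z Tm'; have zn := ltn_ord z.
      split; first by do ![split=> //]; try lia; case: leqP => //; lia.
      by rewrite mz leqn0; case: (z \in _).
    move=> q ptr' m' qs Tm' mq Gm'.
    have [_ _ _ mz _] := Tm'.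
    have zn := ltn_ord (last u q).
    apply: (ok_seq good_Inv) => //; apply: (ok_if X_word good_Inv) => //=.
      have zX := table_mark_le (last u q) Tm'.
      by do ![split=> //]; try lia; case: leqP => //; lia.
    rewrite mz leqn0; have [zin|zin] := boolP (last u q \in ends u ps) => /=.
      (* All tries failed: the table stays one walk short, and the value to be reached is 0. *)
      apply: (ok_skip good_Inv) => //.
      apply: (ok_set X_word good_Inv) => //=.
        by do ![split=> //]; lia.
      rewrite subn1 /= => G2.
      apply: (@ok_le _ _ _ _ _ _ _ _
                (N + (o * (24 * L * (8 * l1 + 15) + 12)).+1)); last by lia.
      apply: (ok_weak (r := tv o ps)); first by apply: IH => //; lia.
      by apply: table_value_ge0 => //; apply: beta_ge0.
    have Tr : table (rcons ps q) (upd m' (last u q) (size ps).+1).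
      by apply: table_rcons.
    apply: (ok_seq good_Inv) => //; apply: (ok_setw X_word good_Inv) => //=.
    - by lia.
    - by do ![split=> //]; lia.
    - by rewrite addn1; apply: table_WG Tr.
    rewrite addn1 => G2; apply: (ok_set X_word good_Inv) => //=.
      by do ![split=> //]; lia.
    rewrite addn1 => G3; apply: (ok_set X_word good_Inv) => //=.
      by do ![split=> //]; lia.
    rewrite subn1 /= => G4.
    apply: (@ok_le _ _ _ _ _ _ _ _
              (N + (o * (24 * L * (8 * l1 + 15) + 12)).+1)); last by lia.
    have := IH (rcons ps q); rewrite size_rcons; apply=> //; lia.
  have [sz|sz] := eqVneq (size ps + o.+1) s.
    have [_ [us _] _ _ _] := Tm.
    apply: table_value_step => //; exact: beta_ge0.
  rewrite {1}/tv /table_value sz mulr_ge0 // ?sumr_ge0 // => [j _|].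
    by apply: exprn_ge0; apply: Ew_ge0 => q _; case: ifP.
  apply: Ew_ge0 => q _; case: ifP => // _; apply: table_value_ge0 => //.
  exact: beta_ge0.
by rewrite mulSn; lia.
Qed.

Lemma table_index ps m q : table ps m -> q \in ps ->
  nth [::] ps (index (last u q) (ends u ps)) = q.
Proof.
move=> [_ [us _] _ _ _] qps.
rewrite -[in index _ _](nth_index [::] qps) -(nth_map _ (last u [::])) ?index_mem //.
by rewrite index_uniq ?size_map ?index_mem ?nth_index.
Qed.

Lemma slot_mono i j : i <= j -> slot i <= slot j.
Proof. by move=> ij; rewrite leq_add2l leq_mul2r ij orbT. Qed.

Lemma slot_s_W0 : slot s + len < W0.
Proof. by rewrite /slot /W0 mulSn; lia. Qed.

Lemma ok_splice ps m N k r0 r1 cur i ptr r10 o tr q x r :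
  table ps m -> q = nth [::] ps (index (last v x) (ends u ps)) ->
  last v x \in ends u ps -> size x = l2 -> cur = val (last v x) ->
  (forall j, j <= l2 -> m (slot s + j) = (nth 0 (map val (v :: x)) j).+1) ->
  good (regs r0 r1 cur i ptr r10 (size ps) o tr) p m ->
  (forall i ptr r10,
     let p' := fill Defs.Sub (fill Add p (t - da) (map val (u :: q)))
                 (t + db) (map val (v :: x)) in
     size q = l1 -> last u q = last v x ->
     K p' -> good (regs r0 r1 cur i ptr r10 (size ps) o tr) p' m ->
     ok N (k, St (regs r0 r1 cur i ptr r10 (size ps) o tr) p' m) r) ->
  ok (N + (8 * len + 40))
     (splice_cmd :: k, St (regs r0 r1 cur i ptr r10 (size ps) o tr) p m) r.
Proof.
move=> Tm qE zin x_size curE mx Gm H.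
have [_ [us szs] sz mz ms] := Tm.
set z := last v x in qE zin curE H *; set idx := index z (ends u ps) in qE.
have idx_lt : idx < size ps by rewrite /idx -(size_map (last u)) index_mem.
have q_in : q \in ps by rewrite qE mem_nth.
have q_size := sz _ q_in.
have q_last : last u q = z.
  by rewrite qE -(nth_map _ (last u [::])) // nth_index.
have m_cur : m cur = idx.+1 by rewrite curE mz zin.
have idx_s : idx < s by exact: leq_trans szs.
have zX := table_mark_le z Tm; have zn := ltn_ord z.
have curX : cur <= X by rewrite curE; apply: leq_trans n_X; apply: ltnW.
have l12 : l1 + l2 = len by rewrite /l2 subnKC // l1_len.
have sq : size (map val (u :: q)) = l1 + 1 by rewrite /= size_map q_size addn1.
have sx : size (map val (v :: x)) = l2 + 1 by rewrite /= size_map x_size addn1.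
have slotX j : j <= s -> slot j + (len + 1) <= X.
  move=> js; apply: leq_trans W0_X; rewrite addn1 addnS.
  by apply: leq_ltn_trans slot_s_W0; rewrite leq_add2r; apply: slot_mono.
have lenX : len + 1 <= X by apply: leq_trans (slotX 0 _) => //; apply: leq_addl.
pose NB := (N + (8 * size (map val (v :: x))).+1).+3.+3.
pose NA := (NB + (8 * size (map val (u :: q))).+1).+4.+3.
apply: (@ok_le _ _ _ _ _ _ _ _ NA); last first.
  by rewrite /NA /NB sq sx -l12; lia.
apply: (ok_seq good_Inv) => //; apply: (ok_set X_word good_Inv) => //.
  have [_ _ f1 e1] := fits_left r0 r1 cur i ptr r10 (size ps) o tr m.
  by split=> //=; [lia | move: e1 => /= ->; lia].
have [_ _ _ /= ->] := fits_left r0 r1 cur i ptr r10 (size ps) o tr m.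
rewrite -sq => G1; apply: (ok_seq good_Inv) => //.
set l3 := regs r0 r1 cur (size (map val (u :: q))) ptr r10 (size ps) o tr.
have e2' : evn inp l3 p m (Bin Defs.Sub marked (Lit 1)) = idx.
  by rewrite /= m_cur subn1.
have [||f2 e2] := @fits_slot r0 r1 cur (size (map val (u :: q))) ptr r10 (size ps) o tr
  m (Bin Defs.Sub marked (Lit 1)).
- by rewrite /= m_cur; split=> //; lia.
- by rewrite e2' ltnW.
apply: (ok_set X_word good_Inv) => //; rewrite [evn _ _ _ _ _]e2.
rewrite e2' => G2.
apply: (ok_seq good_Inv) => //; apply: (ok_set X_word good_Inv) => //=.
  by rewrite inp4; do ![split=> //]; lia.
rewrite inp4 => G3; apply: (ok_seq good_Inv) => //.
refine (ok_copy n_gt0 d_gt0 X_word n_X good_Inv (o := Add)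
  (q := map val (u :: q)) (N := NB) (lo := t - da) (hi := t + db) (K := K)
  _ _ _ _ _ _ _ _ _ _) => //.
- by rewrite sq; apply: leq_trans (slotX idx (ltnW idx_s)); lia.
- by rewrite sq; split=> //; lia.
- by apply/allP => _ /mapP[y _ ->]; apply: ltn_ord.
- by move=> j; rewrite sq addn1 ltnS => jl; rewrite ms // -qE.
move=> ptr' dst' l' p1 Kp1 G4; rewrite /l' /NB; apply: (ok_seq good_Inv) => //=.
apply: (ok_set X_word good_Inv) => //.
  have [_ _ f3 e3] := fits_right r0 r1 cur 0 ptr' dst' (size ps) o tr m.
  by split=> //=; [lia | move: e3 => /= ->; lia].
have [_ _ _ /= ->] := fits_right r0 r1 cur 0 ptr' dst' (size ps) o tr m.
rewrite -sx => G5; apply: (ok_seq good_Inv) => //.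
have [||f4 e4] := @fits_slot r0 r1 cur (size (map val (v :: x))) ptr' dst' (size ps)
  o tr m (Reg 4).
- by rewrite /=; apply: leq_trans n_X.
- by [].
apply: (ok_set X_word good_Inv) => //; rewrite [evn _ _ _ _ _]e4 [evn _ _ _ _ _]/=.
move=> G6; apply: (ok_seq good_Inv) => //; apply: (ok_set X_word good_Inv) => //=.
  by rewrite inp4; do ![split=> //]; lia.
rewrite inp4 => G7.
refine (ok_copy n_gt0 d_gt0 X_word n_X good_Inv (o := Defs.Sub)
  (q := map val (v :: x)) (N := N) (lo := t - da) (hi := t + db) (K := K)
  _ _ _ _ _ _ _ _ _ _) => //.
- by rewrite sx; apply: leq_trans (slotX s (leqnn s)); lia.
- by rewrite sx; split=> //; lia.
- by apply/allP => _ /mapP[y _ ->]; apply: ltn_ord.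
- by move=> j; rewrite sx addn1 ltnS => jl; rewrite mx.
by move=> ptr2 dst2 l2' p2 Kp2 G8; apply: H.
Qed.

Lemma ok_bridge N k r0 r1 cur i ptr r10 j o tr m :
  let target (q x : seq 'I_n) : R := (((q == lp) && (x == rp))%:R)%R in
  confined mem0 W0 n [::] m ->
  good (regs r0 r1 cur i ptr r10 j o tr) p m ->
  (forall cur i ptr r10 j o tr m,
     good (regs r0 r1 cur i ptr r10 j o tr) p m ->
     ok N (k, St (regs r0 r1 cur i ptr r10 j o tr) p m) 0%R) ->
  (forall q x cur i ptr r10 j o tr m,
     let p' := fill Defs.Sub (fill Add p (t - da) (map val (u :: q)))
                 (t + db) (map val (v :: x)) in
     size q = l1 -> size x = l2 -> last u q = last v x -> K p' ->
     good (regs r0 r1 cur i ptr r10 j o tr) p' m ->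
     ok N (k, St (regs r0 r1 cur i ptr r10 j o tr) p' m) (target q x)) ->
  ok (N + (s * (24 * L) * (16 * len + 30) + 12 * s + 8 * len + 60))
     (bridge_cmd :: k, St (regs r0 r1 cur i ptr r10 j o tr) p m)
     ((1 - delta) ^+ (3 * s + 2) * n%:R *
        (pathw R d e u lp * pathw R d e v rp))%R.
Proof.
move=> target m0 Gm Hfail Hend.
have l12 : l1 + l2 = len by rewrite /l2 subnKC // l1_len.
have T0 : table [::] m.
  split=> //.
  - split=> a; first by move=> _; apply: m0.1.
    rewrite mem_iota => /andP[_ aW]; rewrite (m0.1 a) // mem0E; split=> //.
    by apply: ltnW.
  - by move=> z; rewrite (m0.1 z) ?mem0E.
pose N2 := N + (8 * len + 40).
pose N1 := (N2.+1 + (s * (24 * L) * (8 * l2 + 15)).+1).+3.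
pose N0 := (N1 + (s * (24 * L * (8 * l1 + 15) + 12)).+1).+4.+1.
apply: (@ok_le _ _ _ _ _ _ _ _ N0); last first.
  rewrite /N0 /N1 /N2.
  have -> : s * (24 * L * (8 * l1 + 15) + 12) =
      s * (24 * L) * (8 * l1 + 15) + 12 * s by rewrite mulnDr mulnA [s * 12]mulnC.
  rewrite -l12.
  set a := s * (24 * L); have : a * (8 * l2 + 15) + a * (8 * l1 + 15) <=
    a * (16 * (l1 + l2) + 30) by rewrite -mulnDr leq_mul2l; apply/orP; right; lia.
  by lia.
apply: (ok_seq good_Inv) => //; apply: (ok_set X_word good_Inv) => //= G1.
apply: (ok_seq good_Inv) => //; apply: (ok_set X_word good_Inv) => //=.
  by apply: leq_trans n_X.
move=> G2; apply: (ok_seq good_Inv) => //.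
rewrite -(table_value0 (v := v) (rp := rp) s_gt0 s_le u lp (erefl beta)).
refine (@ok_table s [::] m N1 _ _ _ _ _ _ _ _ _ T0 _ _) => //.
move=> ps m1 cur1 i1 ptr1 tr1 Tm1 Gm1; rewrite /N1.
have [_ [us szs] _ _ _] := Tm1.
apply: (ok_seq good_Inv) => //; apply: (ok_set X_word good_Inv) => //=.
  have hL : 24 * L <= s * (24 * L) by rewrite leq_pmull.
  do ![split=> //]; try lia; exact: leq_trans n_X.
move=> G3; apply: (ok_seq good_Inv) => //.
(* Credit is given only if [lp] is in a complete table. The endpoints are distinct, so the walk [rp]
   can then only be spliced with [lp]. *)
pose g (x : seq 'I_n) : R :=
  (if (size ps == s) && (lp \in ps) then (x == rp)%:R else 0)%R.
apply: (ok_weak (r := ((\sum_(j < s * (24 * L))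
       Ew d e l2 v (fun q => if last v q \in ends u ps then 0 else 1) ^+ j)
    * Ew d e l2 v (fun q => if last v q \in ends u ps then g q else 0))%R)).
  apply: (ok_try n_gt0 d_gt0 e_reg X_word n_X good_Inv (u := v) (ln := l2)
      (bs := slot s) (A := fun z => z \in ends u ps) (N := N2.+1)
      (J := table ps) (g := g)) => //.
  - by apply: leq_trans W0_X; apply: leq_trans (ltnW slot_s_W0); lia.
  - by rewrite !muln_gt0 s_gt0.
  - exact: table_WG.
  - move=> m' a y Tm' /andP[sa al] yn; apply: table_upd => //.
    rewrite (leq_trans _ sa) ?slot_mono //=.
    by apply: leq_ltn_trans slot_s_W0; lia.
  - move=> cur' i' ptr' tr' m' _ l'.
    have [? ? ? ?] := fits_right r0 r1 cur' i' ptr' r10 (size ps) 0 tr' m'.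
    split=> //; apply: (@fits_slot _ _ _ _ _ _ _ _ _ _ (Reg 4)) => //=.
    exact: leq_trans n_X.
  - move=> z ptr' tr' m' Tm' l' /=; have [_ _ _ mz _] := Tm'.
    have zX := table_mark_le z Tm'; have zn := ltn_ord z.
    split; first by split=> //; lia.
    by rewrite mz; case: (z \in _).
  move=> x ptr' m' xs Tm' mx Gm'.
  have [_ _ _ mz _] := Tm'; have zn := ltn_ord (last v x).
  apply: (ok_if X_word good_Inv) => //=.
    by have := table_mark_le (last v x) Tm'; split=> //; lia.
  rewrite mz; have [zin|zin] := boolP (last v x \in ends u ps); last first.
    apply: (@ok_le _ _ _ _ _ _ _ _ N.+1); last by rewrite /N2; lia.
    by apply: (ok_skip good_Inv) => //; apply: Hfail.
  apply: (ok_splice Tm' (erefl _) zin xs (erefl _) mx) => //.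
  move=> i2 ptr2 r2 p' qs ql Kp' Gp'.
  apply: (ok_weak (r := target (nth [::] ps (index (last v x) (ends u ps))) x)).
    exact: Hend.
  rewrite /g /target; case: ifP => [/andP[_ lp_in]|_]; last by rewrite ler0n.
  case: eqP => [xE|_]; last by rewrite ler0n.
  by rewrite xE -lp_rp (table_index Tm1 lp_in) eqxx.
have Ew0 : (0 <= (\sum_(j < s * (24 * L))
       Ew d e l2 v (fun q => if last v q \in ends u ps then 0 else 1) ^+ j)
    * Ew d e l2 v (fun q => if last v q \in ends u ps then g q else 0))%R.
  rewrite mulr_ge0 // ?sumr_ge0 // => [j' _|].
    by apply: exprn_ge0; apply: Ew_ge0 => q _; case: ifP.
  by apply: Ew_ge0 => q _; rewrite /g; do ![case: ifP => // _]; rewrite ler0n.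
rewrite {1}/tv /table_value addn0; case: eqP => //= sz.
rewrite mul0r !mul0r mulr0 expr0 mul1r; case: ifP => // zin; case: ifP => // lp_in.
have := collision_step d_gt0 e_reg delta_ge0 delta_le tries_tail s_gt0 s_le
  n_le_sqr mix2 us sz rp_size.
rewrite -lp_rp => /(_ (negbFE zin)).
rewrite /g sz eqxx lp_in /=; exact.
Qed.

End Bridge.

(** * Known times *)

Section KnownTimes.
Local Open Scope nat_scope.

(** The address [a] holds the vertex at time [a]; the vertex at time 0 is known
    even in the initial memory. *)
Definition start (M : memory) : memory := upd M 0 1.

Lemma startE M a : start M a = if a == 0 then 1 else M a.
Proof. by rewrite /start updE. Qed.

(** [find] returns the length of the list if nothing is found, so a gap of [8 * h] may end at a free
    cell; [near_left] decides. Truncated subtraction does no harm because cell 0 of [start M] is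
    never free. *)
Definition left_gap (M : memory) (h t : nat) : nat :=
  find (fun i => start M (t - i) != 0) (iota 0 (8 * h)).
Definition right_gap (M : memory) (h t : nat) : nat :=
  find (fun i => start M (t + i) != 0) (iota 0 (2 * h)).
Definition near_left M h t : bool := start M (t - left_gap M h t) != 0.
Definition near_right M h t : bool := start M (t + right_gap M h t) != 0.
Definition low M h t : nat := if near_left M h t then t - left_gap M h t else t.
Definition high M h t : nat := if near_right M h t then t + right_gap M h t else t.

Definition store (M : memory) (lo hi : nat) (x : nat -> nat) : memory :=
  fill Add M lo [seq x i | i <- iota lo (hi.+1 - lo)].

Lemma storeE M lo hi x a : lo <= hi.+1 ->
  store M lo hi x a = if lo <= a <= hi then (x a).+1 else M a.
Proof.
move=> lohi; rewrite /store fill_addE size_map size_iota subnKC // ltnS.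
case: ifP => // /andP[la ah]; rewrite (nth_map 0) ?size_iota; last by lia.
by rewrite nth_iota ?subnKC //; lia.
Qed.

Definition new_memory (h : nat) (M : memory) (t : nat) (x : nat -> nat) : memory :=
  store (start M) (low M h t) (high M h t) x.

Section Gaps.
Variables (M : memory) (h t : nat).

Lemma find_iotaP (P : pred nat) m :
  [/\ find P (iota 0 m) <= m, (forall i, i < find P (iota 0 m) -> ~~ P i)
    & (find P (iota 0 m) < m -> P (find P (iota 0 m)))].
Proof.
split.
- by rewrite -[leqRHS](size_iota 0) find_size.
- move=> i im; have := before_find 0 im; rewrite nth_iota ?add0n => [->//|].
  by apply: leq_trans im _; rewrite -[leqRHS](size_iota 0) find_size.
- move=> fm; have := @nth_find _ 0 P (iota 0 m).
  by rewrite has_find size_iota nth_iota // add0n; apply.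
Qed.

Lemma left_gap_le : left_gap M h t <= 8 * h.
Proof. by have [] := find_iotaP (fun i => start M (t - i) != 0) (8 * h). Qed.

Lemma left_gap_before i : i < left_gap M h t -> start M (t - i) = 0.
Proof.
have [_ H _] := find_iotaP (fun i => start M (t - i) != 0) (8 * h).
by move=> /H; rewrite negbK => /eqP.
Qed.

Lemma left_gap_end : left_gap M h t < 8 * h -> start M (t - left_gap M h t) <> 0.
Proof.
have [_ _ H] := find_iotaP (fun i => start M (t - i) != 0) (8 * h).
by move=> /H/eqP.
Qed.

Lemma right_gap_le : right_gap M h t <= 2 * h.
Proof. by have [] := find_iotaP (fun i => start M (t + i) != 0) (2 * h). Qed.

Lemma right_gap_before i : i < right_gap M h t -> start M (t + i) = 0.
Proof.
have [_ H _] := find_iotaP (fun i => start M (t + i) != 0) (2 * h).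
by move=> /H; rewrite negbK => /eqP.
Qed.

Lemma right_gap_end :
  right_gap M h t < 2 * h -> start M (t + right_gap M h t) <> 0.
Proof.
have [_ _ H] := find_iotaP (fun i => start M (t + i) != 0) (2 * h).
by move=> /H/eqP.
Qed.

Lemma left_gap_t : left_gap M h t <= t.
Proof.
rewrite leqNgt; apply/negP => tg; have := left_gap_before tg.
by rewrite subnn startE.
Qed.

(** Time 0 is known, so a search that found nothing did not get there. *)
Lemma far_left i : ~~ near_left M h t -> i <= 8 * h ->
  8 * h < t /\ start M (t - i) = 0.
Proof.
rewrite /near_left negbK => /eqP far ih.
have gE : left_gap M h t = 8 * h.
  have := left_gap_le; rewrite leq_eqVlt => /orP[/eqP //|/left_gap_end].
  by rewrite far.
rewrite gE in far; split.
  rewrite ltnNge; apply/negP => th; have : t - 8 * h = 0 by lia.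
  by move=> E; rewrite E startE in far.
move: ih; rewrite leq_eqVlt => /orP[/eqP ->//|ih].
by apply: left_gap_before; rewrite gE.
Qed.

Lemma far_right i : ~~ near_right M h t -> i <= 2 * h -> start M (t + i) = 0.
Proof.
rewrite /near_right negbK => /eqP far ih.
have gE : right_gap M h t = 2 * h.
  have := right_gap_le; rewrite leq_eqVlt => /orP[/eqP //|/right_gap_end].
  by rewrite far.
rewrite gE in far.
move: ih; rewrite leq_eqVlt => /orP[/eqP ->//|ih].
by apply: right_gap_before; rewrite gE.
Qed.

Lemma low_le : low M h t <= t.
Proof. by rewrite /low; case: ifP => // _; apply: leq_subr. Qed.

Lemma high_ge : t <= high M h t.
Proof. by rewrite /high; case: ifP => // _; apply: leq_addr. Qed.

Lemma low_high : low M h t <= high M h t.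
Proof. exact: leq_trans low_le high_ge. Qed.

Lemma inside_gap a : low M h t < a < high M h t -> start M a = 0.
Proof.
move=> /andP[la ah]; case: (leqP a t) => at_.
  rewrite -(subKn at_); apply: left_gap_before.
  move: la; rewrite /low; case: ifP => _; last by lia.
  by have := left_gap_t; lia.
have -> : a = t + (a - t) by lia.
apply: right_gap_before.
by move: ah; rewrite /high; case: ifP => _; lia.
Qed.

Lemma new_memory_known (x : nat -> nat) :
  start M t != 0 -> start M t = (x t).+1 -> new_memory h M t x = start M.
Proof.
move=> Mt tx; have l0 : left_gap M h t = 0.
  apply/eqP; rewrite -leqn0 leqNgt; apply/negP => /left_gap_before.
  by rewrite subn0 => M0; rewrite M0 in Mt.
have r0 : right_gap M h t = 0.
  apply/eqP; rewrite -leqn0 leqNgt; apply/negP => /right_gap_before.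
  by rewrite addn0 => M0; rewrite M0 in Mt.
have loE : low M h t = t by rewrite /low l0 subn0; case: ifP.
have hiE : high M h t = t by rewrite /high r0 addn0; case: ifP.
apply: memP => a; rewrite storeE loE hiE //; case: ifP => // /andP[ta at_].
by rewrite (_ : a = t) //; lia.
Qed.

End Gaps.

(** Unknown stretches between two known times are longer than [2 h], so that both
    halves of a bridge mix; bridges only occur at times at least [6 h], since
    there is no unknown time to the left of a known one before [8 h]. *)
Record valid (n h T : nat) (M : memory) : Prop := Valid {
  valid0 : M 0 <= 1;
  valid_value : forall a, M a <= n;
  valid_time : forall a, T < a -> M a = 0;
  valid_gap : forall a b, a < b -> start M a != 0 -> start M b != 0 ->
    (forall c, a < c < b -> start M c = 0) -> b = a.+1 \/ a + 2 * h <= b;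
  valid_start : forall c b, 0 < c < b -> start M b != 0 -> start M c = 0 ->
    8 * h <= b }.

Lemma valid_mem0 n h T : valid n h T mem0.
Proof.
have s0 a : start mem0 a != 0 -> a = 0.
  by rewrite startE mem0E; case: (a =P 0).
split=> [|a|a _|a b ab _ /s0 b0|c b /andP[_ cb] /s0 b0]; rewrite ?mem0E //.
  by rewrite b0 in ab.
by rewrite b0 in cb.
Qed.

Lemma start_idem M : start (start M) = start M.
Proof. by apply: memP => a; rewrite !startE; case: eqP. Qed.

Lemma valid_start_mem n h T M : 0 < n -> valid n h T M -> valid n h T (start M).
Proof.
move=> n0 [v0 v1 v2 v3 v4]; split=> [|a|a Ta|a b|c b]; rewrite ?start_idem //.
- by rewrite startE eqxx.
- by rewrite startE; case: eqP.
- by rewrite startE; case: eqP Ta => [->|_ /v2].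
- exact: v3.
- exact: v4.
Qed.

Section Extension.
Variables (n h T : nat) (M : memory) (t : nat).
Hypotheses (n_gt0 : 0 < n) (h_gt0 : 0 < h) (M_valid : valid n h T M) (t_T : t <= T).

Lemma high_T : high M h t <= T.
Proof.
rewrite /high; case: ifP => // nr; rewrite leqNgt; apply/negP => Th.
move: nr; rewrite /near_right startE (valid_time M_valid Th).
by case: (t + right_gap M h t =P 0) => // E; rewrite E in Th.
Qed.

(** Next to a known end of the stored interval, the unknown stretch is an old one. A new stretch
    only arises at an end without known vertex, and there the failed search makes it longer than
    [2 h]. *)
Lemma valid_extension (p : memory) :
  (forall a, low M h t <= a <= high M h t -> 0 < p a <= n) ->
  (forall a, ~~ (low M h t <= a <= high M h t) -> p a = start M a) ->
  p 0 = 1 -> valid n h T p.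
Proof.
move=> pin pout p0; have [v0 v1 v2 v3 v4] := M_valid.
have [lt ht] := (low_le M h t, high_ge M h t).
have sp : start p = p by apply: memP => a; rewrite startE; case: eqP => [->|].
have known a : p a != 0 -> start M a != 0 \/ low M h t <= a <= high M h t.
  by case: (boolP (low M h t <= a <= high M h t)); [right | move/pout => ->; left].
have unknown a : p a = 0 -> start M a = 0 /\ ~~ (low M h t <= a <= high M h t).
  move=> pa; case: (boolP (low M h t <= a <= high M h t)) => [/pin|lh].
    by rewrite pa.
  by rewrite -(pout _ lh).
split=> [|a|a Ta|a b ab|c b /andP[c0 cb]]; rewrite ?p0 ?sp //.
- case: (boolP (low M h t <= a <= high M h t)) => [/pin/andP[]//|/pout ->].
  by rewrite startE; case: eqP.
- rewrite pout ?startE ?v2 //; first by case: eqP Ta => // ->.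
  by have := high_T; lia.
- move=> pa pb btw.
  have out c : a < c < b -> ~~ (low M h t <= c <= high M h t).
    by move=> /btw/unknown[].
  have Mbtw c : a < c < b -> start M c = 0 by move=> /btw/unknown[].
  case/known: (pa) => [Ma|alh].
    case/known: (pb) => [Mb|blh]; first exact: v3.
    case: (ltnP a (low M h t)) => al; last first.
      left; apply/eqP; apply/negPn/negP => bS.
      by have := out a.+1; lia.
    have bE : b = low M h t.
      by apply/eqP/negPn/negP => bl; have := out (low M h t); lia.
    rewrite bE in ab Mbtw *; move: ab Mbtw; rewrite /low.
    case: ifP => [nl ab Mbtw|/negbT nl ab Mbtw]; first exact: v3.
    have [th _] := far_left nl (leq0n _).
    right; rewrite leqNgt; apply/negP => at_.
    have tah : t - a <= 8 * h by lia.
    have := far_left nl tah; rewrite (subKn (ltnW ab)) => -[_ Ma0].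
    by rewrite Ma0 in Ma.
  case: (ltnP (high M h t) b) => bh; last first.
    left; apply/eqP; apply/negPn/negP => bS.
    by have := out a.+1; lia.
  have aE : a = high M h t.
    by apply/eqP/negPn/negP => bl; have := out (high M h t); lia.
  have Mb : start M b != 0 by move: pb; rewrite pout //; lia.
  rewrite aE in ab Mbtw *; move: ab Mbtw; rewrite /high.
  case: ifP => [nr ab Mbtw|/negbT nr ab Mbtw]; first exact: v3.
  right; rewrite leqNgt; apply/negP => at_.
  have bth : b - t <= 2 * h by lia.
  by have := far_right nr bth; rewrite (subnKC (ltnW ab)) => Mb0; rewrite Mb0 in Mb.
- move=> pb pc; have [Mc clh] := unknown _ pc.
  case/known: (pb) => [Mb|blh]; first by apply: (v4 c); rewrite ?c0.
  have cl : c < low M h t by lia.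
  apply: (@leq_trans (low M h t)); last by case/andP: blh.
  move: cl; rewrite /low; case: ifP => [nl cl|/negbT nl _].
    by apply: (v4 c); rewrite ?c0.
  by have [] := far_left nl (leq0n _); lia.
Qed.

(** The known right end has the unknown time [t] before it, so it is at least [8 h] by
    [valid_start], and it is at most [2 h] after [t]. *)
Lemma bridge_gap : start M t = 0 -> near_left M h t -> near_right M h t ->
  2 * h <= left_gap M h t + right_gap M h t /\ 6 * h <= t.
Proof.
move=> Mt nl nr; have [v0 v1 v2 v3 v4] := M_valid.
have lg0 : 0 < left_gap M h t.
  rewrite lt0n; apply/eqP => E; move: nl; rewrite /near_left E subn0 Mt.
  by [].
have rg0 : 0 < right_gap M h t.
  rewrite lt0n; apply/eqP => E; move: nr; rewrite /near_right E addn0 Mt.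
  by [].
have lgt := left_gap_t M h t; have rgh := right_gap_le M h t.
have t0 : 0 < t by lia.
split; last first.
  have := v4 t (t + right_gap M h t); rewrite t0 -[X in X < _]addn0 ltn_add2l rg0.
  by move=> /(_ isT nr Mt); lia.
case: (v3 _ _ _ nl nr) => [|c cc||]; try lia.
have := @inside_gap M h t c; rewrite /low /high nl nr; exact.
Qed.

End Extension.

End KnownTimes.

(** * The random walk conditioned on known times *)

Section Conditioning.
Variables (R : realType) (n d : nat) (e : rel 'I_n).
Hypotheses (d_gt0 : (0 < d)%N) (e_sym : symmetric e) (e_reg : regular e d).

Let W := walk_mx R e d.
Let Wp := walk_pow R d e.

Implicit Types m : memory.

Definition allows (m : memory) (i : nat) (v : 'I_n) : bool :=
  (m i == 0%N) || (m i == v.+1).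

Fixpoint agrees (m : memory) (i : nat) (q : seq 'I_n) : bool :=
  if q is v :: q' then allows m i v && agrees m i.+1 q' else true.

(** [future m i k v] is the probability that the walk of [k] steps from the vertex
    [v] at time [i] agrees with [m]; [later] ignores the constraint at the time
    [i] itself. [past m v0 i v] is the probability that the walk from [v0] at
    time 0 agrees with [m] before time [i] and is in [v] at time [i]. *)
Fixpoint future (m : memory) (i k : nat) (v : 'I_n) : R :=
  (allows m i v)%:R *
  (if k is k'.+1 then \sum_z W v z * future m i.+1 k' z else 1).

Definition later (m : memory) (i k : nat) (v : 'I_n) : R :=
  if k is k'.+1 then \sum_z W v z * future m i.+1 k' z else 1.

Fixpoint past (m : memory) (v0 : 'I_n) (i : nat) (v : 'I_n) : R :=
  if i is i'.+1 then \sum_z past m v0 i' z * (allows m i' z)%:R * W z v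
  else (v == v0)%:R.

Lemma futureE m i k v : future m i k v = (allows m i v)%:R * later m i k v.
Proof. by case: k. Qed.

Lemma allows_free m i v : m i = 0%N -> allows m i v.
Proof. by rewrite /allows => ->. Qed.

Lemma Ew_agrees m i k v :
  Ew d e k v (fun p => (agrees m i (v :: p))%:R) = future m i k v.
Proof.
elim: k i v => [|k IH] i v /=; first by rewrite andbT mulr1.
rewrite mulr_sumr; apply: eq_bigr => z _; rewrite -IH mulrCA; congr (_ * _).
rewrite mulrC -Ew_scale; apply: eq_Ew => p _.
by rewrite /= mulrC -mulnb natrM.
Qed.

Lemma future_ge0 m i k v : 0 <= future m i k v.
Proof.
elim: k i v => [|k IH] i v /=; first by rewrite mulr1 ler0n.
by rewrite mulr_ge0 // sumr_ge0 // => z _; rewrite mulr_ge0 // walk_mx_ge0.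
Qed.

Lemma later_ge0 m i k v : 0 <= later m i k v.
Proof.
case: k => //= k; rewrite sumr_ge0 // => z _.
by rewrite mulr_ge0 ?walk_mx_ge0 ?future_ge0.
Qed.

Lemma past_ge0 m v0 i v : 0 <= past m v0 i v.
Proof.
elim: i v => [|i IH] v /=; first by rewrite ler0n.
by rewrite sumr_ge0 // => z _; rewrite !mulr_ge0 ?walk_mx_ge0.
Qed.

(** The Markov property at time [i]. The constraint at [i] belongs to [future], as [past] stops just
    before it. *)
Lemma cut_at m v0 T i : (i <= T)%N ->
  future m 0 T v0 = \sum_v past m v0 i v * future m i (T - i) v.
Proof.
elim: i => [|i IH] iT.
  rewrite subn0 (bigD1 v0) //= eqxx mul1r big1 ?addr0 // => v vv0.
  by rewrite (negbTE vv0) mul0r.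
rewrite IH ?(ltnW iT) //= (_ : T - i = (T - i.+1).+1)%N; last by lia.
under [RHS]eq_bigr do rewrite mulr_suml.
rewrite exchange_big /=; apply: eq_bigr => v _.
rewrite mulrA mulr_sumr; apply: eq_bigr => z _; ring.
Qed.

Lemma sum_walk_pow0 (g : 'I_n -> R) v : \sum_z Wp 0 v z * g z = g v.
Proof.
rewrite (bigD1 v) //= mxE eqxx mul1r big1 ?addr0 // => z zv.
by rewrite mxE eq_sym (negbTE zv) mul0r.
Qed.

Lemma walk_powSr k : Wp k.+1 = Wp k *m W.
Proof. by rewrite /Wp -addn1 walk_pow_add /walk_pow /= mulmx1. Qed.

(** Free steps only contribute powers of [W]. For [l = 0] the constraint at [i] appears twice on the
    right, which is harmless for a factor 0 or 1. *)
Lemma future_free m i k l v : (l <= k)%N ->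
  (forall a, i < a < i + l -> m a = 0)%N ->
  future m i k v =
    (allows m i v)%:R * \sum_z Wp l v z * future m (i + l) (k - l) z.
Proof.
elim: l i k v => [|l IH] i k v lk free.
  by rewrite addn0 subn0 sum_walk_pow0 futureE mulrA -natrM mulnb andbb.
case: k lk => // k lk; rewrite /= subSS addnS -addSn; congr (_ * _).
under [RHS]eq_bigr do rewrite /Wp walk_powS mulr_suml.
rewrite exchange_big /=; apply: eq_bigr => y _.
under eq_bigr do rewrite -mulrA.
rewrite -mulr_sumr; congr (_ * _); rewrite IH //; last first.
  by move=> a al; apply: free; lia.
case: (posnP l) => [l0|l_gt0]; last by rewrite allows_free ?mul1r // free; lia.
rewrite l0 addn0 subn0 sum_walk_pow0.
by rewrite futureE mulrA -natrM mulnb andbb.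
Qed.

Lemma past_free m v0 i l v :
  (forall a, i <= a < i + l -> m a = 0)%N ->
  past m v0 (i + l) v = \sum_z past m v0 i z * Wp l z v.
Proof.
elim: l v => [|l IH] v free.
  rewrite addn0 (bigD1 v) //= mxE eqxx mulr1 big1 ?addr0 // => z zv.
  by rewrite mxE (negbTE zv) mulr0.
rewrite addnS /=.
under eq_bigr => y _.
  rewrite IH; last by move=> a al; apply: free; lia.
  rewrite allows_free ?mulr1; last by apply: free; lia.
  rewrite mulr_suml; over.
rewrite exchange_big /=; apply: eq_bigr => z _.
under eq_bigr do rewrite -mulrA.
rewrite -mulr_sumr; congr (_ * _).
by rewrite -[_ *m _]/(Wp l.+1) walk_powSr mxE.
Qed.

Lemma later_all_free m i k v : (forall a, i < a <= i + k -> m a = 0)%N ->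
  later m i k v = 1.
Proof.
elim: k i v => // k IH i v free /=.
rewrite -[RHS](walk_mx_row R d_gt0 e_reg v); apply: eq_bigr => z _.
rewrite futureE allows_free ?mul1r ?IH ?mulr1 //; last by apply: free; lia.
by move=> a al; apply: free; lia.
Qed.

Lemma later_eq m m' i k v : (forall a, i < a -> m a = m' a)%N ->
  later m i k v = later m' i k v.
Proof.
elim: k i v => // k IH i v mm /=; apply: eq_bigr => z _.
rewrite !futureE /allows mm // IH // => a ia; apply: mm; lia.
Qed.

Lemma past_eq m m' v0 i v : (forall a, a < i -> m a = m' a)%N ->
  past m v0 i v = past m' v0 i v.
Proof.
elim: i v => // i IH v mm /=; apply: eq_bigr => z _.
by rewrite /allows mm // IH // => a ai; apply: mm; lia.
Qed.

Definition segment (x : nat -> 'I_n) a l : seq 'I_n := [seq x i | i <- iota a l].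

Lemma future_path m (x : nat -> 'I_n) lo l k v : (l <= k)%N ->
  (forall a, lo <= a <= lo + l -> m a = (x a).+1)%N ->
  future m lo k v = (v == x lo)%:R * (pathw R d e (x lo) (segment x lo.+1 l)
    * later m (lo + l) (k - l) (x (lo + l)%N)).
Proof.
elim: l lo k v => [|l IH] lo k v lk mx.
  rewrite addn0 subn0 mul1r futureE /allows mx ?leqnn ?addn0 //=.
  by rewrite eqSS val_eqE eq_sym; case: eqP => [->|]; rewrite ?mul0r.
case: k lk => // k lk; rewrite subSS addnS -addSn /= /allows mx; last by lia.
rewrite /= eqSS val_eqE [x lo == v]eq_sym.
case: (v =P x lo) => [->|_]; last by rewrite !mul0r.
rewrite !mul1r.
under eq_bigr => z _.
  rewrite IH //; last by move=> a al; apply: mx; lia.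
  over.
rewrite (bigD1 (x lo.+1)) //= eqxx mul1r big1 ?addr0 ?mulrA // => z zx.
by rewrite (negbTE zx) mul0r mulr0.
Qed.

Variables (delta : R) (h : nat).
Hypotheses (delta_ge0 : 0 <= delta) (delta_le : delta <= 2^-1).
Hypothesis mixing : forall l u, (h <= l)%N -> nearly_uniform d e delta l u.

(** Approximate independence in multiplicative form: agreement with constraints at distance at least
    [h] hardly depends on the present vertex. *)
Definition nearly_constant (g : 'I_n -> R) : Prop :=
  exists2 c, 0 <= c & forall v, (1 - delta) * c <= g v <= (1 + delta) * c.

Lemma nearly_constant_avg (l : nat) (f : 'I_n -> R) : (h <= l)%N ->
  (forall z, 0 <= f z) -> nearly_constant (fun v => \sum_z Wp l v z * f z).
Proof.
move=> hl f0; have [n0|n_gt0] := posnP n.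
  exists 0 => // v; exfalso; have := leq_ltn_trans (leq0n v) (ltn_ord v).
  by rewrite n0.
have nR : 0 < n%:R :> R by rewrite ltr0n.
exists (n%:R^-1 * \sum_z f z); first by rewrite mulr_ge0 ?sumr_ge0 ?invr_ge0.
move=> v; rewrite !mulrA !mulr_sumr; apply/andP; split; apply: ler_sum => z _;
  apply: ler_wpM2r => //; have /andP[lo hi] := mixing v hl z.
  by rewrite ler_pdivrMr // mulrC.
by rewrite ler_pdivlMr // mulrC.
Qed.

Lemma later_nearly_constant m t k :
  (forall a, t < a <= t + h -> m a = 0)%N -> nearly_constant (later m t k).
Proof.
(* With fewer than [h] steps left there is no constraint at all; otherwise [h] free steps mix. *)
move=> free; have [kh|hk] := ltnP k h.
  exists 1 => // v; rewrite !mulr1 later_all_free ?lerBlDr ?lerDl ?delta_ge0 //.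
  by move=> a ak; apply: free; lia.
have [h0|h_gt0] := posnP h.
  have /(nearly_constant_avg (leqnn h)) : forall z, 0 <= later m t k z.
    by move=> z; apply: later_ge0.
  rewrite h0 => -[c c0 H]; exists c => // v; have := H v.
  by rewrite sum_walk_pow0.
(* Without the constraint at [t], [later] and [future] coincide and [future_free] applies. *)
pose m' := upd m t 0.
have lE v : later m t k v = \sum_z Wp h v z * future m' (t + h) (k - h) z.
  rewrite (@later_eq m m'); last first.
    by move=> a ta; rewrite updE; case: eqP => // at_; rewrite at_ ltnn in ta.
  have := @future_free m' t k h v hk; rewrite futureE allows_free ?mul1r.
    by apply=> a ah; rewrite updE ifF; [apply: free | apply/negbTE]; lia.
  by rewrite updE eqxx.
have [c c0 H] := nearly_constant_avg (leqnn h)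
  (fun z => future_ge0 m' (t + h) (k - h) z).
by exists c => // v; rewrite lE.
Qed.

(** By symmetry of the powers of [W], averaging over the vertex at time [t - h] is the same as
    walking [h] steps from [v]. *)
Lemma past_nearly_constant m v0 t : (h <= t)%N ->
  (forall a, t - h <= a < t -> m a = 0)%N -> nearly_constant (past m v0 t).
Proof.
move=> ht free; have := nearly_constant_avg (leqnn h) (past_ge0 m v0 (t - h)).
case=> c c0 H; exists c => // v; have := H v.
rewrite -[in past _ _ t](subnK ht) past_free; last first.
  by move=> a; rewrite subnK //; apply: free.
have -> // : \sum_z past m v0 (t - h) z * Wp h z v =
    \sum_z Wp h v z * past m v0 (t - h) z.
by apply: eq_bigr => z _; rewrite mulrC /Wp walk_pow_sym.
Qed.

(** * Conditional probability of a stored segment *)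

Section Query.
Variables (m : memory) (v0 : 'I_n) (x : nat -> 'I_n) (T lo hi : nat).
Hypotheses (lo_hi : (lo <= hi)%N) (hi_T : (hi <= T)%N).
Hypothesis free : forall a, (lo < a < hi)%N -> m a = 0%N.
Hypotheses (x_lo : allows m lo (x lo)) (x_hi : allows m hi (x hi)).

Let m' := store m lo hi (fun a => val (x a)).
Let P := past m v0 lo (x lo).
Let F := later m hi (T - hi) (x hi).

(** The stored values fix the walk on the whole interval, so by the Markov property the parts before
    and after it factor out, and they only see the old constraints. *)
Lemma future_store : future m' 0 T v0 =
  P * (pathw R d e (x lo) (segment x lo.+1 (hi - lo)) * F).
Proof.
have lo_T := leq_trans lo_hi hi_T.
have lh1 : (lo <= hi.+1)%N by apply: leqW.
rewrite (cut_at m' v0 lo_T).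
under eq_bigr => v _.
  rewrite (@future_path m' x lo (hi - lo)) ?leq_sub2r //; last first.
    by move=> a; rewrite subnKC // storeE // => ->.
  over.
rewrite (bigD1 (x lo)) //= eqxx mul1r big1 ?addr0; last first.
  by move=> v vx; rewrite (negbTE vx) mul0r mulr0.
rewrite subnKC // (_ : T - lo - (hi - lo) = T - hi)%N; last by lia.
congr (_ * (_ * _)).
  by apply: past_eq => a al; rewrite storeE // ifF //; apply/negbTE; lia.
by apply: later_eq => a al; rewrite storeE // ifF //; apply/negbTE; lia.
Qed.

Lemma future_split : future m 0 T v0 =
  \sum_w (past m v0 lo w * (allows m lo w)%:R) *
    \sum_z Wp (hi - lo) w z * future m hi (T - hi) z.
Proof.
have lo_T := leq_trans lo_hi hi_T.
rewrite (cut_at m v0 lo_T); apply: eq_bigr => w _.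
rewrite (@future_free m lo (T - lo) (hi - lo) w) ?leq_sub2r ?subnKC //.
by rewrite mulrA (_ : T - lo - (hi - lo) = T - hi)%N //; lia.
Qed.

Lemma sum_known_left (g : 'I_n -> R) : m lo <> 0%N ->
  \sum_w (past m v0 lo w * (allows m lo w)%:R) * g w = P * g (x lo).
Proof.
move=> mlo; rewrite (bigD1 (x lo)) //= x_lo mulr1 big1 ?addr0 // => w wx.
have mE : m lo = (x lo).+1.
  by move: x_lo; rewrite /allows => /orP[/eqP //|/eqP].
rewrite /allows mE /= eqSS val_eqE eq_sym (negbTE wx) mulr0 mul0r //.
Qed.

Lemma sum_known_right (g : 'I_n -> R) : m hi <> 0%N ->
  \sum_z g z * future m hi (T - hi) z = g (x hi) * F.
Proof.
move=> mhi; rewrite (bigD1 (x hi)) //= futureE x_hi mul1r big1 ?addr0 // => w wx.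
have mE : m hi = (x hi).+1.
  by move: x_hi; rewrite /allows => /orP[/eqP //|/eqP].
by rewrite futureE /allows mE /= eqSS val_eqE eq_sym (negbTE wx) mul0r mulr0.
Qed.

(** Compares two values, or averages, of a nearly constant function: they differ by a factor of at
    most [(1 + delta) / (1 - delta)], for which [(1 - delta) ^+ 2] compensates. *)
Lemma ratio_bound (a b : R) : 0 <= b -> (1 - delta) * a <= b ->
  forall y, 0 <= y <= (1 + delta) * a -> (1 - delta) ^+ 2 * y <= b.
Proof.
move=> b0 ab y /andP[y0 ya]; apply: le_trans ab.
have d0 : 0 <= 1 - delta by move: delta_le; lra.
apply: (@le_trans _ _ ((1 - delta) ^+ 2 * ((1 + delta) * a))).
  by rewrite ler_wpM2l // exprn_ge0.
have a0 : 0 <= a.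
  rewrite -(pmulr_rge0 _ (_ : 0 < 1 + delta)); first exact: le_trans ya.
  by rewrite ltr_wpDr.
by rewrite mulrA ler_wpM2r // mulrC square_algebra // -subr_ge0.
Qed.

(** The conditional probability of a segment [x lo, ..., x hi] given [m] is at
    most about [rho] times its walk probability, [rho] being [n], [1] or [1 / n]
    according to the number of known ends. *)
Lemma condition_both : m lo <> 0%N -> m hi <> 0%N -> (h <= hi - lo)%N ->
  (1 - delta) ^+ 4 * (P * F) <= n%:R * future m 0 T v0.
Proof.
move=> mlo mhi hl; rewrite future_split sum_known_left // sum_known_right //.
have /andP[H _] := mixing (x lo) hl (x hi).
have P0 : 0 <= P by exact: past_ge0.
have F0 : 0 <= F by exact: later_ge0.
have d0 : 0 <= 1 - delta by move: delta_le; lra.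
rewrite (_ : n%:R * _ = n%:R * Wp (hi - lo) (x lo) (x hi) * (P * F)); last by ring.
rewrite ler_wpM2r ?mulr_ge0 //; apply: le_trans H.
by rewrite exprS ler_piMr // exprn_ile1 // lerBlDr lerDl.
Qed.

Lemma condition_left : m lo <> 0%N -> m hi = 0%N ->
  (forall a, hi < a <= hi + h -> m a = 0)%N ->
  (1 - delta) ^+ 4 * (P * F) <= future m 0 T v0.
Proof.
move=> mlo mhi far; rewrite future_split sum_known_left //.
have [c c0 H] := later_nearly_constant (T - hi) far.
have P0 : 0 <= P by exact: past_ge0.
have d0 : 0 <= 1 - delta by move: delta_le; lra.
rewrite mulrCA ler_wpM2l //.
apply: (@le_trans _ _ ((1 - delta) ^+ 2 * F)).
  rewrite ler_wpM2r ?later_ge0 // -[4%N]/(2 + 2)%N exprD ler_piMr ?exprn_ge0 //.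
  by rewrite exprn_ile1 // lerBlDr lerDl.
apply: (ratio_bound (a := c)).
- by apply: sumr_ge0 => z _; rewrite mulr_ge0 ?walk_pow_ge0 ?future_ge0.
- apply: (@le_trans _ _ (\sum_z Wp (hi - lo) (x lo) z * ((1 - delta) * c))).
    by rewrite -mulr_suml walk_pow_row // mul1r.
  apply: ler_sum => z _; rewrite ler_wpM2l ?walk_pow_ge0 // futureE.
  by rewrite allows_free ?mul1r //; have /andP[] := H z.
- by rewrite later_ge0 /=; have /andP[] := H (x hi).
Qed.

Lemma condition_right : m hi <> 0%N -> m lo = 0%N -> (h <= lo)%N ->
  (forall a, lo - h <= a < lo -> m a = 0)%N ->
  (1 - delta) ^+ 4 * (P * F) <= future m 0 T v0.
Proof.
move=> mhi mlo hlo far; rewrite future_split.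
under eq_bigr => w _.
  rewrite sum_known_right // allows_free // mulr1 mulrA; over.
rewrite -mulr_suml mulrA ler_wpM2r ?later_ge0 //.
have [c c0 H] := past_nearly_constant v0 hlo far.
have P0 : 0 <= P by exact: past_ge0.
have d0 : 0 <= 1 - delta by move: delta_le; lra.
apply: (@le_trans _ _ ((1 - delta) ^+ 2 * P)).
  rewrite ler_wpM2r // -[4%N]/(2 + 2)%N exprD ler_piMr ?exprn_ge0 //.
  by rewrite exprn_ile1 // lerBlDr lerDl.
apply: (ratio_bound (a := c)).
- by apply: sumr_ge0 => z _; rewrite mulr_ge0 ?walk_pow_ge0 ?past_ge0.
- apply: (@le_trans _ _ (\sum_z ((1 - delta) * c) * Wp (hi - lo) (x hi) z)).
    by rewrite -mulr_sumr walk_pow_row // mulr1.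
  apply: ler_sum => z _; rewrite /Wp walk_pow_sym // ler_wpM2r ?walk_pow_ge0 //.
  by have /andP[] := H z.
- by rewrite past_ge0 /=; have /andP[] := H (x lo).
Qed.

(** With free surroundings on both sides, the sum over the vertex at time [lo] has [n] nearly equal
    terms. Past and later part cost [(1 - delta) ^+ 2] each, which sets the common exponent 4. *)
Lemma condition_none : lo = hi -> m lo = 0%N -> (h <= lo)%N ->
  (forall a, lo - h <= a < lo -> m a = 0)%N ->
  (forall a, hi < a <= hi + h -> m a = 0)%N ->
  (1 - delta) ^+ 4 * (P * F) <= n%:R^-1 * future m 0 T v0.
Proof.
move=> lohi mlo hlo farl farr; rewrite future_split -lohi subnn.
have n_gt0 : (0 < n)%N by case: (n) v0 => [[]|].
have nR : 0 < n%:R :> R by rewrite ltr0n.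
under eq_bigr => w _.
  rewrite sum_walk_pow0 futureE allows_free // mulr1 mul1r; over.
have [c1 c10 H1] := past_nearly_constant v0 hlo farl.
have [c2 c20 H2] := later_nearly_constant (T - hi) farr.
have P0 : 0 <= P by exact: past_ge0.
have F0 : 0 <= F by exact: later_ge0.
have d0 : 0 <= 1 - delta by move: delta_le; lra.
rewrite [leRHS]mulrC ler_pdivlMr //.
apply: (@le_trans _ _ (\sum_(w < n) (1 - delta) ^+ 4 * (P * F))).
  by rewrite sumr_const card_ord mulr_natr.
apply: ler_sum => w _; rewrite -[4%N]/(2 + 2)%N exprD mulrACA.
apply: ler_pM; rewrite ?mulr_ge0 ?exprn_ge0 //.
  apply: (ratio_bound (a := c1)); rewrite ?past_ge0 //; first by have /andP[] := H1 w.
  by have /andP[_ ->] := H1 (x lo).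
rewrite lohi; apply: (ratio_bound (a := c2)); rewrite ?later_ge0 //.
  by have /andP[] := H2 w.
by have /andP[_ ->] := H2 (x hi).
Qed.

End Query.

End Conditioning.

(** * The program *)

Definition single_cmd (vertex len addr : expr) (o : binop) : cmd :=
  Seq (SetReg 7 vertex)
  (Seq (SetReg 8 len)
  (Seq (SetReg 9 (Lit 0))
  (Seq walk_cmd
  (Seq (SetReg 8 (Bin Add len (Lit 1)))
  (Seq (SetReg 9 (Lit 0))
  (Seq (SetReg 10 addr)
       (copy_cmd o))))))).

Definition uniform_cmd : cmd :=
  Seq (RandVertex 7) (SetPMem (Inp 4) (Bin Add (Reg 7) (Lit 1))).

Definition sample_cmd : cmd :=
  If (PMem (Inp 4)) Skip
    (If (PMem left_addr)
      (If (PMem right_addr) bridge_cmd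
                            (single_cmd left_vertex (Reg 5) left_addr Add))
      (If (PMem right_addr) (single_cmd right_vertex (Reg 6) right_addr Defs.Sub)
                            uniform_cmd)).

(** Writing 1 to cell 0 declares the start vertex, number 0, as known; this is the passage from [M]
    to [start M]. *)
Definition main_cmd : cmd :=
  Seq (SetReg 1 (Bin Mul (Bin Mul (Inp 0) (Inp 1)) (Inp 2)))
  (Seq bitlen_cmd
  (Seq (SetReg 3 (Bin Mul (Lit 9) (Bin Mul (Reg 2) (Inp 3))))
  (Seq sqrt_cmd
  (Seq (SetPMem (Lit 0) (Lit 1))
  (Seq (search_cmd 5 Defs.Sub 8)
  (Seq (search_cmd 6 Add 2)
  (Seq sample_cmd
       (SetReg 0 (Bin Defs.Sub (PMem (Inp 4)) (Lit 1)))))))))).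

(** For [eps >= 2], that is [nceil (2 / eps) <= 1], any answer will do. *)
Definition access_cmd : cmd :=
  If (Bin Leq (Inp 2) (Lit 1)) Skip main_cmd.

Section Paths.
Variables (R : realType) (n d : nat) (e : rel 'I_n).
Hypothesis e_sym : symmetric e.

Definition backwards (x : nat -> 'I_n) (a l : nat) : seq 'I_n :=
  [seq x (a - i)%N | i <- iota 1 l].

Lemma size_backwards x a l : size (backwards x a l) = l.
Proof. by rewrite size_map size_iota. Qed.

Lemma last_backwards x a l : last (x a) (backwards x a l) = x (a - l)%N.
Proof.
case: l => [|l]; first by rewrite /= subn0.
by rewrite /backwards -(addn1 l) iotaD map_cat last_cat /= add1n addn1.
Qed.

Lemma last_segment (x : nat -> 'I_n) a l : last (x a) (segment x a.+1 l) = x (a + l)%N.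
Proof.
case: l => [|l]; first by rewrite /= addn0.
by rewrite /segment -(addn1 l) iotaD map_cat last_cat /= addSnnS addn1.
Qed.

Lemma pathw_backwards (x : nat -> 'I_n) a l : (l <= a)%N ->
  pathw R d e (x a) (backwards x a l) =
  pathw R d e (x (a - l)%N) (segment x (a - l).+1 l).
Proof.
elim: l => [//|l IH] la; rewrite /backwards.
have -> : iota 1 l.+1 = iota 1 l ++ [:: l.+1].
  by rewrite -(addn1 l) iotaD add1n addn1.
rewrite map_cat pathw_cat -/(backwards x a l) (IH (ltnW la)) last_backwards /= mulr1 mulrC.
rewrite (_ : (a - l.+1).+1 = a - l)%N; last by lia.
by congr (_ * _); apply: walk_mx_sym.
Qed.

Lemma nth_backwards x0 (x : nat -> 'I_n) a l i : (i <= l)%N ->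
  nth x0 (x a :: backwards x a l) i = x (a - i)%N.
Proof.
case: i => [|i] il /=; first by rewrite subn0.
by rewrite (nth_map 0%N) ?size_iota // nth_iota // add1n.
Qed.

End Paths.

(** * Walks from one known end *)

Section Single.
Local Open Scope nat_scope.
Variables (R : realType) (n d : nat) (e : rel 'I_n).
Hypotheses (n_gt0 : 0 < n) (d_gt0 : 0 < d) (e_reg : regular e d).
Variables (w : nat) (inp : seq nat).
Variables (Inv Post : state -> Prop) (f : state -> R).
Variable X : nat.
Hypotheses (X_word : X < 2 ^ w) (n_X : n <= X).
Variables (PG WG : memory -> Prop).

Let good := good X 14 PG WG.
Hypothesis good_Inv : forall l p m, good l p m -> Inv (St l p m).

Let ok := ok e w inp Inv Post f.

Lemma ok_single vertex len addr o (u : 'I_n) ln dst lo hi N k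
    r0 r1 r2 r3 r4 r5 r6 cur i ptr r10 r11 r12 r13 p m (K : memory -> Prop) g :
  let l cur i ptr r10 :=
    [:: r0; r1; r2; r3; r4; r5; r6; cur; i; ptr; r10; r11; r12; r13] in
  (forall cur i ptr r10 m, let l' := l cur i ptr r10 in
    [/\ fits inp X l' p m vertex /\ evn inp l' p m vertex = val u,
        fits inp X l' p m len /\ evn inp l' p m len = ln &
        fits inp X l' p m addr /\ evn inp l' p m addr = dst]) ->
  ln < X -> hi < X ->
  (if o is Defs.Sub then lo + ln <= dst /\ dst <= hi
   else o = Add /\ lo <= dst /\ dst + ln <= hi) ->
  (forall m', confined mem0 ln n (iota 0 ln.+1) m' -> WG m') ->
  confined mem0 ln n (iota 0 ln.+1) m ->
  (forall p', K p' -> PG p') -> K p ->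
  (forall p' a v, K p' -> lo <= a <= hi -> v < n -> K (upd p' a v.+1)) ->
  good (l cur i ptr r10) p m ->
  (forall (q : seq 'I_n) cur i ptr r10 m,
     let p' := fill o p dst (map val (u :: q)) in
     size q = ln -> K p' -> good (l cur i ptr r10) p' m ->
     ok N (k, St (l cur i ptr r10) p' m) (g q)) ->
  ok (N + (16 * ln + 40)) (single_cmd vertex len addr o :: k,
    St (l cur i ptr r10) p m) (Ew d e ln u g).
Proof.
move=> l Hev lnX hiX oP WK mK KP Kp Kupd Gm H.
pose N2 := (N + (8 * ln.+1).+1).+4.+2.
pose N1 := (N2 + (8 * ln + 3)).+4.+3.
apply: (@ok_le _ _ _ _ _ _ _ _ N1); last by rewrite /N1 /N2; lia.
apply: (ok_seq good_Inv) => //.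
have [[f1 e1] _ _] := Hev cur i ptr r10 m.
apply: (ok_set X_word good_Inv) => //; rewrite e1 => G1.
apply: (ok_seq good_Inv) => //.
have [_ [f2 e2] _] := Hev (val u) i ptr r10 m.
apply: (ok_set X_word good_Inv) => //; rewrite [evn _ _ _ _ _]e2 => G2.
apply: (ok_seq good_Inv) => //.
apply: (ok_set X_word good_Inv) => //; rewrite [evn _ _ _ _ _]/= => G3.
apply: (ok_seq good_Inv) => //=.
refine (ok_walk n_gt0 d_gt0 e_reg X_word n_X good_Inv (N := N2)
  (J := confined mem0 ln n (iota 0 ln.+1)) _ _ WK mK _ _) => //.
- by rewrite add0n ltnW.
- move=> m' a v Cm' /andP[_ aln] vn; apply: confined_upd => //.
  by rewrite mem_iota /= add0n ltnS.
move=> q qs l' m' Cm' G4; move: G4; rewrite /l' add0n => G4.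
apply: (ok_seq good_Inv) => //.
have [_ [f3 e3] _] := Hev (val (last u q)) 0 ln r10 m'.
apply: (ok_set X_word good_Inv) => //.
  by split=> //=; [lia | move: e3 => /= ->; lia].
have sq : ln + 1 = size (map val (u :: q)) by rewrite /= size_map qs addn1.
have e3' : evn inp (l (val (last u q)) 0 ln r10) p m' (Bin Add len (Lit 1)) =
    size (map val (u :: q)) by rewrite -sq /=; move: e3 => /= ->.
rewrite [evn _ _ _ _ _]e3' => G5; apply: (ok_seq good_Inv) => //.
apply: (ok_set X_word good_Inv) => //; rewrite [evn _ _ _ _ _]/= => G6.
apply: (ok_seq good_Inv) => //.
have [_ _ [f4 e4]] := Hev (val (last u q)) (size (map val (u :: q))) 0 r10 m'.
apply: (ok_set X_word good_Inv) => //; rewrite [evn _ _ _ _ _]e4 => G7.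
rewrite (_ : ln.+1 = size (map val (u :: q))); last by rewrite -sq addn1.
refine (ok_copy n_gt0 d_gt0 X_word n_X good_Inv (o := o)
  (q := map val (u :: q)) (N := N) (lo := lo) (hi := hi) (K := K)
  _ _ _ _ _ _ _ _ _ _) => //.
- by rewrite -sq; lia.
- by rewrite -sq; case: (o) oP => // -[] // *; [split=> //|]; lia.
- by apply/allP => _ /mapP[y _ ->]; apply: ltn_ord.
- move=> j; rewrite -sq addn1 ltnS => jl.
  by rewrite fill_addE -sq leq0n /= add0n addn1 ltnS jl subn0.
by move=> ptr2 dst2 l2' p2 Kp2 G8; apply: H.
Qed.

End Single.

(** * A single query in a valid memory *)

Section Query.
Local Open Scope nat_scope.
Variables (R : realType) (n d : nat) (e : rel 'I_n).
Hypotheses (n_gt0 : 0 < n) (d_gt0 : 0 < d) (e_sym : symmetric e)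
  (e_reg : regular e d).
Variables (w B E Lam T t X s : nat) (M : memory).

Let inp := [:: n; B; E; Lam; t].
Let Y := n * B * E.
Let L := bitlen Y.
Let h := 9 * (L * Lam).
Let da := left_gap M h t.
Let db := right_gap M h t.
Let lo := low M h t.
Let hi := high M h t.
Let M1 := start M.
Let Wn := s + s.+1 * (10 * h).+1.
(** Bound for working addresses. A bridge uses [n + (s + 1) * (len + 1)] of them, where [s <= n]
    and, since [6 h <= t], [len <= 2 t]; so [h] does not enter and an address has O(log(nt))
    bits. *)
Let Aw := 3 * (n.+1 * t.+1).

Hypotheses (B_gt0 : 0 < B) (E_gt1 : 1 < E) (Lam_gt0 : 0 < Lam) (t_T : t <= T).
Hypothesis M_valid : valid n h T M.
Hypotheses (s_gt0 : 0 < s) (s_half : 2 * s.-1 <= n) (s_le : s <= n)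
  (n_le_sqr : n <= s * s) (s_min : forall i, i < s -> i * i < n).
Hypotheses (X_word : X < 2 ^ w) (Y_X : Y <= X) (h_X : 10 * h < X)
  (ss_X : s * s < X) (W_X : n + s.+1 * (10 * h).+1 <= X) (t_X : t + 2 * h < X)
  (tries_X : s * (24 * L) <= X) (X_ge : 24 <= X).

Variables (delta : R).
Hypotheses (delta_ge0 : (0 <= delta)%R) (delta_le : (delta <= 2^-1)%R).
Hypothesis tries_tail : ((3 / 4) ^+ (24 * L) <= delta)%R.
Hypothesis mixing : forall l u, h <= l -> nearly_uniform d e delta l u.

Variable x : nat -> 'I_n.
Hypothesis x_allowed : forall a, allows M1 a (x a).

(** The cells are those from [t - 8 h] to [t + 2 h] and cell 0. *)
Definition pmem_ok (p : memory) : Prop :=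
  exists2 F, size F <= 10 * h + 2 & confined M (2 * t) n F p.
Definition wmem_ok (m : memory) : Prop :=
  exists2 F, size F <= Wn & confined mem0 Aw n F m.

Definition bounded (st : state) : Prop :=
  Defs.space (pmem st) <=
    Defs.space M + (10 * h + 2) * (bitlen (2 * t) + bitlen n) /\
  Defs.space (regs st) + Defs.space (wmem st) <=
    14 * (bitlen 14 + bitlen X) + Wn * (bitlen Aw + bitlen n).

Definition settled (st : state) : Prop := valid n h T (pmem st).

(** The reward for the program logic: its expectation is the probability of producing exactly the
    answer and the memory that the simulator derives from [x]. *)
Definition hits (st : state) : R :=
  ((regs st 0 == val (x t)) &&
   (pmem st == new_memory h M t (fun a => val (x a))))%:R%R.

Lemma space_mem0 : Defs.space mem0 = 0.
Proof. by rewrite /Defs.space finsupp0 big_seq_fset0. Qed.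

Lemma good_bounded l p m :
  good X 14 pmem_ok wmem_ok l p m -> bounded (St l p m).
Proof.
move=> [sl al [F Fs Fp] [F' Fs' Fm]]; split=> /=.
  apply: leq_trans (space_confined Fp) _.
  by rewrite leq_add2l leq_mul2r Fs orbT.
apply: leq_add.
  have := @space_confined mem0 14 X (iota 0 14) (mem_of_seq l).
  rewrite space_mem0 add0n size_iota; apply; split=> a; rewrite mem_iota /=.
    by rewrite add0n -leqNgt mem_of_seqE mem0E => la; rewrite nth_default ?sl.
  rewrite add0n => al14; split; first exact: ltnW.
  by rewrite mem_of_seqE; move/(all_nthP 0): al; apply; rewrite sl.
apply: leq_trans (space_confined Fm) _.
by rewrite space_mem0 add0n leq_mul2r Fs' orbT.
Qed.

Let good := good X 14 pmem_ok wmem_ok.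
Let ok := ok e w inp bounded settled hits.

Lemma n_X : n <= X.
Proof. by apply: leq_trans W_X; apply: leq_addr. Qed.

Lemma h_gt0 : 0 < h.
Proof. by rewrite !muln_gt0 /= Lam_gt0. Qed.

Lemma wmem_ok0 : wmem_ok mem0.
Proof. by exists [::] => //; split. Qed.

Lemma confined_le M0 A A' V F m : A <= A' -> confined M0 A V F m ->
  confined M0 A' V F m.
Proof.
move=> AA [H1 H2]; split=> // a /H2[aA mV]; split=> //.
exact: leq_trans AA.
Qed.

Let F := 0 :: iota lo (hi.+1 - lo).

Let K := confined M (2 * t) n F.

Lemma hi_2t : M1 t = 0 -> hi <= 2 * t.
Proof.
move=> Mt; rewrite /hi /high; case: ifP => [nr|_]; last by lia.
have rgh := right_gap_le M h t; rewrite -/db in rgh *.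
case: (boolP (near_left M h t)) => nl.
  by have [_] := bridge_gap n_gt0 h_gt0 M_valid t_T Mt nl nr; lia.
by have [] := far_left nl (leq0n _); lia.
Qed.

Lemma K_upd : M1 t = 0 -> forall p' a v,
  K p' -> lo <= a <= hi -> v < n -> K (upd p' a v.+1).
Proof.
move=> Mt p' a v Kp' alh vn; apply: confined_upd => //.
rewrite in_cons mem_iota subnKC ?alh ?orbT //.
by have := low_high M h t; rewrite -/lo -/hi; lia.
Qed.

Lemma size_F : size F <= 10 * h + 2.
Proof.
rewrite /= size_iota /lo /hi /low /high.
have := left_gap_le M h t; have := right_gap_le M h t.
by do 2 case: ifP => _; lia.
Qed.

Lemma K_pmem_ok p : K p -> pmem_ok p.
Proof. by exists F => //; apply: size_F. Qed.

Lemma K_start : M1 t = 0 -> K M1.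
Proof.
move=> Mt; have t2 := hi_2t Mt; split=> a; rewrite in_cons startE.
  by case: eqP.
rewrite mem_iota subnKC; last by have := low_high M h t; rewrite -/lo -/hi; lia.
case: eqP => [->|_] /=; first by [].
move=> /andP[_ ah]; split; last exact: valid_value M_valid a.
by lia.
Qed.

Lemma start_pmem_ok : pmem_ok M1.
Proof.
exists [:: 0]; first by rewrite addn2.
split=> a; rewrite mem_seq1 startE; first by case: eqP.
by move=> /eqP ->; rewrite eqxx.
Qed.

Lemma valid_stored (p : memory) (y : nat -> 'I_n) :
  (lo = 0 -> val (y 0) = 0) ->
  (forall a, p a = if lo <= a <= hi then (y a).+1 else M1 a) -> valid n h T p.
Proof.
move=> y0 pE; apply: (valid_extension n_gt0 h_gt0 M_valid t_T).
- by move=> a alh; rewrite pE /lo /hi alh ltn_ord.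
- by move=> a /negbTE alh; rewrite pE /lo /hi alh.
- rewrite pE /M1 startE eqxx leqn0.
  by case: eqP => //= /y0 ->.
Qed.

Lemma low_t0 : lo = 0 -> near_left M h t.
Proof.
rewrite /lo /low; case: ifP => // /negbT nl t0.
by have [] := far_left nl (leq0n _); rewrite t0.
Qed.

Lemma high_le : lo <= hi.+1.
Proof. by apply: leqW; apply: low_high. Qed.

Let goal_memory := new_memory h M t (fun a => val (x a)).

Lemma goal_memoryE a :
  goal_memory a = if lo <= a <= hi then (x a).+1 else M1 a.
Proof. exact: (storeE _ _ _ high_le). Qed.

Lemma ok_finish l p m r : good l p m -> valid n h T p ->
  (r <= (p == goal_memory)%:R)%R ->
  ok 1 ([:: SetReg 0 (Bin Defs.Sub (PMem (Inp 4)) (Lit 1))], St l p m) r.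
Proof.
move=> Gl pv rp; have ptX : p t <= X.
  by apply: leq_trans n_X; apply: valid_value pv t.
apply: (ok_set X_word good_bounded) => //=; first by do ![split=> //]; lia.
move=> G1; refine (ok_end _ _ _ good_bounded G1 _ _) => //.
apply: le_trans rp _; rewrite /hits /= mem_of_seqE nth_set_nth /= subn1.
rewrite -/goal_memory; case: eqP => [->|_]; last by rewrite ler0n.
by rewrite goal_memoryE low_le high_ge /= eqxx.
Qed.

Let regs r0 r1 cur i ptr r10 j o tr :=
  [:: r0; r1; L; h; s; da; db; cur; i; ptr; r10; j; o; tr].

Let fin := [:: SetReg 0 (Bin Defs.Sub (PMem (Inp 4)) (Lit 1))].

Lemma M1_X a : M1 a <= X.
Proof.
apply: leq_trans n_X; exact: (valid_value (valid_start_mem n_gt0 M_valid)).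
Qed.

Lemma da_t : da <= t. Proof. exact: left_gap_t. Qed.

Lemma db_h : db <= 2 * h. Proof. exact: right_gap_le. Qed.

Lemma known_x a : M1 a != 0 -> M1 a = (x a).+1.
Proof. by have := x_allowed a; rewrite /allows => /orP[/eqP ->|/eqP]. Qed.

Lemma fits_ends r0 r1 cur i ptr r10 j o tr m :
  let l := regs r0 r1 cur i ptr r10 j o tr in
  [/\ fits inp X l M1 m left_addr, evn inp l M1 m left_addr = t - da,
      fits inp X l M1 m right_addr & evn inp l M1 m right_addr = t + db].
Proof.
have := da_t; have := db_h; move=> H1 H2 l /=.
by do ![split=> //]; lia.
Qed.

Lemma fits_vertices r0 r1 cur i ptr r10 j o tr m :
  let l := regs r0 r1 cur i ptr r10 j o tr in
  [/\ fits inp X l M1 m left_vertex, fits inp X l M1 m right_vertex,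
      near_left M h t -> evn inp l M1 m left_vertex = val (x (t - da)) &
      near_right M h t -> evn inp l M1 m right_vertex = val (x (t + db))].
Proof.
move=> l; have [f1 e1 f2 e2] := fits_ends r0 r1 cur i ptr r10 j o tr m.
have m1 := M1_X (t - da); have m2 := M1_X (t + db).
have X1 : 1 <= X by apply: leq_trans X_ge.
split=> [|||].
- by move: f1 e1 => /= f1 e1; do ![split=> //]; rewrite ?e1 //; lia.
- by move: f2 e2 => /= f2 e2; do ![split=> //]; rewrite ?e2 //; lia.
- by move=> /known_x e3; rewrite /= -/da -/M1 e3 subn1.
- by move=> /known_x e3; rewrite /= -/db -/M1 e3 subn1.
Qed.

Lemma confined_wmem_ok ln m : ln <= t -> ln <= 8 * h ->
  confined mem0 ln n (iota 0 ln.+1) m -> wmem_ok m.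
Proof.
move=> lt lh Cm; exists (iota 0 ln.+1).
  rewrite size_iota /Wn mulSn; apply: leq_trans (leq_addl _ _).
  by apply: leq_trans (leq_addr _ _); lia.
by apply: confined_le Cm; rewrite /Aw mulSn; lia.
Qed.

Lemma confined0 ln : confined mem0 ln n (iota 0 ln.+1) mem0.
Proof. by split=> // a; rewrite mem_iota mem0E add0n ltnS => /andP[]. Qed.

Definition single_steps := 128 * h + 40.

Lemma ok_forward r0 r1 cur i ptr r10 j o tr :
  M1 t = 0 -> near_left M h t -> ~~ near_right M h t ->
  good (regs r0 r1 cur i ptr r10 j o tr) M1 mem0 ->
  ok (1 + single_steps)
    (single_cmd left_vertex (Reg 5) left_addr Add :: fin,
     St (regs r0 r1 cur i ptr r10 j o tr) M1 mem0)
    (pathw R d e (x lo) (segment x lo.+1 (hi - lo))).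
Proof.
move=> Mt nl nr Gm.
have loE : lo = t - da by rewrite /lo /low nl.
have hiE : hi = t by rewrite /hi /high (negbTE nr).
have dat := da_t; have da8 : da <= 8 * h by exact: left_gap_le.
have lda : hi - lo = da by rewrite hiE loE subKn.
apply: (@ok_le _ _ _ _ _ _ _ _ (1 + (16 * da + 40))); last first.
  by rewrite /single_steps; lia.
have seg_size : size (segment x lo.+1 da) = da by rewrite size_map size_iota.
rewrite -[pathw _ _ _ _ _]mulr1 lda -(Ew_path d e (x lo) 1%R seg_size).
apply: (ok_single n_gt0 d_gt0 e_reg X_word n_X good_bounded (dst := lo)
  (lo := lo) (hi := hi) (K := K)) => //.
- move=> cur' i' ptr' r10' m' l'.
  have [f1 e1 _ _] := fits_ends r0 r1 cur' i' ptr' r10' j o tr m'.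
  have [f2 _ e2 _] := fits_vertices r0 r1 cur' i' ptr' r10' j o tr m'.
  by split; split=> //; rewrite ?loE ?e2 //=; lia.
- by lia.
- by rewrite hiE; lia.
- by rewrite loE hiE; split=> //; lia.
- by move=> m'; apply: confined_wmem_ok.
- exact: confined0.
- exact: K_pmem_ok.
- exact: K_start.
- exact: K_upd.
move=> q cur' i' ptr' r10' m' p' qs Kp' G1.
have p'E a : p' a = if lo <= a <= hi then (nth (x lo) (x lo :: q) (a - lo)).+1
                    else M1 a.
  rewrite /p' fill_addE size_map /= qs -lda addnS subnKC ?low_high // ltnS.
  by case: ifP => // /andP[la ah]; rewrite -map_cons (nth_map (x lo)) //= qs; lia.
apply: ok_finish => //.
  apply: (valid_stored (y := fun a => nth (x lo) (x lo :: q) (a - lo))) p'E.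
  move=> lo0; rewrite lo0 /=; have := known_x nl; rewrite -/da -loE lo0.
  by rewrite /M1 startE /= => -[<-].
case: eqP => [qE|_]; last by rewrite ler0n.
suff -> : p' = goal_memory by rewrite eqxx.
rewrite /p' qE /goal_memory /new_memory /store -/lo -/hi subSn ?low_high // lda /=.
by rewrite -map_comp.
Qed.

(** The walk starts at the later end; [pathw_backwards] identifies its weight with that of the
    segment read forwards. *)
Lemma ok_backward r0 r1 cur i ptr r10 j o tr :
  M1 t = 0 -> ~~ near_left M h t -> near_right M h t ->
  good (regs r0 r1 cur i ptr r10 j o tr) M1 mem0 ->
  ok (1 + single_steps)
    (single_cmd right_vertex (Reg 6) right_addr Defs.Sub :: fin,
     St (regs r0 r1 cur i ptr r10 j o tr) M1 mem0)
    (pathw R d e (x lo) (segment x lo.+1 (hi - lo))).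
Proof.
move=> Mt nl nr Gm.
have loE : lo = t by rewrite /lo /low (negbTE nl).
have hiE : hi = t + db by rewrite /hi /high nr.
have [th _] := far_left nl (leq0n _).
have db2 := db_h.
have lda : hi - lo = db by rewrite hiE loE addKn.
have lo_hi : hi - db = lo by rewrite hiE loE addnK.
apply: (@ok_le _ _ _ _ _ _ _ _ (1 + (16 * db + 40))); last first.
  by rewrite /single_steps; lia.
have back_size := size_backwards x hi db.
have -> : pathw R d e (x lo) (segment x lo.+1 (hi - lo)) =
    (pathw R d e (x hi) (backwards x hi db) * 1)%R.
  by rewrite mulr1 pathw_backwards // ?lo_hi ?lda // hiE leq_addl.
rewrite -(Ew_path d e (x hi) 1%R back_size).
apply: (ok_single n_gt0 d_gt0 e_reg X_word n_X good_bounded (dst := hi)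
  (lo := lo) (hi := hi) (K := K)) => //.
- move=> cur' i' ptr' r10' m' l'.
  have [_ _ f1 e1] := fits_ends r0 r1 cur' i' ptr' r10' j o tr m'.
  have [_ f2 _ e2] := fits_vertices r0 r1 cur' i' ptr' r10' j o tr m'.
  by split; split=> //; rewrite ?hiE ?e2 //=; lia.
- by lia.
- by rewrite hiE; lia.
- by rewrite loE hiE; lia.
- by move=> m'; apply: confined_wmem_ok; lia.
- exact: confined0.
- exact: K_pmem_ok.
- exact: K_start.
- exact: K_upd.
move=> q cur' i' ptr' r10' m' p' qs Kp' G1.
have p'E a : p' a = if lo <= a <= hi then (nth (x hi) (x hi :: q) (hi - a)).+1
                    else M1 a.
  rewrite /p' fill_subE size_map /= qs; last by rewrite hiE ltnS leq_addl.
  have -> : (a <= hi < a + db.+1) = (lo <= a <= hi) by lia.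
  case: ifP => // /andP[la ah]; rewrite -map_cons (nth_map (x hi)) //= qs; lia.
apply: ok_finish => //.
  apply: (valid_stored (y := fun a => nth (x hi) (x hi :: q) (hi - a))) p'E.
  by move=> /low_t0; rewrite (negbTE nl).
case: eqP => [qE|_]; last by rewrite ler0n.
suff -> : p' = goal_memory by rewrite eqxx.
apply: memP => a; rewrite p'E goal_memoryE; case: ifP => // /andP[la ah].
by rewrite qE nth_backwards ?subKn //; lia.
Qed.

Lemma ok_uniform r0 r1 cur i ptr r10 j o tr :
  M1 t = 0 -> ~~ near_left M h t -> ~~ near_right M h t ->
  good (regs r0 r1 cur i ptr r10 j o tr) M1 mem0 ->
  ok (1 + single_steps)
    (uniform_cmd :: fin, St (regs r0 r1 cur i ptr r10 j o tr) M1 mem0)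
    (n%:R^-1)%R.
Proof.
move=> Mt nl nr Gm.
have loE : lo = t by rewrite /lo /low (negbTE nl).
have hiE : hi = t by rewrite /hi /high (negbTE nr).
apply: (@ok_le _ _ _ _ _ _ _ _ 1.+3); last by rewrite /single_steps; lia.
apply: (ok_seq good_bounded) => //.
have -> : (n%:R^-1 = n%:R^-1 * \sum_(v < n) (v == x t)%:R :> R)%R.
  rewrite (bigD1 (x t)) //= eqxx big1 ?addr0 ?mulr1 // => v vx.
  by rewrite (negbTE vx).
apply: (ok_rand_vertex good_bounded) => //; first exact: n_X.
move=> v G1; rewrite /= in G1 *; have vn := ltn_ord v; have nX := n_X.
have Kv : K (upd M1 t v.+1).
  by apply: K_upd => //; [apply: K_start | rewrite loE hiE leqnn].
apply: (ok_setp X_word good_bounded) => //=.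
- by lia.
- by do ![split=> //]; lia.
- by rewrite addn1; apply: K_pmem_ok.
rewrite addn1 => G2; have pE a : upd M1 t v.+1 a =
    if lo <= a <= hi then v.+1 else M1 a.
  by rewrite updE loE hiE eqn_leq andbC.
apply: ok_finish => //.
  apply: (valid_stored (y := fun=> v)) pE.
  by move=> /low_t0; rewrite (negbTE nl).
case: eqP => [vE|_]; last by rewrite ler0n.
suff -> : upd M1 t v.+1 = goal_memory by rewrite eqxx.
apply: memP => a; rewrite pE goal_memoryE loE hiE.
by case: ifP => // /andP[ta at_]; rewrite vE (_ : a = t) //; apply/eqP; lia.
Qed.

Definition bridge_steps := s * (24 * L) * (160 * h + 30) + 12 * s + 80 * h + 60.

Let gain : R := ((1 - delta) ^+ (3 * s + 2))%R.

Lemma ok_bridge_query r0 r1 cur i ptr r10 j o tr :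
  M1 t = 0 -> near_left M h t -> near_right M h t ->
  good (regs r0 r1 cur i ptr r10 j o tr) M1 mem0 ->
  ok (1 + bridge_steps)
    (bridge_cmd :: fin, St (regs r0 r1 cur i ptr r10 j o tr) M1 mem0)
    (gain * (n%:R * pathw R d e (x lo) (segment x lo.+1 (hi - lo))))%R.
Proof.
move=> Mt nl nr Gm.
have loE : lo = t - da by rewrite /lo /low nl.
have hiE : hi = t + db by rewrite /hi /high nr.
have dat := da_t; have da8 : da <= 8 * h by exact: left_gap_le.
have db2 := db_h; have h0 := h_gt0.
have [len2 t6] := bridge_gap n_gt0 h_gt0 M_valid t_T Mt nl nr.
rewrite -/da -/db in len2.
set len := da + db; set l1 := len %/ 2; set l2 := len - l1.
have l1h : h <= l1 by rewrite /l1 leq_divRL // mulnC.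
have l1_2 : 2 * l1 <= len by rewrite mulnC leq_divM.
have l2h : h <= l2 by rewrite /l2; lia.
have len10 : len <= 10 * h by rewrite /len; lia.
have l12 : l1 + l2 = len by rewrite /l2; lia.
have hilo : hi - lo = len by rewrite hiE loE /len; lia.
have mid : lo + l1 = hi - l2 by rewrite hiE loE; lia.
(* Split at the midpoint, with the right half read backwards from [hi], as the sampler produces
   it. *)
have pE : pathw R d e (x lo) (segment x lo.+1 (hi - lo)) =
    (pathw R d e (x lo) (segment x lo.+1 l1) *
     pathw R d e (x hi) (backwards x hi l2))%R.
  rewrite hilo -l12 /segment iotaD map_cat pathw_cat -/(segment x lo.+1 l1).
  rewrite last_segment pathw_backwards //; last by rewrite hiE; lia.
  by rewrite -mid addSn.
have lenle : s.+1 * len.+1 <= s.+1 * (10 * h).+1 by rewrite leq_mul2l ltnS len10 orbT.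
apply: (@ok_le _ _ _ _ _ _ _ _
  (1 + (s * (24 * L) * (16 * len + 30) + 12 * s + 8 * len + 60))); last first.
  rewrite leq_add2l /bridge_steps; set a := s * (24 * L).
  have : a * (16 * len + 30) <= a * (160 * h + 30) by rewrite leq_mul2l; apply/orP; right; lia.
  by lia.
rewrite pE mulrA.
have size_l : size (segment x lo.+1 l1) = l1 by rewrite size_map size_iota.
have size_r := size_backwards x hi l2.
apply: (@ok_bridge R n d e n_gt0 d_gt0 e_reg w inp bounded settled hits X X_word
  n_X pmem_ok wmem_ok good_bounded t L h s da db (x lo) (x hi) M1
  _ _ _ _ _ _ _ _ _ _ _ _ _ _ _ K _ _ _ delta
  (segment x lo.+1 l1) (backwards x hi l2)) => //.
- by rewrite -loE; apply: known_x; rewrite loE.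
- by rewrite -hiE; apply: known_x; rewrite hiE.
- by apply: leq_trans W_X; rewrite leq_add2l.
- by apply: leq_ltn_trans t_X; rewrite leq_add2l.
- move=> F0 m F0s Cm; exists F0; first by apply: leq_trans F0s _; rewrite leq_add2l.
  apply: confined_le Cm; apply: (@leq_trans (n + n.+1 * (2 * t).+1)).
    by rewrite leq_add2l; apply: leq_mul; rewrite ltnS //; lia.
  have a1 : n <= n.+1 * t.+1 by apply: leq_trans (leq_pmulr _ _).
  have a2 : n.+1 * (2 * t).+1 <= 2 * (n.+1 * t.+1).
    by rewrite mulnCA leq_mul2l /=; lia.
  by rewrite /Aw (mulSn 2); apply: leq_add.
- exact: K_pmem_ok.
- exact: K_start.
- by rewrite -loE -hiE; apply: K_upd.
- exact: mixing.
- exact: mixing.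
- by rewrite last_segment last_backwards mid.
- move=> cur' i' ptr' r10' j' o' tr' m' G1; apply: ok_finish => //.
  exact: valid_start_mem.
move=> q y cur' i' ptr' r10' j' o' tr' m' p' qs ys qy Kp' G1.
(* The stored stretch as one function of time. At the meeting time [lo + l1] the right half counts,
   being written last. *)
pose z a := if a < lo + l1 then nth (x lo) (x lo :: q) (a - lo)
            else nth (x hi) (x hi :: y) (hi - a).
have p'E a : p' a = if lo <= a <= hi then (z a).+1 else M1 a.
  rewrite /p' -loE -hiE fill_subE size_map [size _]/= ys; last by rewrite hiE; lia.
  have -> : (a <= hi < a + l2.+1) = (lo + l1 <= a <= hi) by rewrite mid; lia.
  rewrite (_ : fill Add _ lo _ a = if lo <= a < lo + l1.+1
      then (nth (x lo) (x lo :: q) (a - lo)).+1 else M1 a); last first.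
    rewrite fill_addE size_map [size _]/= qs; case: ifP => // /andP[la al].
    by rewrite (nth_map (x lo)) //= qs; lia.
  rewrite /z; case: (ltnP a (lo + l1)) => al /=; last first.
    rewrite (leq_trans (leq_addr _ _) al) /=; case: ifP => ah.
      congr S; rewrite -[LHS]/(nth 0 (map val (x hi :: y)) (hi - a)).
      by rewrite (nth_map (x hi)) //= ys; lia.
    by rewrite ifF //; apply/negbTE; lia.
  have -> : (a <= hi) = true by apply/idP; lia.
  by rewrite andbT (_ : (a < lo + l1.+1) = true) ?andbT //; apply/idP; lia.
apply: ok_finish => //.
  apply: (valid_stored (y := z)) p'E.
  move=> lo0; rewrite /z lo0 add0n ifT ?subn0 //=; last by lia.
  have := known_x nl; rewrite -/da -loE lo0.
  by rewrite /M1 startE /= => -[<-].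
case: eqP => [qE|_]; last by rewrite ler0n.
case: eqP => [yE|_]; last by rewrite ler0n.
suff -> : p' = goal_memory by rewrite eqxx.
apply: memP => a; rewrite p'E goal_memoryE; case: ifP => // /andP[la ah].
rewrite /z; case: ifP => al; last by rewrite yE nth_backwards ?subKn //; lia.
rewrite qE (_ : x lo :: _ = segment x lo l1.+1) //.
by rewrite (nth_map 0) ?size_iota ?nth_iota ?subnKC //; lia.
Qed.

Definition weight : R :=
  if near_left M h t then if near_right M h t then n%:R%R else 1%R
  else if near_right M h t then 1%R else (n%:R^-1)%R.

(** Up to mixing errors, [weight] times the path weight is the probability of the segment given its
    known ends; [gain] covers the sampling errors. A known position is returned without loss. *)
Definition query_value : R :=
  if M1 t != 0 then 1%R
  else (gain * (weight * pathw R d e (x lo) (segment x lo.+1 (hi - lo))))%R.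

Lemma gain_le (a : R) : (0 <= a -> gain * a <= a)%R.
Proof.
move=> a0; rewrite ler_piMl // exprn_ile1 //.
  by rewrite subr_ge0; apply: le_trans delta_le _; rewrite invf_le1 // ler1n.
by rewrite lerBlDr lerDl.
Qed.

Lemma ok_sample r0 r1 cur i ptr r10 j o tr :
  good (regs r0 r1 cur i ptr r10 j o tr) M1 mem0 ->
  ok (bridge_steps + single_steps + 5)
    (sample_cmd :: fin, St (regs r0 r1 cur i ptr r10 j o tr) M1 mem0)
    query_value.
Proof.
move=> Gm; have tX : t <= X by lia.
have [f1 e1 f2 e2] := fits_ends r0 r1 cur i ptr r10 j o tr mem0.
rewrite /query_value /weight.
pose N1 := (bridge_steps + single_steps + 1).
apply: (@ok_le _ _ _ _ _ _ _ _ N1.+4); last by rewrite /N1; lia.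
apply: (ok_if X_word good_bounded) => //; first by split; [| exact: M1_X].
rewrite [evn _ _ _ _ _]/=; case: (eqVneq (M1 t) 0) => /= [Mt|Mt]; last first.
  apply: (@ok_le _ _ _ _ _ _ _ _ 2); last by rewrite /N1; lia.
  apply: (ok_skip good_bounded) => //; apply: ok_finish => //.
    exact: valid_start_mem.
  by rewrite /goal_memory new_memory_known ?eqxx //; apply: known_x.
apply: (ok_if X_word good_bounded) => //; first by split=> //; exact: M1_X.
have pw0 := pathw_ge0 R d e (x lo) (segment x lo.+1 (hi - lo)).
rewrite {1}/evn -/(evn _ _ _ _ _) [evn _ _ _ _ _]e1.
rewrite -/(near_left M h t) /near_left -/da -/M1 /near_right -/db -/M1.
case: (eqVneq (M1 (t - da)) 0) => nl /=;
  apply: (ok_if X_word good_bounded) => //; try (by split=> //; exact: M1_X);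
  rewrite {1}/evn -/(evn _ _ _ _ _) [evn _ _ _ _ _]e2;
  case: (eqVneq (M1 (t + db)) 0) => nr /=.
- have loE : lo = t by rewrite /lo /low /near_left -/da -/M1 nl eqxx.
  have hiE : hi = t by rewrite /hi /high /near_right -/db -/M1 nr eqxx.
  rewrite loE hiE subnn /= mulr1.
  apply: (@ok_le _ _ _ _ _ _ _ _ (1 + single_steps)); last by rewrite /N1; lia.
  apply: (ok_weak (r := (n%:R^-1)%R)); last by apply: gain_le; rewrite invr_ge0.
  by apply: ok_uniform => //; rewrite /near_left /near_right negbK ?nl ?nr.
- rewrite mul1r.
  apply: (@ok_le _ _ _ _ _ _ _ _ (1 + single_steps)); last by rewrite /N1; lia.
  apply: (ok_weak (r := pathw R d e (x lo) (segment x lo.+1 (hi - lo)))).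
    by apply: ok_backward => //; rewrite /near_left negbK ?nl.
  exact: gain_le.
- rewrite mul1r.
  apply: (@ok_le _ _ _ _ _ _ _ _ (1 + single_steps)); last by rewrite /N1; lia.
  apply: (ok_weak (r := pathw R d e (x lo) (segment x lo.+1 (hi - lo)))).
    by apply: ok_forward => //; rewrite /near_right negbK ?nr.
  exact: gain_le.
- apply: (@ok_le _ _ _ _ _ _ _ _ (1 + bridge_steps)); last by rewrite /N1; lia.
  exact: ok_bridge_query.
Qed.

Definition query_steps :=
  bridge_steps + single_steps + 4 * L + 2 * s + 20 * h + 40.

Lemma ok_query :
  ok query_steps ([:: access_cmd], State mem0 M mem0) query_value.
Proof.
have h0 := h_gt0; have X0 : 0 < X by apply: leq_trans X_ge.
have nX := n_X; have da8 : da <= 8 * h by exact: left_gap_le.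
have db2 := db_h; have dat := da_t.
have Y_gt0 : 0 < Y by rewrite !muln_gt0 n_gt0 B_gt0 /=; lia.
have BX : B <= X.
  by apply: leq_trans Y_X; rewrite /Y mulnAC; apply: leq_pmull; rewrite muln_gt0 n_gt0; lia.
have nBX : n * B <= X by apply: leq_trans Y_X; apply: leq_pmulr; lia.
have EX : E <= X by apply: leq_trans Y_X; apply: leq_pmull; rewrite muln_gt0 n_gt0.
have LLX : L * Lam <= X by move: h_X; rewrite /h; lia.
have LX : L <= X by apply: leq_trans LLX; apply: leq_pmulr.
have LamX : Lam <= X by apply: leq_trans LLX; apply: leq_pmull.
pose r0 := nseq 14 0.
have -> : State mem0 M mem0 = St r0 M mem0.
  by rewrite /St; congr State; apply: memP => a;
     rewrite mem0E mem_of_seqE nth_nseq; case: ifP.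
have M_ok : pmem_ok M by exists [::] => //; split.
have Gm : good r0 M mem0.
  by split=> //; apply: wmem_ok0.
pose N7 := bridge_steps + single_steps + 5.
pose N6 := (N7.+1 + (2 * db).+1).+1.
pose N5 := (N6 + (2 * da).+1).+3.
pose N4 := (N5 + (2 * s).+1).+1.
pose N3 := (N4.+2 + (4 * L).+1).+1.
apply: (@ok_le _ _ _ _ _ _ _ _ N3.+3); last first.
  by rewrite /query_steps /N3 /N4 /N5 /N6 /N7; lia.
apply: (ok_if X_word good_bounded) => //=; first by do ![split=> //]; lia.
rewrite leqNgt E_gt1 /=.
apply: (ok_seq good_bounded) => //; apply: (ok_set X_word good_bounded) => //=.
move=> G1; apply: (ok_seq good_bounded) => //.
refine (ok_bitlen n_gt0 d_gt0 X_word n_X good_bounded (N := N4.+2) G1 Y_gt0 _ _ _).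
- by rewrite add0n.
- by lia.
rewrite add0n -/L => G2.
apply: (ok_seq good_bounded) => //; apply: (ok_set X_word good_bounded) => //=.
  by rewrite -/L; move: h_X; rewrite /h => hX; do ![split=> //]; lia.
rewrite -/L -/h => G3; apply: (ok_seq good_bounded) => //.
refine (ok_sqrt n_gt0 d_gt0 X_word n_X good_bounded (s := s) (N := N5) G3 _ _ _ _ _ _) => //.
  by apply: leq_ltn_trans ss_X; apply: leq_pmulr.
move=> G4; apply: (ok_seq good_bounded) => //.
apply: (ok_setp X_word good_bounded) => //=; first exact: start_pmem_ok.
rewrite -/(start M) -/M1 => G5; apply: (ok_seq good_bounded) => //.
refine (ok_search n_gt0 d_gt0 X_word n_X good_bounded (fd := da) (N := N6) G5
  _ _ _ _ _ _ _ _ _ _ _ _) => //=.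
- by move=> i _; apply: leq_trans (leq_subr _ _) _; lia.
- exact: M1_X.
- by lia.
- by lia.
- by lia.
- by move=> i; apply: left_gap_before.
- exact: left_gap_end.
move=> G6; apply: (ok_seq good_bounded) => //.
refine (ok_search n_gt0 d_gt0 X_word n_X good_bounded (fd := db) (N := N7.+1) G6
  _ _ _ _ _ _ _ _ _ _ _ _) => //=.
- by move=> i idb; lia.
- exact: M1_X.
- by lia.
- by lia.
- by lia.
- by move=> i; apply: right_gap_before.
- exact: right_gap_end.
move=> G7; apply: (ok_seq good_bounded) => //.
exact: ok_sample.
Qed.

End Query.

(** * Histories *)

Section Histories.
Variables (R : realType) (n d : nat) (e : rel 'I_n).
Hypotheses (n_gt0 : (0 < n)%N) (d_gt0 : (0 < d)%N) (e_reg : regular e d).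

Let O := graph_oracle R e.

Lemma is_dist_rand_vertex : is_dist (rand_vertex O).
Proof. by apply: is_dist_uniform; rewrite size_map size_enum_ord. Qed.

Lemma is_dist_rand_neighbor v : is_dist (rand_neighbor O v).
Proof.
rewrite /=; case: insubP => [u _ _|_]; last exact: is_dist_dret.
by apply: is_dist_uniform; rewrite size_map -cardE e_reg.
Qed.

Lemma is_dist_step w inp c : is_dist (step O w inp c).
Proof.
case: c => -[|[|y g|y g|y g|y|y g|c1 c2|g c1 c2|g c1] k] s;
  try exact: is_dist_dret.
- exact/is_dist_dmap/is_dist_rand_vertex.
- exact/is_dist_dmap/is_dist_rand_neighbor.
Qed.

Lemma is_dist_steps w inp k c : is_dist (steps O w inp k c).
Proof.
elim: k c => [|k IH] c; first exact: is_dist_dret.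
exact/is_dist_dbind/IH/is_dist_step.
Qed.

Lemma is_dist_walk k v : is_dist (walk O k v).
Proof.
elim: k v => [|k IH] v; first exact: is_dist_dret.
apply: is_dist_dbind => [|u]; first exact: is_dist_rand_neighbor.
exact/is_dist_dmap/IH.
Qed.

Lemma Ex_walk k (v : 'I_n) f :
  Ex (walk O k (val v)) f = Ew d e k v (fun q => f (map val (v :: q))).
Proof.
elim: k v f => [|k IH] v f; first by rewrite /= Ex_dret.
rewrite [walk _ _ _]/= Ex_dbind /= valK Ex_uniform size_map -cardE e_reg.
rewrite big_map big_enum /= mulr_sumr [LHS]big_mkcond /=.
apply: eq_bigr => u _; rewrite Ex_dmap IH mxE -topredE /= mulrC.
by case: (e v u); rewrite ?mul0r // div1r mulrC.
Qed.

Variables (A : algorithm R) (T h : nat) (c : R) (adv : adversary).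
Hypotheses (A_probes : probes A = O) (c_ge0 : 0 <= c) (c_le1 : c <= 1).
Hypothesis adv_T : forall z, (adv z <= T)%N.

Lemma is_dist_answer M t : is_dist (answer A M t).
Proof. by apply: is_dist_dmap; rewrite /run A_probes; apply: is_dist_steps. Qed.

Lemma is_dist_real_run r : is_dist (real_run A adv r).
Proof.
elim: r => [|r IH]; first exact: is_dist_dret.
by apply: is_dist_dbind => // z; apply/is_dist_dmap/is_dist_answer.
Qed.

Definition sim (x : seq nat) (z : history) (t : nat) : dist R memory :=
  dret R (new_memory h (last_mem z) t (nth 0%N x)).

Fixpoint replies (x : nat -> nat) (r : nat) : history :=
  if r is r'.+1 then
    let z := replies x r' in
    rcons z (adv z, x (adv z), new_memory h (last_mem z) (adv z) x)
  else [::].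

Lemma Ex_ideal_run x r f : Ex (ideal_run sim adv x r) f = f (replies (nth 0%N x) r).
Proof.
elim: r f => [|r IH] f; first by rewrite /= Ex_dret.
by rewrite Ex_dbind IH Ex_dmap Ex_dret.
Qed.

Lemma is_dist_ideal_run x r : is_dist (ideal_run sim adv x r).
Proof.
elim: r => [|r IH]; first exact: is_dist_dret.
by apply: is_dist_dbind => // z; apply/is_dist_dmap/is_dist_dret.
Qed.

Lemma last_mem_rcons z a M : last_mem (rcons z (a, M)) = M.
Proof. by rewrite /last_mem map_rcons last_rcons. Qed.

Variable v0 : 'I_n.
Hypothesis v0E : val v0 = 0%N.

Hypothesis answer_valid : forall M t, valid n h T M -> (t <= T)%N ->
  dall (fun z => valid n h T z.2) (answer A M t).

(** The quotient of the two [future] terms is the probability of the new memory given the old one.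
    The cross-multiplied form also covers an [x] that is no walk, where [future] may vanish. *)
Hypothesis answer_lower : forall M t (x : nat -> 'I_n),
  valid n h T M -> (t <= T)%N -> (forall a, allows M a (x a)) -> x 0%N = v0 ->
  let M' := new_memory h M t (fun a => val (x a)) in
  valid n h T M' /\
  c * future R d e M' 0 T v0 <=
    Pr (answer A M t) (val (x t), M') * future R d e M 0 T v0.

Lemma dall_real_run r : dall (fun z => valid n h T (last_mem z)) (real_run A adv r).
Proof.
elim: r => [|r IH] /=; first by split=> //; apply: valid_mem0.
rewrite dall_dbind; apply: dall_impl IH => z Mz; rewrite dall_dmap.
by apply: dall_impl (answer_valid Mz (adv_T z)) => y; rewrite /= last_mem_rcons.
Qed.

Section Walk.
Variable x : nat -> 'I_n.
Hypothesis x0 : x 0%N = v0.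

Let past_replies := replies (fun a => val (x a)).

Lemma replies_valid r :
  valid n h T (last_mem (past_replies r)) /\
  forall a, allows (last_mem (past_replies r)) a (x a).
Proof.
elim: r => [|r [IH1 IH2]].
  by split=> [|a]; [apply: valid_mem0 | rewrite allows_free // mem0E].
rewrite /= last_mem_rcons; have [Mv _] := answer_lower IH1 (adv_T (past_replies r)) IH2 x0.
split=> // a; rewrite /allows storeE; last by rewrite ltnW // ltnS low_high.
case: ifP => _; first by rewrite eqxx orbT.
by rewrite startE; case: (a =P 0%N) => [->|_]; [rewrite x0 v0E | apply: IH2].
Qed.

(** [answer_lower] telescopes, starting from the empty memory, for which [future] is 1. *)
Lemma real_run_lower r :
  c ^+ r * future R d e (last_mem (past_replies r)) 0 T v0 <=
    Pr (real_run A adv r) (past_replies r).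
Proof.
elim: r => [|r IH].
  rewrite expr0 mul1r Pr_Ex Ex_dret eqxx futureE later_all_free ?mulr1 //.
    by case: allows.
  by move=> a _; rewrite mem0E.
have [Mz xz] := replies_valid r.
have [_] := answer_lower Mz (adv_T (past_replies r)) xz x0.
set z := past_replies r in IH Mz xz *.
set M' := new_memory _ _ _ _ => ans.
have -> : past_replies r.+1 = rcons z (adv z, val (x (adv z)), M') by [].
rewrite last_mem_rcons Pr_Ex Ex_dbind.
set g := fun y => _.
have g0 y : 0 <= g y.
  rewrite /g -Pr_Ex; apply: Pr_ge0; exact/is_dist_dmap/is_dist_answer.
(* Of all histories after [r] queries, only [z] is kept. *)
apply: (@le_trans _ _ (Pr (real_run A adv r) z * g z)); last first.
  rewrite -[g z](Ex_dret z g); apply: Ex_lower => // y.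
  rewrite [Pr (dret _ _) _]Pr_Ex Ex_dret eq_sym.
  by case: eqP => [->|_]; rewrite ?mulr1 ?mulr0 ?Pr_ge0 //; apply: is_dist_real_run.
have -> : g z = Pr (answer A (last_mem z) (adv z)) (val (x (adv z)), M').
  rewrite /g Ex_dmap Pr_Ex; congr Ex; apply/funext => y /=.
  by rewrite eqseq_rcons eqxx /= !xpair_eqE eqxx /=; case: y.
rewrite exprSr -mulrA.
apply: le_trans (ler_wpM2l (exprn_ge0 _ c_ge0) ans) _.
rewrite mulrCA mulrC ler_wpM2r // Pr_ge0 //; exact: is_dist_answer.
Qed.

End Walk.

Let ideal r := dbind (walk O T 0) (fun x => ideal_run sim adv x r).

Lemma nth_map_val (q : seq 'I_n) a : nth 0%N (map val q) a = val (nth v0 q a).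
Proof.
case: (ltnP a (size q)) => aq; first exact: nth_map.
by rewrite !nth_default ?size_map.
Qed.

Lemma agrees_nth m (q : seq 'I_n) i :
  (forall a, allows m (i + a) (nth v0 q a)) -> agrees m i q.
Proof.
elim: q i => //= v q IH i H; apply/andP; split; first by have := H 0%N; rewrite addn0.
by apply: IH => a; have := H a.+1; rewrite addnS.
Qed.

Lemma Pr_ideal r z :
  Pr (ideal r) z = Ew d e T v0 (fun q =>
    (replies (fun a => val (nth v0 (v0 :: q) a)) r == z)%:R).
Proof.
rewrite Pr_Ex Ex_dbind -[X in walk _ _ X]v0E Ex_walk; apply: eq_Ew => q _.
rewrite Ex_ideal_run; congr ((replies _ _ == _)%:R).
by apply/funext => a; rewrite nth_map_val.
Qed.

Lemma ideal_run_upper r (x : nat -> 'I_n) : x 0%N = v0 ->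
  let z := replies (fun a => val (x a)) r in
  Pr (ideal r) z <= future R d e (last_mem z) 0 T v0.
Proof.
move=> x0 /=; set z := replies _ r; rewrite Pr_ideal -Ew_agrees; apply: Ew_le => q _.
case: eqP => [E|_]; last exact: ler0n.
rewrite agrees_nth // => a; rewrite add0n -E.
by have [_] := @replies_valid (nth v0 (v0 :: q)) erefl r; apply.
Qed.

Lemma real_run_ideal r z : c ^+ r * Pr (ideal r) z <= Pr (real_run A adv r) z.
Proof.
(* A history that no walk produces has ideal probability 0. *)
have [[q zE]|no] := pselect (exists q,
    replies (fun a => val (nth v0 (v0 :: q) a)) r = z).
  have H := @real_run_lower (nth v0 (v0 :: q)) erefl r.
  rewrite -zE; apply: le_trans H; rewrite ler_wpM2l ?exprn_ge0 //.
  exact: ideal_run_upper.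
rewrite Pr_ideal (_ : Ew _ _ _ _ _ = 0) ?mulr0.
  by apply: Pr_ge0; apply: is_dist_real_run.
rewrite -[RHS](Ew_cst d_gt0 e_reg T v0 (0 : R)); apply: eq_Ew => q _.
by case: eqP => // E; case: no; exists q.
Qed.

Lemma l1dist_transcript r :
  l1dist (dmap transcript (real_run A adv r)) (dmap transcript (ideal r))
    <= 2 * (1 - c ^+ r).
Proof.
apply: l1dist_lower.
- exact/is_dist_dmap/is_dist_real_run.
- apply/is_dist_dmap/is_dist_dbind => [|x]; first exact: is_dist_walk.
  exact: is_dist_ideal_run.
- exact: exprn_ile1.
- move=> b; rewrite !Pr_dmap; apply: Ex_lower => // z; exact: real_run_ideal.
Qed.

End Histories.

(** * The loss of a single query *)

Section Answers.
Local Open Scope nat_scope.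
Variables (R : realType) (n d : nat) (e : rel 'I_n).
Hypotheses (n_gt0 : 0 < n) (d_gt0 : 0 < d) (e_sym : symmetric e)
  (e_reg : regular e d).
Variables (B E Lam T t s : nat) (M : memory).

Let h := 9 * (bitlen (n * B * E) * Lam).
Let lo := low M h t.
Let hi := high M h t.

Hypotheses (Lam_gt0 : 0 < Lam) (t_T : t <= T) (M_valid : valid n h T M).
Variables (delta : R) (v0 : 'I_n) (x : nat -> 'I_n).
Hypotheses (delta_ge0 : (0 <= delta)%R) (delta_le : (delta <= 2^-1)%R).
Hypothesis mixing : forall l u, h <= l -> nearly_uniform d e delta l u.
Hypotheses (v0E : val v0 = 0) (x0 : x 0 = v0).
Hypothesis x_allowed : forall a, allows (start M) a (x a).

Let goal_memory := new_memory h M t (fun a => val (x a)).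

(** The walk starts at vertex 0 anyway, so recording this adds no constraint. *)
Lemma future_start : future R d e (start M) 0 T v0 = future R d e M 0 T v0.
Proof.
rewrite !futureE; congr (_ * _)%R; last first.
  by apply: (later_eq R e d_gt0) => a a0; rewrite startE; case: eqP a0 => // ->.
rewrite /allows startE v0E eqxx /=.
by have := valid0 M_valid; case: (M 0) => [|[]].
Qed.

Lemma new_memory_valid : valid n h T goal_memory.
Proof.
apply: (valid_stored n_gt0 Lam_gt0 t_T M_valid (y := x)).
  by rewrite x0.
by move=> a; rewrite storeE // leqW // low_high.
Qed.

(** The exponent adds [3 * s + 2] for sampling a bridge and 4 for the conditioning on known
    times. *)
Lemma query_value_future :
  ((1 - delta) ^+ (3 * s + 6) * future R d e goal_memory 0 T v0 <=
   query_value d e B E Lam t s M delta x * future R d e M 0 T v0)%R.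
Proof.
have h0 : 0 < h by rewrite !muln_gt0 /= Lam_gt0.
have d0 : (0 <= 1 - delta)%R by move: delta_le; lra.
rewrite /query_value; case: eqVneq => [Mt|Mt] /=; last first.
  rewrite /goal_memory new_memory_known //; last first.
    by have := x_allowed t; rewrite /allows (negbTE Mt) => /eqP.
  rewrite future_start mul1r ler_piMl ?future_ge0 //.
  by rewrite exprn_ile1 // lerBlDr lerDl.
rewrite (_ : 3 * s + 6 = (3 * s + 2) + 4); last by rewrite -addnA.
rewrite exprD -mulrA -[leRHS]mulrA ler_wpM2l ?exprn_ge0 //.
have hiT : hi <= T by exact: (high_T M_valid t_T).
have lohi := low_high M h t.
rewrite -future_start /goal_memory /new_memory.
rewrite (future_store e d_gt0 delta_ge0 delta_le v0 lohi hiT (x_allowed _)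
  (x_allowed _)) -/h -/lo -/hi.
set P := past _ _ _ _ _ _ _; set p := pathw _ _ _ _ _; set F := later _ _ _ _ _ _ _.
suff H : ((1 - delta) ^+ 4 * (P * F) <=
    weight R n B E Lam t M * future R d e (start M) 0 T v0)%R.
  rewrite (_ : _ * (P * _) = p * ((1 - delta) ^+ 4 * (P * F)))%R; last by ring.
  by rewrite [leRHS]mulrAC [leRHS]mulrC ler_wpM2l ?pathw_ge0.
have inside := @inside_gap M h t.
rewrite /weight -/h.
case: (boolP (near_left M h t)) => nl; case: (boolP (near_right M h t)) => nr.
- have loE : lo = t - left_gap M h t by rewrite /lo /low nl.
  have hiE : hi = t + right_gap M h t by rewrite /hi /high nr.
  have [len2 _] := bridge_gap n_gt0 h0 M_valid t_T Mt nl nr.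
  apply: (condition_both d_gt0 delta_ge0 delta_le mixing v0 lohi hiT inside
    (x_allowed _) (x_allowed _)) => //; rewrite -?/lo -?/hi ?loE ?hiE; try exact/eqP.
  have := left_gap_t M h t; lia.
- have loE : lo = t - left_gap M h t by rewrite /lo /low nl.
  have hiE : hi = t by rewrite /hi /high (negbTE nr).
  rewrite mul1r; apply: (condition_left d_gt0 e_reg delta_ge0 delta_le mixing v0 lohi hiT inside
    (x_allowed _) (x_allowed _)) => //; rewrite -?/lo -?/hi ?hiE //.
    by rewrite loE; apply/eqP.
  move=> a /andP[ta ah]; rewrite -(subnKC (ltnW ta)); apply: far_right nr _; lia.
- have loE : lo = t by rewrite /lo /low (negbTE nl).
  have hiE : hi = t + right_gap M h t by rewrite /hi /high nr.
  have [th _] := far_left nl (leq0n _).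
  rewrite mul1r; apply: (condition_right d_gt0 e_sym e_reg delta_ge0 delta_le
    mixing v0 lohi hiT inside
    (x_allowed _) (x_allowed _)) => //; rewrite -?/lo -?/hi ?loE //.
  + by rewrite hiE; apply/eqP.
  + by lia.
  + move=> a /andP[ta ah]; rewrite -(subKn (ltnW ah)).
    by have [] := @far_left M h t (t - a) nl; lia.
- have loE : lo = t by rewrite /lo /low (negbTE nl).
  have hiE : hi = t by rewrite /hi /high (negbTE nr).
  have [th _] := far_left nl (leq0n _).
  apply: (condition_none d_gt0 e_sym e_reg delta_ge0 delta_le mixing v0 lohi hiT inside
    (x_allowed _) (x_allowed _)) => //; rewrite -?/lo -?/hi ?loE ?hiE //.
  + by lia.
  + move=> a /andP[ta ah]; rewrite -(subKn (ltnW ah)).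
    by have [] := @far_left M h t (t - a) nl; lia.
  + move=> a /andP[ta ah]; rewrite -(subnKC (ltnW ta)); apply: far_right nr _; lia.
Qed.

End Answers.

(** * Constants *)

Section Constants.
Local Open Scope nat_scope.

Lemma ceil_sqrt n : 0 < n -> exists s, [/\ 0 < s, 2 * s.-1 <= n, s <= n,
  n <= s * s & forall i, i < s -> i * i < n].
Proof.
move=> n_gt0; have ex : exists s, n <= s * s by exists n; apply: leq_pmulr.
case: (ex_minnP ex) => s ns s_min.
have below i : i < s -> i * i < n.
  by move=> si; rewrite ltnNge; apply/negP => /s_min; rewrite leqNgt si.
have s_gt0 : 0 < s by rewrite lt0n; apply/eqP => s0; rewrite s0 in ns; lia.
exists s; split=> //; last by apply: s_min; apply: leq_pmulr.
(* With [k = s - 1]: [2 k <= k ^ 2 + 1 <= n]. *)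
have := below s.-1; rewrite ltn_predL s_gt0 => /(_ isT).
by move: (s.-1) => k; nia.
Qed.

Lemma bitlen_le_id y : 0 < y -> bitlen y <= y.
Proof.
by move=> y0; apply: leq_trans (ltn_expl _ (ltnSn 1)) _; apply: trunc_logP.
Qed.

Lemma ltn_bitlen y : y < 2 ^ bitlen y.
Proof. exact: trunc_log_ltn. Qed.

(** Bounds all numbers that occur in a query. It involves the queried time [t] and not the horizon
    [T], since registers are charged by it. *)
Definition word_bound (n B E Lam t : nat) : nat :=
  400 * (n * (n * B * E) * Lam * t.+1).

(** With [Y = n * (B + 1) * E] and [a = Lam * (T + 1)], the left side is at most [400 * Y ^ 2 * a],
    and the sixth power leaves a factor [64 * Y ^ 4 * a ^ 5] to beat 400; note [Y >= 4]. *)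
Lemma word_bound_large n B E Lam T t w :
  0 < n -> 0 < B -> 1 < E -> 0 < Lam -> t <= T ->
  (2 * n * B.+1 * E * Lam * T.+1) ^ 6 <= 2 ^ w -> word_bound n B E Lam t < 2 ^ w.
Proof.
move=> n0 B0 E1 Lam0 tT; apply: leq_trans; rewrite /word_bound.
set q := n * (n * B * E) * Lam * t.+1.
pose Y := n * B.+1 * E; pose a := Lam * T.+1.
have -> : 2 * n * B.+1 * E * Lam * T.+1 = 2 * (Y * a) by rewrite /Y /a; ring.
have a0 : 0 < a by rewrite muln_gt0 Lam0.
have nE : n <= n * E by apply: leq_pmulr; lia.
have YE : Y = n * B * E + n * E by rewrite /Y; ring.
have BE : n * E <= n * B * E by rewrite mulnAC leq_pmulr.
have E2 : 2 <= n * E by apply: leq_trans E1 (leq_pmull _ n0).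
have Y4 : 4 <= Y by lia.
have qY : q <= Y * Y * a.
  rewrite /q -mulnA; apply: leq_mul; first by apply: leq_mul; lia.
  by rewrite leq_mul2l ltnS tT orbT.
apply: (@leq_ltn_trans (400 * (Y * Y * a))); first by rewrite leq_mul2l qY orbT.
have -> : (2 * (Y * a)) ^ 6 = 64 * (Y * Y * a) * (Y ^ 4 * a ^ 5) by ring.
have Y256 : 4 ^ 4 <= Y ^ 4 by rewrite leq_exp2r.
have : 4 ^ 4 * 1 <= Y ^ 4 * a ^ 5 by apply: leq_mul; rewrite // expn_gt0 a0.
have : 0 < Y * Y * a by rewrite 2!muln_gt0 a0 andbT andbb; lia.
by move: (Y * Y * a) (Y ^ 4 * a ^ 5); nia.
Qed.

Lemma word_bound_ge n B E Lam t s (L := bitlen (n * B * E)) (h := 9 * (L * Lam)) :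
  0 < n -> 0 < B -> 1 < E -> 0 < Lam -> 0 < s -> s <= n ->
  let X := word_bound n B E Lam t in
  [/\ n * B * E <= X, 10 * h < X, s * s < X &
  [/\ n + s.+1 * (10 * h).+1 <= X, t + 2 * h < X, s * (24 * L) <= X & 24 <= X]].
Proof.
move=> n0 B0 E1 Lam0 s0 sn; rewrite /word_bound /h.
set Y := n * B * E.
have Y0 : 0 < Y by rewrite !muln_gt0 n0 B0; lia.
have LY : L <= Y by apply: bitlen_le_id.
have nY : n <= Y by rewrite /Y -mulnA leq_pmulr // muln_gt0 B0; lia.
have LLY : L * Lam <= Y * Lam by rewrite leq_mul2r LY orbT.
set u := L * Lam in LLY *; set v := Y * Lam in LLY.
have Yv : Y <= v by apply: leq_pmulr.
have -> : n * Y * Lam * t.+1 = n * v * t.+1 by rewrite /v; ring.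
have nvt : n * v <= n * v * t.+1 by apply: leq_pmulr.
have vnv : v <= n * v by apply: leq_pmull.
have tnv : v * t.+1 <= n * v * t.+1 by rewrite leq_mul2r vnv orbT.
have ss : s * s <= n * v by apply: leq_mul => //; lia.
have sL : s * L <= n * v by apply: leq_mul => //; lia.
have su : s * u <= n * v by apply: leq_mul.
have tv : t.+1 <= v * t.+1 by apply: leq_pmull; lia.
do ![split]; try lia.
Qed.

End Constants.

(** * Choice of the parameters and total error *)

Section Algorithm.
Variables (R : realType) (n d : nat) (e : rel 'I_n).
Hypotheses (n_gt0 : (0 < n)%N) (d_gt0 : (0 < d)%N) (e_sym : symmetric e)
  (e_reg : regular e d).
Variables (B E Lam T w s : nat) (lam : R) (budget : nat -> nat).

Let L := bitlen (n * B * E).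
Let h := (9 * (L * Lam))%N.
Let delta : R := 2^-1 ^+ (8 * L).

Hypotheses (lam_ge0 : 0 <= lam) (lam_spec : lambda R e d <= lam)
  (Lam_spec : 1 <= Lam%:R * (1 - lam)).
Hypotheses (B_gt0 : (0 < B)%N) (E_gt1 : (1 < E)%N).
Hypotheses (s_gt0 : (0 < s)%N) (s_half : (2 * s.-1 <= n)%N) (s_le : (s <= n)%N)
  (n_le_sqr : (n <= s * s)%N) (s_min : forall i, (i < s)%N -> (i * i < n)%N).
Hypothesis w_large : ((2 * n * B.+1 * E * Lam * T.+1) ^ 6 <= 2 ^ w)%N.
Hypothesis budget_large : forall t, (query_steps n B E Lam s <= budget t)%N.

Let A := Algorithm access_cmd (graph_oracle R e) w [:: n; B; E; Lam] budget.

Lemma Lam_gt0 : (0 < Lam)%N.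
Proof.
rewrite lt0n; apply/eqP => Lam0; move: Lam_spec.
by rewrite Lam0 mul0r ler10.
Qed.

Lemma lam_lt1 : lam < 1.
Proof.
rewrite ltNge; apply/negP => l1; move: Lam_spec.
by rewrite leNgt => /negP; apply; apply: le_lt_trans ltr01; rewrite mulr_ge0_le0 ?subr_le0.
Qed.

Lemma delta_ge0 : 0 <= delta.
Proof. by rewrite exprn_ge0 // invr_ge0. Qed.

Lemma half_le1 : (2^-1 : R) <= 1.
Proof. by rewrite invf_le1 // ler1n. Qed.

Lemma half_exp_le k l : (l <= k)%N -> (2^-1 : R) ^+ k <= 2^-1 ^+ l.
Proof. by apply: ler_wiXn2l; [rewrite invr_ge0 | apply: half_le1]. Qed.

Lemma delta_le : delta <= 2^-1.
Proof. by rewrite -[leRHS]expr1; apply: half_exp_le; rewrite muln_gt0. Qed.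

(** Three tries fail with probability at most 27/64, which is below 1/2. *)
Lemma tries_tail : ((3 / 4) ^+ (24 * L) <= delta :> R).
Proof.
rewrite (_ : 24 * L = 3 * (8 * L))%N; last by lia.
by rewrite exprM lerXn2r ?nnegrE ?exprn_ge0 //; lra.
Qed.

(** By [pow_sub_le] the power is at most [1 / (1 + Lam * (1 - lam))]. *)
Lemma lam_exp : lam ^+ Lam <= 2^-1.
Proof.
have l1 := lam_lt1; have x01 : 0 <= 1 - lam <= 1 by move: lam_ge0; lra.
have := pow_sub_le Lam x01; rewrite subKr => /le_trans; apply.
by rewrite lef_pV2 ?posrE //; move: Lam_spec; lra.
Qed.

Lemma Y_half : (n * B * E)%:R * 2^-1 ^+ L <= 1 :> R.
Proof.
rewrite exprVn ler_pdivrMr ?exprn_gt0 // mul1r -natrX ler_nat.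
exact/ltnW/ltn_bitlen.
Qed.

(** The factor 9 in [h] gives an absolute error [2 ^ (- 9 L)]. One [L] absorbs the factor [n] that
    makes the error relative to [1 / n]. *)
Lemma mixing l u : (h <= l)%N -> nearly_uniform d e delta l u.
Proof.
move=> hl z; have nR : 0 < n%:R :> R by rewrite ltr0n.
suff : n%:R * `|walk_pow R d e l u z - n%:R^-1| <= delta.
  rewrite -{1}(ger0_norm (ltW nR)) -normrM mulrBr mulfV ?gt_eqF // ler_norml.
  by move=> /andP[]; lra.
have mix := walk_pow_mixing d_gt0 e_sym e_reg lam_ge0 lam_spec l u z.
apply: le_trans (ler_wpM2l (ltW nR) mix) _.
have lam1 := ltW lam_lt1.
apply: (@le_trans _ _ (n%:R * lam ^+ h)); first by rewrite ler_pM2l // ler_wiXn2l.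
have hE : h = (Lam * (9 * L))%N by rewrite /h; lia.
apply: (@le_trans _ _ (n%:R * 2^-1 ^+ (L + 8 * L))).
  rewrite ler_pM2l // hE exprM (_ : 9 * L = L + 8 * L)%N; last by lia.
  by rewrite lerXn2r ?nnegrE ?exprn_ge0 ?invr_ge0 //; exact: lam_exp.
rewrite exprD mulrA -[leRHS]mul1r ler_wpM2r ?delta_ge0 //.
apply: le_trans Y_half; rewrite ler_wpM2r ?exprn_ge0 ?invr_ge0 //.
by rewrite ler_nat -mulnA leq_pmulr // muln_gt0 B_gt0 ltnW.
Qed.

Section Query.
Variables (t : nat) (M : memory).
Hypotheses (t_T : (t <= T)%N) (M_valid : valid n h T M).

Let X := word_bound n B E Lam t.

Lemma ok_run (x : nat -> 'I_n) : (forall a, allows (start M) a (x a)) ->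
  ok e w [:: n; B; E; Lam; t] (bounded n B E Lam t X s M) (settled n B E Lam T)
    (hits R B E Lam t M x) (budget t) ([:: access_cmd], State mem0 M mem0)
    (query_value d e B E Lam t s M delta x).
Proof.
move=> xM; apply: ok_le (budget_large t).
have [X1 X2 X3 [X4 X5 X6 X7]] := @word_bound_ge n B E Lam t s n_gt0 B_gt0 E_gt1 Lam_gt0
  s_gt0 s_le.
exact: (ok_query n_gt0 d_gt0 e_sym e_reg B_gt0 E_gt1 Lam_gt0 t_T M_valid s_gt0
  s_half s_le n_le_sqr s_min
  (word_bound_large n_gt0 B_gt0 E_gt1 Lam_gt0 t_T w_large)
  X1 X2 X3 X4 X5 X6 X7 delta_ge0 delta_le tries_tail mixing xM).
Qed.

(** Halting, validity and space do not mention target positions, but [ok_run] needs some; any that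
    are compatible with the memory will do. *)
Lemma ex_allowed : exists x : nat -> 'I_n, forall a, allows (start M) a (x a).
Proof.
exists (fun a => odflt (Ordinal n_gt0) (insub (start M a).-1)) => a.
have := valid_value (valid_start_mem n_gt0 M_valid) a; rewrite /allows.
case: (start M a) => [//|k] kn /=.
by rewrite insubT /= eqxx.
Qed.

Lemma run_halted : dall halted (run A M t (budget t)).
Proof.
have [x /ok_run/ok_steps[H _]] := ex_allowed.
by apply: dall_impl H => c [].
Qed.

Lemma answer_valid : dall (fun z => valid n h T z.2) (answer A M t).
Proof.
have [x /ok_run/ok_steps[H _]] := ex_allowed.
by rewrite /answer dall_dmap; apply: dall_impl H => c [].
Qed.

Lemma run_bounded k :
  dall (fun c : config => bounded n B E Lam t X s M c.2) (run A M t k).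
Proof. by have [x /ok_run/ok_inv H] := ex_allowed; apply: H. Qed.

Lemma answer_lower (v0 : 'I_n) (x : nat -> 'I_n) :
  val v0 = 0%N -> x 0%N = v0 -> (forall a, allows M a (x a)) ->
  let M' := new_memory h M t (fun a => val (x a)) in
  valid n h T M' /\
  (1 - delta) ^+ (3 * s + 6) * future R d e M' 0 T v0 <=
    Pr (answer A M t) (val (x t), M') * future R d e M 0 T v0.
Proof.
move=> v00 x0 xM M'.
have xM1 a : allows (start M) a (x a).
  by rewrite /allows startE; case: (a =P 0%N) => [->|_]; [rewrite x0 v00 | apply: xM].
split; first exact: (new_memory_valid n_gt0 Lam_gt0 t_T M_valid v00 x0).
apply: le_trans (query_value_future n_gt0 d_gt0 e_sym e_reg s Lam_gt0 t_T M_valid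
  delta_ge0 delta_le mixing v00 xM1) _.
rewrite ler_wpM2r ?future_ge0 //.
have [_] := ok_steps (ok_run xM1); move/le_trans; apply.
rewrite Pr_Ex Ex_dmap le_eqVlt; apply/orP; left; apply/eqP.
by congr Ex; apply/funext => c; rewrite /hits xpair_eqE.
Qed.

End Query.

Lemma access_error (adv : adversary) (r : nat) :
  (forall z, adv z <= T)%N -> (r <= B)%N ->
  l1dist (dmap transcript (real_run A adv r))
    (dmap transcript (dbind (walk (graph_oracle R e) T 0)
       (fun x => ideal_run (sim R h) adv x r))) <= 2 / E%:R.
Proof.
move=> adv_T rB; pose v0 := Ordinal n_gt0.
pose m := (3 * s + 6)%N.
have d01 : 0 <= delta <= 1.
  by rewrite delta_ge0 /= (le_trans delta_le) // half_le1.
have c0 : 0 <= (1 - delta) ^+ m by rewrite exprn_ge0 //; lra.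
have c1 : (1 - delta) ^+ m <= 1 by rewrite exprn_ile1 //; lra.
refine (le_trans (l1dist_transcript (h := h) n_gt0 d_gt0 e_reg (A := A) erefl
  c0 c1 adv_T (v0 := v0) erefl _ r) _).
  by move=> M t x Mv tT xM x0; apply: answer_lower.
(* [m * r * E] is at most [9 * n * B * E], that is [9 * 2 ^ L], so times [delta] it is at most
   [9 / 128]. *)
rewrite ler_wpM2l // -exprM; apply: (@le_trans _ _ ((m * r)%:R * delta)).
  by have := bernoulli_sub (m * r) d01; lra.
have E0 : 0 < E%:R :> R by rewrite ltr0n ltnW.
rewrite -[leRHS]mul1r ler_pdivlMr // mulrAC -natrM.
apply: (@le_trans _ _ ((9 * (n * B * E))%:R * delta)).
  rewrite ler_wpM2r ?delta_ge0 // ler_nat mulnA leq_mul2r; apply/orP; right.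
  rewrite mulnA; apply: leq_mul => //; rewrite /m (mulnDl 3 6 n).
  by rewrite leq_add ?leq_mul2l ?s_le // leq_pmulr.
have L0 : (0 < L)%N by [].
rewrite /delta (_ : 8 * L = L + 7 * L)%N; last by lia.
rewrite exprD natrM -mulrA (mulrA _ (2^-1 ^+ L)).
apply: (@le_trans _ _ (9 * (1 * 2^-1 ^+ 7))); last by rewrite mul1r; lra.
rewrite ler_wpM2l //; apply: ler_pM; rewrite ?mulr_ge0 ?exprn_ge0 ?invr_ge0 //.
  exact: Y_half.
by apply: half_exp_le; apply: leq_pmulr.
Qed.

End Algorithm.

(** * Costs *)

Section Logarithms.
Variable R : realType.

Lemma nceil_bounds (x : R) : 0 <= x -> x <= (nceil x)%:R < x + 1.
Proof.
move=> x0; have c0 : 0 <= Num.ceil x by rewrite ceil_ge0; apply: lt_le_trans x0.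
have -> : (nceil x)%:R = (Num.ceil x)%:~R :> R by rewrite pmulrn gez0_abs.
have /andP[lo ->] := ceil_itv x; move: lo; rewrite intrB; lra.
Qed.

Lemma ln2_ge : 2^-1 <= ln 2 :> R.
Proof.
rewrite -[leLHS]expRK ler_ln ?posrE ?expR_gt0 //.
have := expR_ge1Dx (- 2^-1 : R); rewrite expRN => h.
rewrite -[leLHS]invrK -[leRHS]invrK lef_pV2 ?posrE ?invr_gt0 ?expR_gt0 //; lra.
Qed.

Lemma bitlen_ln (x : nat) (y : R) : 1 <= y -> x%:R <= y ->
  (bitlen x)%:R <= 1 + 2 * ln y.
Proof.
move=> y1 xy; have lny : 0 <= ln y by rewrite ln_ge0.
have [x0|x0] := posnP x; first by rewrite x0 /bitlen trunc_log0; lra.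
rewrite /bitlen -natr1 addrC lerD2l.
set k := trunc_log 2 x; have kx : (2 ^ k <= x)%N by apply: trunc_logP.
have y0 : 0 < y by lra.
have : ln (2 ^+ k) <= ln y.
  rewrite ler_ln ?posrE ?exprn_gt0 //; apply: le_trans xy.
  by rewrite -natrX ler_nat.
rewrite lnXn // -[_ *+ k]mulr_natl => kl.
have : k%:R * 2^-1 <= k%:R * ln 2 :> R by rewrite ler_wpM2l // ln2_ge.
lra.
Qed.

Lemma ge1_ge0 (x : R) : 1 <= x -> 0 <= x.
Proof. exact: le_trans ler01. Qed.

Lemma lg_ge1 (x : R) : 1 <= lg x.
Proof. by rewrite /lg le_max lexx. Qed.

Lemma ln_le_lg (x : R) : ln x <= lg x.
Proof. by rewrite /lg le_max lexx orbT. Qed.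

End Logarithms.

(** The final summation of [steps_cost]: [q] is sqrt n times [b], [m] is [b * mu], and [u] is the
    dominant term. *)
Lemma linear_cost (R : realFieldType) (u x y z sigma b q m : R) :
  u <= 528 * q * (40 * 1000 * m) -> x <= 198 * m -> y <= 11 * b -> z <= 2 * sigma ->
  q <= q * m -> m <= q * m -> sigma <= q -> b <= q -> 1 <= q ->
  u + (14 * z + 228 * x + 4 * y + 140) <= 10 ^+ 8 * (q * m).
Proof. lra. Qed.

Section Costs.
Variables (R : realType) (eps lam : R) (n B t s : nat).
Hypotheses (eps_gt0 : 0 < eps) (lam_ge0 : 0 <= lam) (lam_lt1 : lam < 1).
Hypotheses (n_gt0 : (0 < n)%N) (B_gt0 : (0 < B)%N).

Let E := nceil (2 / eps).
Let Lam := nceil (1 - lam)^-1.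
Let Y := (n * B * E)%N.
Let L := bitlen Y.
Let h := (9 * (L * Lam))%N.

Let a : R := lg ((n * maxn t 1)%:R).
Let b : R := lg (n%:R * B%:R / eps).
Let mu := (1 - lam)^-1.
Let sigma : R := Num.sqrt n%:R.

Lemma mu_ge1 : 1 <= mu.
Proof. by rewrite invf_ge1 ?subr_gt0 // lerBlDr lerDl. Qed.

Lemma sigma_ge1 : 1 <= sigma.
Proof. by rewrite -(sqrtr1 R) ler_wsqrtr // ler1n. Qed.

Lemma Lam_cost : (1 <= Lam)%N /\ Lam%:R <= 2 * mu.
Proof.
have m1 := mu_ge1; have /andP[l1 l2] := nceil_bounds (le_trans ler01 m1).
split; last by move: l1 l2; rewrite -/mu -/Lam; lra.
by rewrite -(ler_nat R); apply: le_trans m1 l1.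
Qed.

Lemma Lam_large : 1 <= Lam%:R * (1 - lam).
Proof.
have m1 := mu_ge1; have /andP[l1 _] := nceil_bounds (le_trans ler01 m1).
have l0 : 0 < 1 - lam by rewrite subr_gt0.
by rewrite -(ler_pdivrMr _ _ l0) mul1r.
Qed.

Hypothesis E_gt1 : (1 < E)%N.

(** Rounding up at most doubles [2 / eps], because [E > 1] forces [2 / eps > 1]. *)
Lemma E_cost : E%:R <= 4 / eps.
Proof.
have e0 : 0 <= 2 / eps by rewrite divr_ge0 // ltW.
have /andP[_ l2] := nceil_bounds e0.
have : 1 < 2 / eps.
  rewrite ltNge; apply/negP => e1; move: E_gt1; rewrite ltnNge => /negP; apply.
  have E_le : Num.ceil (2 / eps) <= 1 by rewrite ceil_le_int.
  have c0 : 0 <= Num.ceil (2 / eps) by rewrite ceil_ge0; apply: lt_le_trans e0.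
  by rewrite /E /nceil -lez_nat gez0_abs.
by move: l2; rewrite -/E (_ : 4 / eps = 2 / eps + 2 / eps); [lra | field; rewrite gt_eqF].
Qed.

Lemma Y_ln : 1 <= Y%:R :> R /\ ln (Y%:R : R) <= 4 + b.
Proof.
have Y1 : 1 <= Y%:R :> R.
  by rewrite ler1n !muln_gt0 n_gt0 B_gt0 ltnW.
split=> //; have z0 : 0 < n%:R * B%:R / eps by rewrite divr_gt0 // mulr_gt0 // ltr0n.
apply: (@le_trans _ _ (ln (4 * (n%:R * B%:R / eps)))).
  rewrite ler_ln ?posrE ?(lt_le_trans ltr01 Y1) ?(mulr_gt0 _ z0) //.
  rewrite /Y !natrM (_ : 4 * _ = n%:R * B%:R * (4 / eps)); last by ring.
  by rewrite ler_wpM2l // E_cost.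
rewrite lnM ?posrE // lerD ?ln_le_lg // ltW // ln_sublinear // ltr0n.
Qed.

Lemma L_cost : L%:R <= 11 * b.
Proof.
have [Y1 Yb] := Y_ln; have := bitlen_ln Y1 (lexx _).
by have := lg_ge1 (n%:R * B%:R / eps); rewrite -/b; lra.
Qed.

Lemma h_cost : h%:R <= 198 * (b * mu).
Proof.
rewrite /h !natrM; have [_ l2] := Lam_cost.
rewrite (_ : 198 * _ = 9 * ((11 * b) * (2 * mu))); last by ring.
by rewrite ler_wpM2l // ler_pM // L_cost.
Qed.

Lemma nt_ln : 1 <= (n * maxn t 1)%:R :> R /\ ln ((n * maxn t 1)%:R : R) <= a.
Proof. by rewrite ler1n muln_gt0 n_gt0 leq_max orbT ln_le_lg. Qed.

Lemma bitlen_cost (x k : nat) : (0 < k)%N -> (x <= k * (n * maxn t 1))%N ->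
  (bitlen x)%:R <= 1 + 2 * (k%:R + a).
Proof.
move=> k0 xk; have [m1 ma] := nt_ln.
have k1 : 1 <= k%:R :> R by rewrite ler1n.
set m := (n * maxn t 1)%N in xk m1 ma *.
have km : 1 <= (k * m)%:R :> R by rewrite natrM mulr_ege1.
apply: le_trans (bitlen_ln km _) _; first by rewrite ler_nat.
rewrite lerD2l ler_pM2l // natrM lnM ?posrE ?(lt_le_trans ltr01) //.
by apply: lerD => //; apply/ltW/ln_sublinear; apply: lt_le_trans k1.
Qed.

(** The logarithm of [Lam] is generously replaced by [2 * mu]: only fourteen registers are charged
    for full words. *)
Lemma word_cost :
  (bitlen (word_bound n B E Lam t))%:R <= 1620 * (a * (b * mu)).
Proof.
have [Y1 Yb] := Y_ln; have [m1 ma] := nt_ln; have [L1 L2] := Lam_cost.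
have a1 : 1 <= a by apply: lg_ge1.
have b1 : 1 <= b by apply: lg_ge1.
have mu1 := mu_ge1.
have Lam1 : 1 <= Lam%:R :> R by rewrite ler1n.
set m := (n * maxn t 1)%N in m1 ma *.
have [k kE] : exists k, k = 800%N by exists 800%N.
have k800 : k%:R = 800 :> R by rewrite kE.
have k1 : 1 <= k%:R :> R by rewrite kE ler1n.
pose z : R := k%:R * (m%:R * (Y%:R * Lam%:R)).
have p0 (x : R) : 1 <= x -> x \is Num.pos by rewrite posrE; apply: lt_le_trans.
have YL : 1 <= Y%:R * Lam%:R :> R by rewrite mulr_ege1.
have mYL : 1 <= m%:R * (Y%:R * Lam%:R) :> R by rewrite mulr_ege1.
have z1 : 1 <= z by rewrite mulr_ege1.
have : (bitlen (word_bound n B E Lam t))%:R <= 1 + 2 * ln z.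
  apply: bitlen_ln => //; rewrite /z -!natrM ler_nat /word_bound -/Y /m.
  have tm : (t.+1 <= 2 * maxn t 1)%N by clear; lia.
  rewrite kE (_ : 800 * _ = 400 * (n * Y * Lam * (2 * maxn t 1)))%N.
    by rewrite !leq_mul2l tm !orbT.
  by ring.
have lnz : ln z = ln k%:R + (ln m%:R + (ln Y%:R + ln Lam%:R)).
  by rewrite /z !lnM // ?p0.
have lLam : ln (Lam%:R : R) <= 2 * mu.
  by apply/ltW; apply: lt_le_trans L2; apply: ln_sublinear; apply: lt_le_trans Lam1.
have lk : ln (k%:R : R) <= k%:R by apply/ltW/ln_sublinear/(lt_le_trans ltr01 k1).
have ab : 1 <= a * (b * mu) by rewrite !mulr_ege1.
have a_ab : a <= a * (b * mu) by rewrite ler_peMr ?mulr_ege1 // ge1_ge0.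
have bm : b * mu <= a * (b * mu) by rewrite ler_peMl ?mulr_ge0 // ge1_ge0.
have b_bm : b <= b * mu by rewrite ler_peMr // ge1_ge0.
have m_bm : mu <= b * mu by rewrite ler_peMl // ge1_ge0.
by rewrite lnz; move: k800; lra.
Qed.

Lemma pspace_cost :
  ((10 * h + 2) * (bitlen (2 * t) + bitlen n))%:R <=
    10 ^+ 8 * pspace_bound eps B lam n t.
Proof.
have a1 : 1 <= a by apply: lg_ge1.
have b1 : 1 <= b by apply: lg_ge1.
have mu1 := mu_ge1.
have b2t := @bitlen_cost (2 * t) 2 isT; have bn := @bitlen_cost n 1 isT.
have t_le : (2 * t <= 2 * (n * maxn t 1))%N.
  by rewrite leq_mul2l /=; apply: leq_trans (leq_maxl t 1) (leq_pmull _ n_gt0).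
have n_le : (n <= 1 * (n * maxn t 1))%N by rewrite mul1n leq_pmulr // leq_max orbT.
have : (bitlen (2 * t) + bitlen n)%:R <= 12 * a.
  by rewrite natrD; have := b2t t_le; have := bn n_le; lra.
have : (10 * h + 2)%:R <= 1982 * (b * mu).
  rewrite natrD natrM; have := h_cost; have : 1 <= b * mu by rewrite mulr_ege1.
  lra.
move=> h1 h2; rewrite natrM; apply: le_trans (ler_pM _ _ h1 h2) _ => //.
rewrite /pspace_bound -/a -/b -/mu (_ : _ * (12 * a) = 1982 * 12 * (a * mu * b)); last by ring.
by rewrite ler_wpM2r ?mulr_ge0 //; lra.
Qed.

Hypotheses (s_gt0 : (0 < s)%N) (s_min : forall i, (i < s)%N -> (i * i < n)%N).

Lemma s_cost : s%:R <= 2 * sigma.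
Proof.
have s1 := sigma_ge1.
have : (s.-1 * s.-1 < n)%N by apply: s_min; rewrite ltn_predL.
move/ltnW; rewrite -(ler_nat R) natrM -expr2 => s2.
have : s.-1%:R <= sigma by rewrite -(ger0_norm (ler0n R s.-1)) -sqrtr_sqr ler_wsqrtr.
by rewrite -[in s%:R](prednK s_gt0) -natr1; lra.
Qed.

Lemma time_boundE : time_bound eps B lam n t = a * (sigma * b * (b * mu)).
Proof. by rewrite /time_bound -/a -/b -/mu -/sigma; ring. Qed.

(** Dominated by the two families of [s * (24 * L)] attempts of length O(h). The factor [a] of the
    bound is slack here. *)
Lemma steps_cost :
  (query_steps n B E Lam s)%:R <= 10 ^+ 8 * time_bound eps B lam n t.
Proof.
have a1 : 1 <= a by apply: lg_ge1.
have b1 : 1 <= b by apply: lg_ge1.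
have mu1 := mu_ge1; have si1 := sigma_ge1.
have hc := h_cost; have sc := s_cost; have Lc := L_cost.
set m := b * mu in hc *; have m1 : 1 <= m by rewrite mulr_ege1.
have sb1 : 1 <= sigma * b by rewrite mulr_ege1.
set q := sigma * b in sb1 *.
have -> : query_steps n B E Lam s = (s * (24 * L) * (160 * h + 30) +
    (14 * s + 228 * h + 4 * L + 140))%N.
  rewrite /query_steps /bridge_steps /single_steps -/Y -/L -/h; clear; lia.
have : (s * (24 * L))%:R <= 528 * q.
  rewrite !natrM (_ : 528 * q = (2 * sigma) * (24 * (11 * b))); last by rewrite /q; ring.
  by rewrite ler_pM // ?mulr_ge0 // ler_wpM2l.
have : (160 * h + 30)%:R <= 40 * 1000 * m by rewrite natrD natrM; lra.
move=> h1 h2; have := ler_pM (ler0n R _) (ler0n R _) h2 h1.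
have qm : q <= q * m by rewrite ler_peMr // ge1_ge0.
have mq : m <= q * m by rewrite ler_peMl // ge1_ge0.
have sq : sigma <= q by rewrite ler_peMr // ge1_ge0.
have bq : b <= q by rewrite ler_peMl // ge1_ge0.
rewrite time_boundE -/q -/m; move=> h3.
apply: (@le_trans _ _ (10 ^+ 8 * (q * m))); last first.
  by rewrite ler_wpM2l ?exprn_ge0 // ler_peMl // mulr_ge0 // ge1_ge0.
have lin (u x y z : nat) : (u + (14 * x + 228 * y + 4 * z + 140))%:R =
    u%:R + (14 * x%:R + 228 * y%:R + 4 * z%:R + 140) :> R.
  by rewrite 4!natrD 3!natrM.
rewrite (lin (s * (24 * L) * (160 * h + 30))%N s h L) [X in X + _]natrM.
exact: (linear_cost h3 hc Lc sc qm mq sq bq sb1).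
Qed.

(** About [s + 1] walks of length at most [10 h] are stored; here [a] pays for the bits of a
    cell. *)
Lemma wspace_cost :
  (14 * (bitlen 14 + bitlen (word_bound n B E Lam t)) +
   (s + s.+1 * (10 * h).+1) * (bitlen (3 * (n.+1 * t.+1)) + bitlen n))%:R <=
    10 ^+ 8 * time_bound eps B lam n t.
Proof.
have a1 : 1 <= a by apply: lg_ge1.
have b1 : 1 <= b by apply: lg_ge1.
have mu1 := mu_ge1; have si1 := sigma_ge1.
have hc := h_cost; have sc := s_cost.
have wc := word_cost.
set m := b * mu in hc wc *; have m1 : 1 <= m by rewrite mulr_ege1.
have bA := @bitlen_cost (3 * (n.+1 * t.+1)) 12 isT; have bn := @bitlen_cost n 1 isT.
have A_le : (3 * (n.+1 * t.+1) <= 12 * (n * maxn t 1))%N.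
  have n2 : (n.+1 <= 2 * n)%N by move: n_gt0; clear; lia.
  have t2 : (t.+1 <= 2 * maxn t 1)%N by clear; lia.
  by have := leq_mul n2 t2; clear; lia.
have n_le : (n <= 1 * (n * maxn t 1))%N by rewrite mul1n leq_pmulr // leq_max orbT.
have h1 : (bitlen (3 * (n.+1 * t.+1)) + bitlen n)%:R <= 32 * a.
  by rewrite natrD; have := bA A_le; have := bn n_le; lra.
have h2 : (10 * h).+1%:R <= 1981 * m by rewrite -natr1 natrM; lra.
have h3 : s.+1%:R <= 3 * sigma by rewrite -natr1; lra.
have sm : sigma <= sigma * m by rewrite ler_peMr // ge1_ge0.
have h4 : (s + s.+1 * (10 * h).+1)%:R <= 6 * 1000 * (sigma * m).
  rewrite natrD natrM; have := ler_pM (ler0n R _) (ler0n R _) h3 h2; lra.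
have h5 := ler_pM (ler0n R _) (ler0n R _) h4 h1.
rewrite time_boundE -/m; set q := sigma * b.
have q1 : 1 <= q by rewrite mulr_ege1.
have [q0 m0 a0] := And3 (ge1_ge0 q1) (ge1_ge0 m1) (ge1_ge0 a1).
have mq : m <= q * m by rewrite ler_peMl.
have smq : sigma * m <= q * m.
  by rewrite ler_wpM2r // ler_peMr // ge1_ge0.
have am : a * m <= a * (q * m) by rewrite ler_wpM2l.
have asm : a * (sigma * m) <= a * (q * m) by rewrite ler_wpM2l.
have a_am : 1 <= a * (q * m) by rewrite !mulr_ege1.
rewrite natrD [X in _ + X]natrM natrM natrD.
have b14 : bitlen 14 = 4 by [].
rewrite b14; move: h5; set u := _%:R * _%:R; set v := _%:R in wc *.
rewrite -/a; lra.
Qed.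

End Costs.

(** * Degenerate parameters, and the theorem *)

Section Trivial.
Variables (R : realType) (n d : nat) (e : rel 'I_n).
Hypotheses (n_gt0 : (0 < n)%N) (d_gt0 : (0 < d)%N) (e_reg : regular e d).

Lemma l1dist_le2 (A : eqType) (D D' : dist R A) :
  is_dist D -> is_dist D' -> l1dist D D' <= 2.
Proof.
move=> HD HD'; have := @l1dist_lower R A D D' 0 HD HD' ler01.
by rewrite subr0 mulr1; apply => x; rewrite mul0r Pr_ge0.
Qed.

Lemma l1dist_start (A : algorithm R) T simulator adv :
  l1dist (dmap transcript (real_run A adv 0))
    (dmap transcript (dbind (walk (graph_oracle R e) T 0)
       (fun x => ideal_run simulator adv x 0))) <= 0.
Proof.
rewrite -[leRHS](mulr0 2) -(subrr 1).
have Hw := is_dist_walk R d_gt0 e_reg T 0.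
apply: l1dist_lower => //.
- exact/is_dist_dmap/is_dist_dret.
- by apply/is_dist_dmap/is_dist_dbind => // x; apply: is_dist_dret.
move=> z; rewrite mul1r !Pr_dmap Ex_dbind /= Ex_dret.
by rewrite /Ex -mulr_suml (proj2 Hw) mul1r.
Qed.

Lemma ok_void w B E Lam t M : (1 < 2 ^ w)%N -> (E <= 1)%N ->
  ok e w [:: n; B; E; Lam; t] (fun st => st = State mem0 M mem0) (fun=> True)
    (fun=> 0 : R) 2 ([:: access_cmd], State mem0 M mem0) 0.
Proof.
move=> w1 E1.
have G : good 1 0 (eq M) (eq mem0) [::] M mem0 by split.
have Inv l p m : good 1 0 (eq M) (eq mem0) l p m -> St l p m = State mem0 M mem0.
  by move=> [/size0nil -> _ <- <-].
rewrite -(Inv _ _ _ G); apply: (ok_if w1 Inv) => //=.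
  by rewrite E1.
rewrite E1 /=; apply: (ok_skip Inv) => //.
Qed.

End Trivial.

Theorem theorem3p1 (R : realType) :
  exists (P : cmd) (c : nat) (C : R),
  forall (eps : R) (B : nat) (lam : R),
    0 < eps -> 0 <= lam -> lam < 1 ->
  forall (n d : nat) (e : rel 'I_n),
    (0 < n)%N -> (0 < d)%N -> symmetric e -> regular e d ->
    lambda R e d <= lam ->
  forall T w : nat, word_large c eps B lam n T w ->
  let pspace t := C * pspace_bound eps B lam n t in
  let tspace t := C * time_bound eps B lam n t in
  let A := Algorithm P (graph_oracle R e) w (inputs eps B lam n)
             (fun t => Num.truncn (tspace t)) in
  local_access A T eps B /\ within_resources A T B pspace tspace.
Proof.
(* The exponent 6 comes from [word_bound_large]; [10 ^+ 8] covers both space bounds and the time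
   bound. *)
exists access_cmd, 6, (10 ^+ 8) => eps B lam eps0 lam0 lam1 n d e n0 d0 e_sym e_reg.
move=> lam_spec T w w_large pspace tspace A.
pose E := nceil (2 / eps); pose Lam := nceil (1 - lam)^-1.
pose h := (9 * (bitlen (n * B * E) * Lam))%N.
have [s [s0 s_half s_le n_sqr s_min]] := ceil_sqrt n0.
have [L1 _] := Lam_cost lam0 lam1.
have e2 : 0 < 2 / eps by rewrite divr_gt0.
have /andP[E_lo _] := nceil_bounds (ltW e2).
have E0 : (0 < E)%N by rewrite -(ltr_nat R); apply: lt_le_trans E_lo.
have tspace_ge1 t : 10 ^+ 8 <= tspace t.
  rewrite -[leLHS]mulr1 ler_wpM2l ?exprn_ge0 //.
  rewrite time_boundE !mulr_ege1 ?lg_ge1 ?sigma_ge1 ?mu_ge1 //.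
have pspace_ge0 t : 0 <= pspace t.
  rewrite mulr_ge0 ?exprn_ge0 // !mulr_ge0 ?ge1_ge0 ?lg_ge1 ?mu_ge1 //.
have AD r adv : is_dist (dmap transcript (real_run A adv r)).
  exact/is_dist_dmap/(is_dist_real_run n0 d0 e_reg).
(* In this case [eps >= 2], and the program stops at once. *)
have [E_le1|E_gt1] := leqP E 1.
  have eps2 : 2 <= eps.
    have : 2 / eps <= 1 by apply: le_trans E_lo _; rewrite lern1.
    by rewrite ler_pdivrMr // mul1r.
  have w1 : (1 < 2 ^ w)%N.
    apply: leq_trans w_large; rewrite -[X in (X < _)%N](exp1n 6) ltn_exp2r //.
    by rewrite -!mulnA leq_pmulr // !muln_gt0 n0 E0 L1.
  have okM t M := @ok_void R n e w B E Lam t M w1 E_le1.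
  have bud t : (2 <= budget A t)%N.
    rewrite truncn_ge_nat; first by apply: le_trans (tspace_ge1 t); lra.
    by apply: le_trans (tspace_ge1 t); rewrite exprn_ge0.
  split.
    exists (sim R 0); first by move=> *; apply: is_dist_dret.
    move=> adv r adv_T rB; apply: le_trans eps2; apply: l1dist_le2 => //.
    apply/is_dist_dmap/is_dist_dbind => [|x]; first exact: (is_dist_walk R d0 e_reg).
    exact: is_dist_ideal_run.
  move=> adv r adv_T rB.
  have H M t : query_within A pspace tspace M t.
    have H := okM t M; split.
      have [D _] := ok_steps (ok_le H (bud t)).
      by apply: dall_impl D => c' [].
    move=> k; have := ok_inv H k; apply: dall_impl => c' -> /=.
    rewrite lerDl pspace_ge0 space_mem0; split=> //.
    by apply: le_trans (tspace_ge1 t); rewrite exprn_ge0.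
  by elim: (real_run A adv r) => //= p D IH; split.
(* For [B = 0] only the empty run is compared, and no query is charged. *)
case: (posnP B) => [B0|B0].
  split=> [|adv r _]; last by rewrite B0.
  exists (sim R 0); first by move=> *; apply: is_dist_dret.
  move=> adv r _; rewrite B0 leqn0 => /eqP ->.
  by apply: le_trans (ltW eps0); apply: (l1dist_start d0 e_reg).
have bud t : (query_steps n B E Lam s <= budget A t)%N.
  rewrite truncn_ge_nat; first exact: steps_cost.
  by apply: le_trans (tspace_ge1 t); rewrite exprn_ge0.
have Ll := Lam_large lam0 lam1.
split.
  exists (sim R h); first by move=> *; apply: is_dist_dret.
  move=> adv r adv_T rB.
  apply: le_trans (access_error n0 d0 e_sym e_reg lam0 lam_spec Ll B0 E_gt1 s0
    s_half s_le n_sqr s_min w_large bud adv_T rB) _.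
  rewrite ler_pdivrMr ?ltr0n // mulrC -ler_pdivrMr //.
move=> adv r adv_T rB.
have av M t : valid n h T M -> (t <= T)%N ->
    dall (fun z => valid n h T z.2) (answer A M t).
  move=> Mv tT; exact: (answer_valid n0 d0 e_sym e_reg lam0 lam_spec Ll B0 E_gt1
    s0 s_half s_le n_sqr s_min w_large bud).
apply: dall_impl (dall_real_run (A := A) adv_T av r) => z Mz.
have tT := adv_T z; move: (last_mem z) (adv z) Mz tT => M t Mz tT; split.
  exact: (run_halted n0 d0 e_sym e_reg lam0 lam_spec Ll B0 E_gt1 s0 s_half s_le
    n_sqr s_min w_large bud tT Mz).
move=> k; have := run_bounded n0 d0 e_sym e_reg lam0 lam_spec Ll B0 E_gt1 s0 s_half
  s_le n_sqr s_min w_large bud tT Mz k.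
apply: dall_impl => c' [pb wb]; split.
  apply: (@le_trans _ _ (Defs.space M +
      (10 * h + 2) * (bitlen (2 * t) + bitlen n))%N%:R).
    by rewrite ler_nat.
  by rewrite natrD lerD2l; apply: pspace_cost.
apply: le_trans (wspace_cost t eps0 lam0 lam1 n0 B0 E_gt1 s0 s_min).
by rewrite ler_nat.
Qed.
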